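(* Consider problem $(\mathbf{PS})$ under the standing assumptions (1)–(8) listed in the context. Define $$M_X := (\|x_0\| + T M_B)e^{T M_A}, \quad M_P := 2 \alpha T |C| (|C| M_X + M_{\Omega'}) e^{T M_A},$$ $$C_X := (G_A M_X + G_B) e^{M_A T},\quad C_E := \tfrac{1}{2} C_X T (M_P G_A + \alpha |C|^2 C_X T),\quad \beta_0 := \tfrac{1}{2} M_P(H_A M_X + H_B) + C_E .$$ If $\beta > \beta_0$, then, for any continuous initial control $u^{(0)}:[0,T]\to U$, the Method of Successive Approximations (described in the context) generates a sequence of continuous controls $\{u^{(k)}\}$ and the sequences of state and adjoint variables $\{x^{(k)}\}$ and $\{p^{(k)}\}$ that correspond to $\{u^{(k)}\}$. Moreover, there exists a subsequence indexed by $\{k_j\}$ such that $u^{(k_j)} \to u^*$, $x^{(k_j)} \to x^*$, and $p^{(k_j)} \to p^*$ uniformly on $[0,T] \times \Omega$, where $x^*$ and $p^*$ are the state and adjoint variables that correspond to $u^*$, and the triple $(x^*, p^*, u^* )$ satisfies the maximum condition $$H(x^*(t,\cdot), p^*(t,\cdot), u^*(t), t) = \max_{u \in U} H(x^*(t,\cdot), p^*(t,\cdot), u, t) \quad\text{for a.e. } t\in[0,T].$$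
   Context: Problem $(\mathbf{PS})$. Let $T,\alpha,\beta>0$. $\mathbb{E}_\omega$ denotes integration over $\Omega$ with respect to the probability measure $\mu$. Controls are measurable functions $u:[0,T]\to U\subseteq\mathbb{R}^m$ (independent of $\omega$). The state variable $x$ corresponding to $u$ solves, for each $\omega$, $$\dot{x}(t, \omega) = A(t, \omega; u(t))\, x(t, \omega) + B(t, \omega; u(t)),\quad t \in [0, T], \qquad x(0, \omega) = x_0(\omega)\in\mathbb{R}^n,$$ and the adjoint variable $p$ corresponding to $u$ (and $x$) solves $$\dot{p}(t, \omega) = - A(t, \omega; u(t))^\top p(t, \omega) + 2 \alpha C^\top (Cx(t, \omega) - \mathcal{F}(\omega)(t)),\quad t\in[0,T],\qquad p(T,\omega)=0.$$ $(\mathbf{PS})$ is to minimize over all controls the cost $J(u(\cdot)) = \int_0^T \mathbb{E}_{\omega} [ \alpha |C x(t, \omega) - \mathcal{F}(\omega)(t)|^2 + \beta |u(t)|^2 ] \, \mathrm{d}t$. The Hamiltonian is $$H(x(t, \cdot), p(t, \cdot), u, t) := \mathbb{E}_{\omega} \left[ p(t, \omega) \cdot \left( A(t, \omega; u) x(t, \omega) + B(t, \omega; u) \right) - \alpha |C x(t, \omega) - \mathcal{F}(\omega)(t)|^2 - \beta |u|^2 \right].$$ Method of Successive Approximations. Input: a continuous control $u^{(0)}:[0,T]\to U$. For $k=0,1,2,\dots$: let $x^{(k)}$ be the state variable corresponding to $u^{(k)}$; let $p^{(k)}$ be the adjoint variable corresponding to $u^{(k)}$ and $x^{(k)}$; and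 choose $u^{(k+1)}$ with values in $U$ such that for all $t\in[0,T]$, $$H(x^{(k)}(t,\cdot), p^{(k)}(t,\cdot), u^{(k+1)}(t), t) = \max_{u \in U} H(x^{(k)}(t,\cdot), p^{(k)}(t,\cdot), u, t).$$ Norms: $|\cdot|$ is the Euclidean norm of vectors and the spectral norm of matrices; $\|\cdot\|$ is the supremum norm of a function, with $\|x_0\|=\sup_{\omega\in\Omega}|x_0(\omega)|$; $\|\cdot\|_{\mathrm{op}}$ is the operator norm. For derivatives in $u$: $D_uA(t,\omega;u)[v]=\sum_i v_i\,\partial A/\partial u_i$, $D_u^2A(t,\omega;u)[v,w]=\sum_{i,j}v_iw_j\,\partial^2A/\partial u_i\partial u_j$, $\|D_uA\|_{\mathrm{op}}=\sup_{|v|=1}|D_uA[v]|$, $\|D_u^2A\|_{\mathrm{op}}=\sup_{|v|=|w|=1}|D_u^2A[v,w]|$, and likewise for $B$. Standing assumptions: (1) $\Omega$ is a compact and convex subset of $\tilde\Omega$, a bounded open subset of $C([0,T];\mathbb{R}^d)$ with the supremum norm; $\Sigma$ is the Borel $\sigma$-algebra on $\Omega$; $\mu$ is an arbitrary fixed probability measure on $(\Omega,\Sigma)$. (2) $\Omega'$ is a compact subset of $C([0,T];\mathbb{R}^{d'})$ with the supremum norm; in particular there is $M_{\Omega'}>0$ with $\|\omega'\|\le M_{\Omega'}$ for all $\omega'\in\Omega'$. (3) $\mathcal{F}:\tilde\Omega\to\Omega'$ and $x_0:\tilde\Omega\to\mathbb{R}^n$ are continuously Fréchet differentiable. (4) $U$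 is a nonempty, convex and compact subset of $\mathbb{R}^m$. (5) $A:[0,T]\times\tilde\Omega\times U\to\mathbb{R}^{n\times n}$ and $B:[0,T]\times\tilde\Omega\times U\to\mathbb{R}^n$ are jointly continuous, and there are $M_A,M_B>0$ with $|A(t,\omega;u)|\le M_A$, $|B(t,\omega;u)|\le M_B$ everywhere. (6) $A$ and $B$ are twice continuously differentiable in $u$, and $G_A:=\sup\|D_uA\|_{\mathrm{op}}$, $G_B:=\sup\|D_uB\|_{\mathrm{op}}$, $H_A:=\sup\|D_u^2A\|_{\mathrm{op}}$, $H_B:=\sup\|D_u^2B\|_{\mathrm{op}}$ (suprema over $[0,T]\times\tilde\Omega\times U$) are finite. Moreover there are moduli of continuity $\theta_A,\theta_B$ such that for all $t,s\in[0,T]$, $\sup_{(\omega,u)\in\tilde\Omega\times U}\|D_uA(t,\omega;u)-D_uA(s,\omega;u)\|_{\mathrm{op}}\le\theta_A(|t-s|)$ and $\sup_{(\omega,u)\in\tilde\Omega\times U}\|D_uB(t,\omega;u)-D_uB(s,\omega;u)\|_{\mathrm{op}}\le\theta_B(|t-s|)$. (7) $A$ and $B$ are Fréchet differentiable in $\omega$, with $\partial_\omega A$, $\partial_\omega B$ continuous and $\sup_{[0,T]\times\tilde\Omega\times U}\|\partial_\omega A\|_{\mathrm{op}}<\infty$, $\sup_{[0,T]\times\tilde\Omega\times U}\|\partial_\omega B\|_{\mathrm{op}}<\infty$. (8) $C\in\mathbb{R}^{d'\times n}$ is a constant matrix of full column rank, $d'\ge n$. *)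

(* Defs.v *)
From HB Require Import structures.
From mathcomp Require Import all_boot all_order all_algebra.
From mathcomp Require Import all_classical all_reals all_analysis.
From mathcomp Require Import ring.

Set Implicit Arguments.
Unset Strict Implicit.
Unset Printing Implicit Defensive.

Import Order.TTheory GRing.Theory Num.Theory.
Import numFieldNormedType.Exports.

Local Open Scope classical_set_scope.
Local Open Scope ring_scope.

(* The library norm on matrices is the max norm, hence the explicit Euclidean
   and spectral norms. *)
Section Norms.
Context {R : realType}.

Definition dot {n} (v w : 'cV[R]_n) : R := \sum_i v i 0 * w i 0.

Definition enorm {n} (v : 'cV[R]_n) : R := Num.sqrt (\sum_i v i 0 ^+ 2).

Definition spnorm {p q} (M : 'M[R]_(p, q)) : R :=
  sup [set enorm (M *m v) | v in [set v | enorm v <= 1]].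

(* Operator norms of v |-> sum_i v_i D_i and (v, w) |-> sum_(i, j) v_i w_j D_ij
   for a norm N on the codomain. *)
Definition opnorm1 {m} {W : lmodType R} (N : W -> R) (D : 'I_m -> W) : R :=
  sup [set N (\sum_i v i 0 *: D i) | v in [set v : 'cV[R]_m | enorm v = 1]].

Definition opnorm2 {m} {W : lmodType R} (N : W -> R) (D : 'I_m -> 'I_m -> W) : R :=
  sup [set N (\sum_i \sum_j (z.1 i 0 * z.2 j 0) *: D i j) |
        z in [set z : 'cV[R]_m * 'cV[R]_m | enorm z.1 = 1 /\ enorm z.2 = 1]].

Lemma enorm_ge0 n (v : 'cV[R]_n) : 0 <= enorm v.
Proof. exact: sqrtr_ge0. Qed.

Lemma enorm_sqr n (v : 'cV[R]_n) : enorm v ^+ 2 = \sum_i v i 0 ^+ 2.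
Proof. by rewrite sqr_sqrtr // sumr_ge0 // => i _; exact: sqr_ge0. Qed.

Lemma enorm0 n : enorm (0 : 'cV[R]_n) = 0.
Proof.
by rewrite /enorm big1 ?sqrtr0 // => i _; rewrite mxE expr0n.
Qed.

Lemma enorm_eq0 n (v : 'cV[R]_n) : enorm v = 0 -> v = 0.
Proof.
move=> v0; have /eqP := enorm_sqr v; rewrite v0 expr0n eq_sym psumr_eq0; last first.
  by move=> i _; exact: sqr_ge0.
move=> /allP v0'; apply/colP => i; rewrite mxE.
by have := v0' i (mem_index_enum i); rewrite /= sqrf_eq0 => /eqP.
Qed.

Lemma enormZ n a (v : 'cV[R]_n) : enorm (a *: v) = `|a| * enorm v.
Proof.
rewrite /enorm -sqrtr_sqr -sqrtrM ?sqr_ge0 // mulr_sumr.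
by congr Num.sqrt; apply: eq_bigr => i _; rewrite mxE exprMn.
Qed.

Lemma dot_le n (v w : 'cV[R]_n) : dot v w <= enorm v * enorm w.
Proof.
have key a b : 2 * a * b * dot v w <= a ^+ 2 * enorm v ^+ 2 + b ^+ 2 * enorm w ^+ 2.
  rewrite !enorm_sqr /dot !mulr_sumr -big_split /=; apply: ler_sum => i _.
  rewrite -subr_ge0.
  have -> : a ^+ 2 * v i 0 ^+ 2 + b ^+ 2 * w i 0 ^+ 2 - 2 * a * b * (v i 0 * w i 0)
     = (a * v i 0 - b * w i 0) ^+ 2.
    by ring.
  exact: sqr_ge0.
have [v0|v0] := eqVneq (enorm v) 0.
  rewrite v0 mul0r (enorm_eq0 v0) /dot big1 // => i _.
  by rewrite mxE mul0r.
have [w0|w0] := eqVneq (enorm w) 0.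
  rewrite w0 mulr0 (enorm_eq0 w0) /dot big1 // => i _.
  by rewrite mxE mulr0.
have vp : 0 < enorm v by rewrite lt_neqAle eq_sym v0 enorm_ge0.
have wp : 0 < enorm w by rewrite lt_neqAle eq_sym w0 enorm_ge0.
have := key (enorm w) (enorm v).
have -> : enorm w ^+ 2 * enorm v ^+ 2 + enorm v ^+ 2 * enorm w ^+ 2
   = 2 * enorm w * enorm v * (enorm v * enorm w).
  by ring.
by rewrite ler_pM2l // !mulr_gt0.
Qed.

Lemma enormD n (v w : 'cV[R]_n) : enorm (v + w) <= enorm v + enorm w.
Proof.
rewrite -(@ler_pXn2r _ 2) ?nnegrE ?addr_ge0 ?enorm_ge0 //.
rewrite sqrrD !enorm_sqr.
have -> : \sum_i (v + w) i 0 ^+ 2 =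
    \sum_i v i 0 ^+ 2 + dot v w *+ 2 + \sum_i w i 0 ^+ 2.
  rewrite /dot -sumrMnl -!big_split /=; apply: eq_bigr => i _.
  by rewrite mxE sqrrD.
by rewrite lerD2r lerD2l lerMn2r dot_le orbT.
Qed.

Lemma enorm_continuous n : continuous (enorm : 'cV[R]_n -> R).
Proof.
have sq : continuous (fun v : 'cV[R]_n => \sum_i v i 0 ^+ 2).
  apply: continuous_big => [|i _ v]; first exact: add_continuous.
  have c := @coord_continuous R n 1 i 0 v.
  exact: (@continuous_comp _ _ _ _ (fun x : R => x ^+ 2) v c (@exprn_continuous R 2 _)).
by move=> v; exact: (@continuous_comp _ _ _ _ Num.sqrt v (sq v) (@sqrt_continuous R _)).
Qed.

End Norms.

(* C([0,T]; R^d) with the supremum norm.  An element is represented by its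
   extension by 0 outside [0,T], so that Leibniz equality is equality on [0,T]. *)
Section Paths.
Context {R : realType} (T : R) (d : nat).

Definition is_cpath : {pred R -> 'cV[R]_d} :=
  mem [set f : R -> 'cV[R]_d | {within `[0, T], continuous f} /\
                               forall t, ~ `[0, T]%classic t -> f t = 0].

Record cpath := CPath { cpath_fun :> R -> 'cV[R]_d; _ : cpath_fun \in is_cpath }.

HB.instance Definition _ := [isSub for cpath_fun].
HB.instance Definition _ := [Choice of cpath by <:].

Lemma is_cpath_submod : submod_closed is_cpath.
Proof.
split=> [|a f g].
  rewrite inE; split=> // t; exact: cvg_cst.
rewrite !inE => -[cf f0] [cg g0]; split=> [t|t tT]; last first.
  by change (a *: f t + g t = 0); rewrite (f0 _ tT) (g0 _ tT) addr0 scaler0.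
apply: (@continuousD _ _ _ (fun s : subspace `[0, T]%classic => a *: f s) g t); last exact: cg.
by apply: continuousZr; exact: cf.
Qed.

HB.instance Definition _ :=
  GRing.isSubmodClosed.Build R (R -> 'cV[R]_d) is_cpath is_cpath_submod.
HB.instance Definition _ := [SubChoice_isSubLmodule of cpath by <:].

Definition cpath_norm (f : cpath) : R := sup [set enorm (f t) | t in `[0, T]].

Lemma cpathP (f : cpath) :
  {within `[0, T], continuous f} /\ forall t, ~ `[0, T]%classic t -> f t = 0.
Proof. by have := valP f; rewrite inE. Qed.

Lemma cpath_norm_ubound (f : cpath) : has_ubound [set enorm (f t) | t in `[0, T]].
Proof.
have [T0|T0] := leP 0 T; last first.
  exists 0 => r [t] /=; rewrite in_itv /= => /andP[t0 tT].
  by have := lt_le_trans T0 (le_trans t0 tT); rewrite ltxx.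
have cf : {within `[0, T], continuous (fun t => enorm (f t))}.
  move=> t; exact: (@continuous_comp _ _ _ (f : subspace `[0, T]%classic -> _)
    enorm t ((cpathP f).1 t) (@enorm_continuous R d (f t))).
have [c _ fc] := EVT_max T0 cf.
by exists (enorm (f c)) => _ [t tT <-]; exact: fc.
Qed.

Lemma cpath_norm_ub (f : cpath) t : 0 <= t <= T -> enorm (f t) <= cpath_norm f.
Proof.
by move=> tT; apply: ub_le_sup; [exact: cpath_norm_ubound|exists t => //=; rewrite in_itv].
Qed.

Lemma cpath_norm_le (f : cpath) (c : R) : 0 <= c ->
  (forall t, 0 <= t <= T -> enorm (f t) <= c) -> cpath_norm f <= c.
Proof.
move=> c0 fc; have [T0|T0] := leP 0 T; last first.
  rewrite /cpath_norm set_itv_ge ?image_set0 ?sup0 //.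
  by rewrite bnd_simp -ltNge.
apply: ge_sup; first by exists (enorm (f 0)); exists 0 => //=; rewrite in_itv /= lexx.
by move=> r [t] /=; rewrite in_itv /= => tT <-; exact: fc.
Qed.

Lemma cpath_norm_ge0 (f : cpath) : 0 <= cpath_norm f.
Proof.
have [T0|T0] := leP 0 T; last first.
  rewrite /cpath_norm set_itv_ge ?image_set0 ?sup0 //.
  by rewrite bnd_simp -ltNge.
by apply: le_trans (enorm_ge0 (f 0)) (cpath_norm_ub _ _); rewrite lexx.
Qed.

Lemma cpath_normD (f g : cpath) : cpath_norm (f + g) <= cpath_norm f + cpath_norm g.
Proof.
apply: cpath_norm_le => [|t tT]; first by rewrite addr_ge0 ?cpath_norm_ge0.
by apply: le_trans (enormD _ _) (lerD _ _); exact: cpath_norm_ub.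
Qed.

Lemma cpath_normZ a (f : cpath) : cpath_norm (a *: f) = `|a| * cpath_norm f.
Proof.
have le b (g : cpath) : cpath_norm (b *: g) <= `|b| * cpath_norm g.
  apply: cpath_norm_le => [|t tT]; first by rewrite mulr_ge0 ?cpath_norm_ge0.
  by rewrite /= enormZ ler_wpM2l // cpath_norm_ub.
apply/eqP; rewrite eq_le le /=; have [->|a0] := eqVneq a 0.
  by rewrite normr0 mul0r cpath_norm_ge0.
rewrite -ler_pdivlMl ?normr_gt0 // -normfV.
by apply: le_trans (le _ _); rewrite scalerA mulVf // scale1r.
Qed.

Lemma cpath_norm0_eq0 (f : cpath) : cpath_norm f = 0 -> f = 0.
Proof.
move=> f0; apply/val_inj/funext => t /=.
have [tT|tT] := pselect (`[0, T]%classic t); last exact: (cpathP f).2.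
apply: enorm_eq0; apply/eqP; rewrite eq_le enorm_ge0 andbT -f0.
by apply: cpath_norm_ub; move: tT; rewrite /= in_itv.
Qed.

HB.instance Definition _ :=
  Lmodule_isNormed.Build R cpath cpath_normD cpath_normZ cpath_norm0_eq0.

End Paths.

Section Calculus.
Context {R : realType}.

Definition modulus_of_continuity (theta : R -> R) : Prop :=
  [/\ theta 0 = 0,
      forall r, 0 <= r -> 0 <= theta r,
      forall r s, 0 <= r -> r <= s -> theta r <= theta s
    & theta r @[r --> 0^'+] --> 0].

Definition abs_continuous {V : normedModType R} (a b : R) (f : R -> V) : Prop :=
  forall e : R, 0 < e -> exists2 delta : R, 0 < delta &
    forall (N : nat) (l r : 'I_N -> R),
      (forall i, a <= l i /\ l i <= r i /\ r i <= b) ->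
      trivIset setT (fun i => `]l i, r i[%classic) ->
      \sum_i (r i - l i) < delta ->
      \sum_i `|f (r i) - f (l i)| < e.

(* A map given on a convex set U, possibly with empty interior, has partial
   derivatives df at the points of U: the limit is taken inside U, so nothing
   is required of f outside U.  When U has nonempty interior, df is unique. *)
Definition has_partials_on {m} {W : normedModType R}
    (U : set 'cV[R]_m) (f : 'cV[R]_m -> W) (df : 'cV[R]_m -> 'I_m -> W) : Prop :=
  forall u, U u ->
    (fun v => f v - f u - \sum_i (v - u) i 0 *: df u i)
      =o_ (within U (nbhs u)) (fun v => v - u).

Definition C2_on {m} {W : normedModType R} (U : set 'cV[R]_m)
    (f : 'cV[R]_m -> W) (df : 'cV[R]_m -> 'I_m -> W)
    (ddf : 'cV[R]_m -> 'I_m -> 'I_m -> W) : Prop :=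
  [/\ has_partials_on U f df,
      forall j, has_partials_on U (fun u => df u j) (fun u i => ddf u i j)
    & forall i j, {within U, continuous (fun u => ddf u i j)}].

(* Continuity on D and boundedness on D, for the operator norm, of a family of
   linear maps.  These do not depend on the choice of equivalent norms. *)
Definition op_continuous_on {Z : topologicalType} {V W : normedModType R}
    (D : set Z) (L : Z -> V -> W) : Prop :=
  forall z, D z -> forall e : R, 0 < e ->
    \forall z' \near within D (nbhs z),
      forall h, `|L z' h - L z h| <= e * `|h|.

Definition op_bounded_on {Z : Type} {V W : normedModType R}
    (D : set Z) (L : Z -> V -> W) : Prop :=
  exists K : R, forall z, D z -> forall h, `|L z h| <= K * `|h|.

Definition C1_on {V W : normedModType R} (D : set V) (f : V -> W) : Prop :=
  (forall w, D w -> differentiable f w) /\ op_continuous_on D (fun w => 'd f w).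

End Calculus.

Notation Borel V := (g_sigma_algebraType (@open V)).

(* mu is a Borel measure on the ambient path space, concentrated on Om (see
   measure_Om below).  duA t w u i is the partial derivative of A(t, w; .) at
   u along the i-th coordinate, duuA t w u i j the one along i then j. *)
Record problem (R : realType) (d d' m n : nat) := Problem {
  hT : R;
  alpha : R;
  beta : R;
  Omt : set (cpath hT d);
  Om : set (cpath hT d);
  Om' : set (cpath hT d');
  mu : probability (Borel (cpath hT d)) R;
  F : cpath hT d -> cpath hT d';
  x0 : cpath hT d -> 'cV[R]_n;
  U : set 'cV[R]_m;
  A : R -> cpath hT d -> 'cV[R]_m -> 'M[R]_n;
  B : R -> cpath hT d -> 'cV[R]_m -> 'cV[R]_n;
  C : 'M[R]_(d', n);
  duA : R -> cpath hT d -> 'cV[R]_m -> 'I_m -> 'M[R]_n;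
  duuA : R -> cpath hT d -> 'cV[R]_m -> 'I_m -> 'I_m -> 'M[R]_n;
  duB : R -> cpath hT d -> 'cV[R]_m -> 'I_m -> 'cV[R]_n;
  duuB : R -> cpath hT d -> 'cV[R]_m -> 'I_m -> 'I_m -> 'cV[R]_n;
  M_A : R;
  M_B : R;
  M_Om' : R
}.

Arguments Omt {R d d' m n} P : rename.
Arguments Om {R d d' m n} P : rename.
Arguments Om' {R d d' m n} P : rename.
Arguments mu {R d d' m n} P : rename.
Arguments F {R d d' m n} P : rename.
Arguments x0 {R d d' m n} P : rename.
Arguments U {R d d' m n} P : rename.
Arguments A {R d d' m n} P : rename.
Arguments B {R d d' m n} P : rename.
Arguments C {R d d' m n} P : rename.
Arguments duA {R d d' m n} P : rename.
Arguments duuA {R d d' m n} P : rename.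
Arguments duB {R d d' m n} P : rename.
Arguments duuB {R d d' m n} P : rename.

Section Assumptions.
Context {R : realType} {d d' m n : nat} (P : problem R d d' m n).

Let I : set R := `[0, hT P].

Definition domain : set (R * cpath (hT P) d * 'cV[R]_m) :=
  (I `*` Omt P) `*` U P.

Definition duA_norms : set R :=
  [set opnorm1 spnorm (duA P z.1.1 z.1.2 z.2) | z in domain].
Definition duB_norms : set R :=
  [set opnorm1 enorm (duB P z.1.1 z.1.2 z.2) | z in domain].
Definition duuA_norms : set R :=
  [set opnorm2 spnorm (duuA P z.1.1 z.1.2 z.2) | z in domain].
Definition duuB_norms : set R :=
  [set opnorm2 enorm (duuB P z.1.1 z.1.2 z.2) | z in domain].

Definition G_A : R := sup duA_norms.
Definition G_B : R := sup duB_norms.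
Definition H_A : R := sup duuA_norms.
Definition H_B : R := sup duuB_norms.

Definition dwA (z : R * cpath (hT P) d * 'cV[R]_m) : cpath (hT P) d -> 'M[R]_n :=
  'd (fun w : cpath (hT P) d => A P z.1.1 w z.2) (z.1.2).
Definition dwB (z : R * cpath (hT P) d * 'cV[R]_m) : cpath (hT P) d -> 'cV[R]_n :=
  'd (fun w : cpath (hT P) d => B P z.1.1 w z.2) (z.1.2).

Record standing_assumptions : Prop := {
  hT_gt0 : 0 < hT P;
  alpha_gt0 : 0 < alpha P;
  beta_gt0 : 0 < beta P;

  Omt_open : open (Omt P);
  Omt_bounded : bounded_set (Omt P);
  Om_Omt : Om P `<=` Omt P;
  Om_compact : compact (Om P);
  Om_convex : convex_set (Om P);
  measure_Om : mu P (Om P) = 1%E;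

  Om'_compact : compact (Om' P);
  MOm'_gt0 : 0 < M_Om' P;
  Om'_bound : forall w, Om' P w -> `|w| <= M_Om' P;

  F_Om' : forall w, Omt P w -> Om' P (F P w);
  F_C1 : C1_on (Omt P) (F P);
  x0_C1 : C1_on (Omt P) (x0 P);

  U_neq0 : U P !=set0;
  U_convex : convex_set (U P);
  U_compact : compact (U P);

  A_continuous : {within domain, continuous (fun z => A P z.1.1 z.1.2 z.2)};
  B_continuous : {within domain, continuous (fun z => B P z.1.1 z.1.2 z.2)};
  MA_gt0 : 0 < M_A P;
  MB_gt0 : 0 < M_B P;
  A_bound : forall t w u, domain (t, w, u) -> spnorm (A P t w u) <= M_A P;
  B_bound : forall t w u, domain (t, w, u) -> enorm (B P t w u) <= M_B P;

  A_C2 : forall t w, I t -> Omt P w -> C2_on (U P) (A P t w) (duA P t w) (duuA P t w);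
  B_C2 : forall t w, I t -> Omt P w -> C2_on (U P) (B P t w) (duB P t w) (duuB P t w);
  GA_finite : has_ubound duA_norms;
  GB_finite : has_ubound duB_norms;
  HA_finite : has_ubound duuA_norms;
  HB_finite : has_ubound duuB_norms;
  duA_modulus : exists2 theta : R -> R, modulus_of_continuity theta &
    forall t s w u, domain (t, w, u) -> domain (s, w, u) ->
      opnorm1 spnorm (fun i => duA P t w u i - duA P s w u i) <= theta `|t - s|;
  duB_modulus : exists2 theta : R -> R, modulus_of_continuity theta &
    forall t s w u, domain (t, w, u) -> domain (s, w, u) ->
      opnorm1 enorm (fun i => duB P t w u i - duB P s w u i) <= theta `|t - s|;

  A_diff : forall t w u, domain (t, w, u) -> differentiable (fun w' => A P t w' u) w;
  B_diff : forall t w u, domain (t, w, u) -> differentiable (fun w' => B P t w' u) w;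
  dwA_continuous : op_continuous_on domain dwA;
  dwB_continuous : op_continuous_on domain dwB;
  dwA_bounded : op_bounded_on domain dwA;
  dwB_bounded : op_bounded_on domain dwB;

  dims : (n <= d')%N;
  C_rank : \rank (C P) = n
}.

Definition x0_norm : R := sup [set enorm (x0 P w) | w in Om P].

Definition M_X : R := (x0_norm + hT P * M_B P) * expR (hT P * M_A P).
Definition M_P : R :=
  2 * alpha P * hT P * spnorm (C P) * (spnorm (C P) * M_X + M_Om' P) *
  expR (hT P * M_A P).
Definition C_X : R := (G_A * M_X + G_B) * expR (M_A P * hT P).
Definition C_E : R :=
  2^-1 * C_X * hT P * (M_P * G_A + alpha P * spnorm (C P) ^+ 2 * C_X * hT P).
Definition beta0 : R := 2^-1 * M_P * (H_A * M_X + H_B) + C_E.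

End Assumptions.

Section Dynamics.
Context {R : realType} {d d' m n : nat} (P : problem R d d' m n).

Let I : set R := `[0, hT P].
Let trajectory := R -> cpath (hT P) d -> 'cV[R]_n.

Definition is_control (u : R -> 'cV[R]_m) : Prop :=
  (forall i, measurable_fun I (fun t => u t i 0)) /\ (forall t, I t -> U P (u t)).

(* Controls are merely measurable, so the differential equations are understood
   in the sense of Caratheodory: absolutely continuous solutions satisfying the
   equation for almost every t. *)
Definition is_state (u : R -> 'cV[R]_m) (x : trajectory) : Prop :=
  forall w, Om P w ->
  [/\ abs_continuous 0 (hT P) (x^~ w),
      x 0 w = x0 P w
    & {ae lebesgue_measure, forall t : R, I t ->
        is_derive t 1 (x^~ w) (A P t w (u t) *m x t w + B P t w (u t))}].

Definition is_adjoint (u : R -> 'cV[R]_m) (x p : trajectory) : Prop :=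
  forall w, Om P w ->
  [/\ abs_continuous 0 (hT P) (p^~ w),
      p (hT P) w = 0
    & {ae lebesgue_measure, forall t : R, I t ->
        is_derive t 1 (p^~ w)
          (- ((A P t w (u t))^T *m p t w) +
           (2 * alpha P) *: ((C P)^T *m (C P *m x t w - F P w t)))}].

Definition hamiltonian (x p : cpath (hT P) d -> 'cV[R]_n) (u : 'cV[R]_m) (t : R) : R :=
  \int[mu P]_(w in Om P)
    (dot (p w) (A P t w u *m x w + B P t w u)
     - alpha P * enorm (C P *m x w - F P w t) ^+ 2 - beta P * enorm u ^+ 2).

Definition maximizes_hamiltonian (x p : trajectory) (u : R -> 'cV[R]_m) (t : R) : Prop :=
  U P (u t) /\
  forall v, U P v -> hamiltonian (x t) (p t) v t <= hamiltonian (x t) (p t) (u t) t.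

Definition is_MSA (u0 : R -> 'cV[R]_m) (u : nat -> R -> 'cV[R]_m)
    (x p : nat -> trajectory) : Prop :=
  [/\ u 0%N = u0,
      forall k, is_state (u k) (x k),
      forall k, is_adjoint (u k) (x k) (p k)
    & forall k t, I t -> maximizes_hamiltonian (x k) (p k) (u k.+1) t].

End Dynamics.

Arguments is_state {R d d' m n} P u x.
Arguments is_adjoint {R d d' m n} P u x p.
Arguments hamiltonian {R d d' m n} P x p u t.
Arguments maximizes_hamiltonian {R d d' m n} P x p u t.
Arguments is_MSA {R d d' m n} P u0 u x p.

(* Main.v *)
(* Set kappa := beta - M_P (H_A M_X + H_B) / 2.  For fixed t the Hamiltonian is
   strongly concave in u with constant kappa, so a maximizer u^+ satisfies
   H(u^+) - H(v) >= kappa |u^+ - v|^2 for all v in U.  Comparing two times, this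
   makes u^(k+1) continuous in t, with a modulus independent of k, because the
   state and adjoint variables are Lipschitz in t with constants depending only
   on the problem.

   By duality between state and adjoint, J(u^(k+1)) - J(u^(k)) equals minus the
   time integral of the gain in the Hamiltonian, which is at least
   kappa int |u^(k+1) - u^(k)|^2, plus terms of second order in the difference of
   states, which are at most C_E int |u^(k+1) - u^(k)|^2.  Since beta > beta_0
   means kappa > C_E and J >= 0, these integrals tend to 0, and by
   equicontinuity u^(k+1) - u^(k) -> 0 uniformly.  Extract a uniformly convergent
   subsequence of u^(k) and pass to the limit in the maximum condition, in which
   u^(k_j + 1) has the same limit as u^(k_j).

   Controls being continuous, a Caratheodory solution is a classical one; all
   time integrals are therefore handled as primitives. *)

Require Import Defs.
From mathcomp Require Import all_boot all_order all_algebra.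
From mathcomp Require Import all_classical all_reals all_analysis.
From mathcomp Require Import measurable_realfun ring lra.

Set Implicit Arguments.
Unset Strict Implicit.
Unset Printing Implicit Defensive.

Import Order.TTheory GRing.Theory Num.Theory.
Import numFieldNormedType.Exports.

Local Open Scope classical_set_scope.
Local Open Scope ring_scope.

(** * Euclidean, spectral and operator norms *)

(** The order of the two integrations shapes the argument. Duality holds for each [w] separately,
    whereas the maximum condition speaks only of the expectation over [Om] at a fixed time. The cost
    is therefore kept as the expectation of pathwise primitives in time, and the integrals are
    exchanged once, as an inequality in one direction, for the gain in the Hamiltonian.

    The constant [C_E] bounds the remainder of the duality identity, [alpha |C dx|^2 - p . (dA dx)],
    where [dx], [dA], [du] are the changes of state, coefficient and control. Gronwall gives
    [|dx(t)| <= C_X y(t)] with [y' = |du|] and [y(0) = 0], and Cauchy-Schwarz gives [y(t)^2 <= t Q],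
    where [Q] is the integral of [|du|^2]. Integrating [y y'] and [t Q] produces the factors
    [T Q / 2] and [T^2 Q / 2].

    Since [U] may have empty interior and nothing is known outside it, derivatives in the control
    are taken only along segments of [U], and concavity is used as an inequality on chords. *)

Section EuclideanNorms.
Context {R : realType}.

(** [sup] is 0 by convention on an empty or unbounded set, so the sign does not depend on
    finiteness; [spnorm], [G_A], [G_B], [H_A], [H_B] and [x0_norm] get theirs this way. *)
Lemma sup_ge0 (E : set R) : (forall x, E x -> 0 <= x) -> 0 <= sup E.
Proof.
move=> E0; have [hE|/sup_out ->//] := pselect (has_sup E).
by have [x Ex] := hE.1; apply: le_trans (E0 x Ex) _; exact: (ub_le_sup hE.2).
Qed.

Lemma dotC n (v w : 'cV[R]_n) : dot v w = dot w v.
Proof. by apply: eq_bigr => i _; rewrite mulrC. Qed.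

Lemma dotDr n (v w z : 'cV[R]_n) : dot v (w + z) = dot v w + dot v z.
Proof.
by rewrite /dot -big_split; apply: eq_bigr => i _; rewrite mxE mulrDr.
Qed.

Lemma dotZr n a (v w : 'cV[R]_n) : dot v (a *: w) = a * dot v w.
Proof.
by rewrite /dot mulr_sumr; apply: eq_bigr => i _; rewrite mxE mulrCA.
Qed.

Lemma dotNr n (v w : 'cV[R]_n) : dot v (- w) = - dot v w.
Proof. by rewrite -scaleN1r dotZr mulN1r. Qed.

Lemma dotBr n (v w z : 'cV[R]_n) : dot v (w - z) = dot v w - dot v z.
Proof. by rewrite dotDr dotNr. Qed.

Lemma dotDl n (v w z : 'cV[R]_n) : dot (v + w) z = dot v z + dot w z.
Proof. by rewrite dotC dotDr !(dotC z). Qed.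

Lemma dotZl n a (v w : 'cV[R]_n) : dot (a *: v) w = a * dot v w.
Proof. by rewrite dotC dotZr dotC. Qed.

Lemma dotNl n (v w : 'cV[R]_n) : dot (- v) w = - dot v w.
Proof. by rewrite dotC dotNr dotC. Qed.

Lemma dotBl n (v w z : 'cV[R]_n) : dot (v - w) z = dot v z - dot w z.
Proof. by rewrite dotDl dotNl. Qed.

Lemma dot0r n (v : 'cV[R]_n) : dot v 0 = 0.
Proof. by rewrite -(scale0r 0) dotZr mul0r. Qed.

Lemma dot0l n (v : 'cV[R]_n) : dot 0 v = 0.
Proof. by rewrite dotC dot0r. Qed.

Lemma dotvv n (v : 'cV[R]_n) : dot v v = enorm v ^+ 2.
Proof. by rewrite enorm_sqr; apply: eq_bigr => i _; rewrite expr2. Qed.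

Lemma dot_trmx p q (M : 'M[R]_(p, q)) v w : dot (M^T *m v) w = dot v (M *m w).
Proof.
rewrite /dot; under eq_bigr do rewrite mxE mulr_suml.
rewrite exchange_big; apply: eq_bigr => i _ /=; rewrite mxE mulr_sumr.
by apply: eq_bigr => j _; rewrite mxE; ring.
Qed.

Lemma enormN n (v : 'cV[R]_n) : enorm (- v) = enorm v.
Proof. by rewrite -scaleN1r enormZ normrN normr1 mul1r. Qed.

Lemma enorm_distrC n (v w : 'cV[R]_n) : enorm (v - w) = enorm (w - v).
Proof. by rewrite -enormN opprB. Qed.

Lemma enormB n (v w : 'cV[R]_n) : enorm (v - w) <= enorm v + enorm w.
Proof. by rewrite -(enormN w) enormD. Qed.

Lemma dot_norm_le n (v w : 'cV[R]_n) : `|dot v w| <= enorm v * enorm w.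
Proof. by rewrite ler_norml dot_le lerNl -dotNl -(enormN v) dot_le. Qed.

Lemma enorm_sqrD n (v w : 'cV[R]_n) :
  enorm (v + w) ^+ 2 = enorm v ^+ 2 + 2 * dot v w + enorm w ^+ 2.
Proof. by rewrite -!dotvv dotDl !dotDr (dotC w v); ring. Qed.

Lemma coord_le_enorm n (v : 'cV[R]_n) i : `|v i 0| <= enorm v.
Proof.
rewrite -(@ler_pXn2r _ 2) ?nnegrE ?enorm_ge0 // enorm_sqr real_normK ?num_real //.
by rewrite (bigD1 i) //= lerDl sumr_ge0 // => j _; exact: sqr_ge0.
Qed.

Lemma coord_le_norm p q (M : 'M[R]_(p, q)) i j : `|M i j| <= `|M|.
Proof.
by rewrite [leRHS]/Num.Def.normr/= mx_normrE; exact: (le_bigmax _ _ (i, j)).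
Qed.

Lemma norm_le_enorm n (v : 'cV[R]_n) : `|v| <= enorm v.
Proof.
rewrite [leLHS]/Num.Def.normr/= mx_normrE bigmax_le ?enorm_ge0 //= => -[i j] _ /=.
by rewrite ord1 coord_le_enorm.
Qed.

(** The topology is that of the max norm while the estimates are Euclidean; with [norm_le_enorm]
    this passes between the two. The factor [n] is crude, only its finiteness matters. *)
Lemma enorm_le_norm n (v : 'cV[R]_n) : enorm v <= n%:R * `|v|.
Proof.
rewrite -(@ler_pXn2r _ 2) ?nnegrE ?enorm_ge0 ?mulr_ge0 ?ler0n // enorm_sqr.
apply: (@le_trans _ _ (\sum_(i < n) `|v| ^+ 2)).
  apply: ler_sum => i _; rewrite -(real_normK (num_real _)).
  by rewrite ler_pXn2r ?nnegrE // coord_le_norm.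
rewrite sumr_const card_ord -[leLHS]mulr_natl exprMn.
rewrite ler_wpM2r ?sqr_ge0 //.
by rewrite -natrX ler_nat; case: (n) => // k; rewrite expnS expn1 leq_pmulr.
Qed.

(** A crude entrywise bound: it shows that the supremum defining [spnorm] is finite, and it controls
    [spnorm] by the max norm. *)
Lemma enorm_mulmx_norm p q (M : 'M[R]_(p, q)) v :
  enorm (M *m v) <= (p * q)%:R * `|M| * enorm v.
Proof.
apply: le_trans (enorm_le_norm _) _; rewrite natrM -!mulrA ler_wpM2l ?ler0n //.
rewrite [leLHS]/Num.Def.normr/= mx_normrE bigmax_le ?mulr_ge0 ?ler0n ?enorm_ge0 //= => -[i j] _ /=.
rewrite ord1 mxE; apply: le_trans (ler_norm_sum _ _ _) _.
apply: (@le_trans _ _ (\sum_(k < q) `|M| * enorm v)).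
  by apply: ler_sum => k _; rewrite normrM ler_pM // ?coord_le_norm ?coord_le_enorm.
by rewrite sumr_const card_ord -[leLHS]mulr_natl.
Qed.

Lemma enorm_mulmx p q (M : 'M[R]_(p, q)) v :
  enorm (M *m v) <= spnorm M * enorm v.
Proof.
have ub : has_ubound [set enorm (M *m v) | v in [set v | enorm v <= 1]].
  exists ((p * q)%:R * `|M|) => _ [w /= w1 <-].
  apply: le_trans (enorm_mulmx_norm _ _) _.
  by rewrite ler_piMr // mulr_ge0 ?ler0n.
have [v0|v0] := eqVneq (enorm v) 0.
  by rewrite (enorm_eq0 v0) mulmx0 !enorm0 mulr0.
have vp : 0 < enorm v by rewrite lt_neqAle eq_sym v0 enorm_ge0.
rewrite -ler_pdivrMr // mulrC -[X in X * _]ger0_norm ?invr_ge0 ?enorm_ge0 //.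
rewrite -enormZ scalemxAr; apply: ub_le_sup => //; exists ((enorm v)^-1 *: v) => //=.
by rewrite enormZ ger0_norm ?invr_ge0 ?enorm_ge0 // mulVf.
Qed.

Lemma spnorm_ge0 p q (M : 'M[R]_(p, q)) : 0 <= spnorm M.
Proof.
by apply: sup_ge0 => _ [v _ <-]; exact: enorm_ge0.
Qed.

Lemma spnorm_le p q (M : 'M[R]_(p, q)) c : 0 <= c ->
  (forall v, enorm (M *m v) <= c * enorm v) -> spnorm M <= c.
Proof.
move=> c0 Mc; apply: ge_sup; first by exists (enorm (M *m 0)), 0; rewrite //= enorm0.
by move=> _ [v /= v1 <-]; apply: le_trans (Mc v) _; rewrite ler_piMr.
Qed.

Lemma spnorm0 p q : spnorm (0 : 'M[R]_(p, q)) = 0.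
Proof.
apply/eqP; rewrite eq_le spnorm_ge0 andbT; apply: spnorm_le => // v.
by rewrite mul0mx enorm0 mul0r.
Qed.

Lemma spnorm_le_norm p q (M : 'M[R]_(p, q)) : spnorm M <= (p * q)%:R * `|M|.
Proof. by apply: spnorm_le => [|v]; [rewrite mulr_ge0 ?ler0n|exact: enorm_mulmx_norm]. Qed.

Lemma spnormD p q (M N : 'M[R]_(p, q)) : spnorm (M + N) <= spnorm M + spnorm N.
Proof.
apply: spnorm_le => [|v]; first by rewrite addr_ge0 ?spnorm_ge0.
by rewrite mulmxDl mulrDl; apply: le_trans (enormD _ _) _; rewrite lerD ?enorm_mulmx.
Qed.

Lemma spnormZ_le p q a (M : 'M[R]_(p, q)) : spnorm (a *: M) <= `|a| * spnorm M.
Proof.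
apply: spnorm_le => [|v]; first by rewrite mulr_ge0 ?spnorm_ge0.
by rewrite -scalemxAl enormZ -mulrA ler_wpM2l ?enorm_mulmx.
Qed.

(** With [w = M^T v], [|w|^2 = v . (M w) <= |v| |M| |w|]. The adjoint equation thus obeys the same
    bound [M_A] as the state equation. *)
Lemma enorm_trmx_mul p q (M : 'M[R]_(p, q)) v :
  enorm (M^T *m v) <= spnorm M * enorm v.
Proof.
set w := _ *m _.
have [w0|w0] := eqVneq (enorm w) 0; first by rewrite w0 mulr_ge0 ?spnorm_ge0 ?enorm_ge0.
have wp : 0 < enorm w by rewrite lt_neqAle eq_sym w0 enorm_ge0.
rewrite -(ler_pM2r wp) -expr2 -dotvv {1}/w dot_trmx.
apply: le_trans (dot_le _ _) _; rewrite [leRHS]mulrAC [leRHS]mulrC.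
by rewrite ler_wpM2l ?enorm_ge0 ?enorm_mulmx.
Qed.

Lemma dot_mulmx_le n p (M : 'M[R]_(n, p)) q y :
  `|dot q (M *m y)| <= enorm q * (spnorm M * enorm y).
Proof.
by apply: le_trans (dot_norm_le _ _) _; rewrite ler_wpM2l ?enorm_ge0 ?enorm_mulmx.
Qed.

End EuclideanNorms.

Section OperatorNorms.
Context {R : realType} {m : nat} {W : lmodType R}.
Variable N : W -> R.
Hypothesis ND : forall x y, N (x + y) <= N x + N y.
Hypothesis NZ : forall a x, N (a *: x) <= `|a| * N x.

Let N0 : N 0 <= 0.
Proof. by have := NZ 0 0; rewrite scale0r normr0 mul0r. Qed.

Let N_ge0 x : 0 <= N x.
Proof.
have := ND 0 0; have := ND x (- x); have := NZ (-1) x; rewrite normrN normr1.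
by rewrite scaleN1r subrr addr0; have := N0; lra.
Qed.

Let N_sum (I : finType) (F : I -> W) : N (\sum_i F i) <= \sum_i N (F i).
Proof.
elim/big_ind2 : _ => // x1 y1 x2 y2 h1 h2.
by apply: le_trans (ND _ _) _; exact: lerD.
Qed.

(** Homogeneity reduces to a unit vector. Its coordinates are at most 1 in absolute value, so the
    sum of the [N (D i)] bounds the set and its [sup] is a true upper bound. [N] stands for both
    [enorm] and [spnorm]. *)
Lemma opnorm1_le (D : 'I_m -> W) (v : 'cV[R]_m) :
  N (\sum_i v i 0 *: D i) <= opnorm1 N D * enorm v.
Proof.
have [v0|v0] := eqVneq (enorm v) 0.
  rewrite v0 mulr0 big1 // => i _.
  by rewrite (enorm_eq0 v0) mxE scale0r.
have vp : 0 < enorm v by rewrite lt_neqAle eq_sym v0 enorm_ge0.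
have vE : \sum_i v i 0 *: D i = enorm v *: \sum_i ((enorm v)^-1 *: v) i 0 *: D i.
  rewrite scaler_sumr; apply: eq_bigr => i _.
  by rewrite mxE scalerA mulVKf.
rewrite vE; apply: le_trans (NZ _ _) _; rewrite ger0_norm ?enorm_ge0 // mulrC.
rewrite ler_wpM2r ?enorm_ge0 //; apply: ub_le_sup; last first.
  exists ((enorm v)^-1 *: v) => //=.
  by rewrite enormZ ger0_norm ?invr_ge0 ?enorm_ge0 // mulVf.
exists (\sum_i N (D i)) => _ [w /= w1 <-].
apply: le_trans (N_sum _) _; apply: ler_sum => i _.
by apply: le_trans (NZ _ _) _; rewrite ler_piMl ?N_ge0 // -w1 coord_le_enorm.
Qed.

Lemma opnorm2_le (D : 'I_m -> 'I_m -> W) (v : 'cV[R]_m) :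
  N (\sum_i \sum_j (v i 0 * v j 0) *: D i j) <= opnorm2 N D * enorm v ^+ 2.
Proof.
have [v0|v0] := eqVneq (enorm v) 0.
  rewrite v0 expr0n mulr0 big1 // => i _; rewrite big1 // => j _.
  by rewrite (enorm_eq0 v0) mxE mul0r scale0r.
have vp : 0 < enorm v by rewrite lt_neqAle eq_sym v0 enorm_ge0.
pose w := (enorm v)^-1 *: v.
have w1 : enorm w = 1 by rewrite enormZ ger0_norm ?invr_ge0 ?enorm_ge0 // mulVf.
have vE : \sum_i \sum_j (v i 0 * v j 0) *: D i j =
    enorm v ^+ 2 *: \sum_i \sum_j (w i 0 * w j 0) *: D i j.
  rewrite scaler_sumr; apply: eq_bigr => i _; rewrite scaler_sumr.
  by apply: eq_bigr => j _; rewrite !mxE scalerA; congr (_ *: _); field.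
rewrite vE; apply: le_trans (NZ _ _) _; rewrite ger0_norm ?sqr_ge0 // mulrC.
rewrite ler_wpM2r ?sqr_ge0 //; apply: ub_le_sup; last by exists (w, w).
exists (\sum_i \sum_j N (D i j)) => _ [[z1 z2] /= [z11 z21] <-].
apply: le_trans (N_sum _) _; apply: ler_sum => i _.
apply: le_trans (N_sum _) _; apply: ler_sum => j _.
apply: le_trans (NZ _ _) _; rewrite ler_piMl // normrM mulr_ile1 //.
- by rewrite -z11 coord_le_enorm.
- by rewrite -z21 coord_le_enorm.
Qed.

End OperatorNorms.

(** * Integral inequalities and linear differential equations *)

Section Calculus.
Context {R : realType}.

Lemma scale_real (a b : R) : a *: b = a * b.
Proof. by []. Qed.

Lemma is_derive_mxP p q (M : R -> 'M[R]_(p, q)) dM (t : R) :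
  is_derive t 1 M dM <-> forall i j, is_derive t 1 (fun s => M s i j) (dM i j).
Proof.
split=> [[Md <-] i j|Md].
  split; first exact: (derivable_mxP M t 1).1 Md i j.
  by rewrite derive_mx // mxE.
have dM' : derivable M t 1 by apply/derivable_mxP => i j; have [] := Md i j.
split=> //; rewrite derive_mx //; apply/matrixP => i j; rewrite mxE.
by have [] := Md i j.
Qed.

Lemma is_derive_dot n (p x : R -> 'cV[R]_n) dp dx (t : R) :
  is_derive t 1 p dp -> is_derive t 1 x dx ->
  is_derive t 1 (fun s => dot (p s) (x s)) (dot dp (x t) + dot (p t) dx).
Proof.
move=> /is_derive_mxP hp /is_derive_mxP hx.
have -> : (fun s => dot (p s) (x s)) = \sum_i (fun s => p s i 0 * x s i 0).
  by apply/funext => s; rewrite fct_sumE.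
apply: is_derive_eq.
rewrite /dot -big_split /=; apply: eq_bigr => i _.
by rewrite addrC; congr (_ + _); exact: mulrC.
Qed.

Lemma is_derive_cdot n (v : 'cV[R]_n) (x : R -> 'cV[R]_n) dx (t : R) :
  is_derive t 1 x dx -> is_derive t 1 (fun s => dot v (x s)) (dot v dx).
Proof.
move=> hx; have := is_derive_dot (is_derive_cst v t 1) hx.
by rewrite dot0l add0r.
Qed.

Lemma is_derive_enorm_sqr n (x : R -> 'cV[R]_n) dx (t : R) :
  is_derive t 1 x dx -> is_derive t 1 (fun s => enorm (x s) ^+ 2) (2 * dot (x t) dx).
Proof.
move=> hx; have := is_derive_dot hx hx.
under eq_fun do rewrite dotvv.
by rewrite (dotC dx) mulr_natl mulr2n.
Qed.

(** Meant for [a = -1], [b = T]: reversing time turns the final condition of the adjoint into an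
    initial one. *)
Lemma is_derive_comp_affine (V : normedModType R) (f : R -> V) df (a b t : R) :
  is_derive (a * t + b) 1 f df -> is_derive t 1 (fun s => f (a * s + b)) (a *: df).
Proof.
move=> [fd <-].
have da : is_derive t 1 (fun s : R => a * s + b) a.
  by apply: is_derive_eq; rewrite addr0 scale_real mulr1.
have dfa : differentiable f (a * t + b) by exact/derivable1_diffP.
have dga : differentiable (fun s : R => a * s + b) t.
  by apply/derivable1_diffP; exact: ex_derive.
have dc := differentiable_comp dga dfa.
split; first exact/derivable1_diffP.
rewrite (deriveE _ dc) diff_comp //=.
have -> : 'd (fun s : R => a * s + b) t 1 = a.
  by rewrite -deriveE //; exact: derive_val.
rewrite (deriveE _ dfa) -linearZ; congr ('d f (a * t + b) _).
by rewrite scale_real mulr1.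
Qed.

(** The mean value theorem for [G - F]. It plays the part of monotonicity of the time integral
    wherever integrals are handled as primitives. *)
Lemma le_increment (F G dF dG : R -> R) (a b : R) : a <= b ->
  (forall t, a <= t <= b -> is_derive t 1 F (dF t)) ->
  (forall t, a <= t <= b -> is_derive t 1 G (dG t)) ->
  (forall t, a <= t <= b -> dF t <= dG t) ->
  F b - F a <= G b - G a.
Proof.
move=> ab hF hG le.
have hGF t : a <= t <= b -> is_derive t 1 (fun s => G s - F s) (dG t - dF t).
  by move=> tab; apply: is_deriveB; [exact: hG|exact: hF].
have [||c cab E] := @MVT_segment R (fun s => G s - F s) (fun t => dG t - dF t) a b ab.
- by move=> t; rewrite in_itv /= => /andP[ta tb]; apply: hGF; rewrite !ltW.
- apply: derivable_within_continuous => t; rewrite in_itv /= => tab.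
  by have [] := hGF t tab.
have : 0 <= (dG c - dF c) * (b - a).
  by rewrite mulr_ge0 ?subr_ge0 // le //; move: cab; rewrite in_itv.
by rewrite -E; lra.
Qed.

(* Testing against the fixed vector [z b - z a] reduces the claim to the
   scalar case. *)
Lemma enorm_increment n (z dz : R -> 'cV[R]_n) (G dG : R -> R) (a b : R) : a <= b ->
  (forall t, a <= t <= b -> is_derive t 1 z (dz t)) ->
  (forall t, a <= t <= b -> is_derive t 1 G (dG t)) ->
  (forall t, a <= t <= b -> enorm (dz t) <= dG t) ->
  enorm (z b - z a) <= G b - G a.
Proof.
move=> ab hz hG le; set v := z b - z a.
have [v0|v0] := eqVneq (enorm v) 0.
  rewrite v0; have := @le_increment (fun=> 0) G (fun=> 0) dG a b ab.
  rewrite subrr; apply=> // t tab.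
  exact: le_trans (enorm_ge0 _) (le t tab).
have vp : 0 < enorm v by rewrite lt_neqAle eq_sym v0 enorm_ge0.
rewrite -(ler_pM2l vp) -expr2 -dotvv {2}/v dotBr mulrBr.
apply: (@le_increment (fun s => dot v (z s)) (fun s => enorm v * G s)
  (fun s => dot v (dz s)) (fun s => enorm v * dG s)) => // t tab.
- by apply: is_derive_cdot; exact: hz.
- exact: (@is_deriveZ _ _ _ G (enorm v) t 1 _ (hG t tab)).
- by apply: le_trans (dot_le _ _) _; rewrite ler_wpM2l ?enorm_ge0 ?le.
Qed.

Lemma enorm_lipschitz n (z dz : R -> 'cV[R]_n) (L a b : R) :
  (forall t, a <= t <= b -> is_derive t 1 z (dz t)) ->
  (forall t, a <= t <= b -> enorm (dz t) <= L) ->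
  forall s t, a <= s <= b -> a <= t <= b -> enorm (z t - z s) <= L * `|t - s|.
Proof.
move=> hz le.
have key s t : a <= s -> s <= t -> t <= b -> enorm (z t - z s) <= L * (t - s).
  move=> as_ st tb; rewrite mulrBr.
  have sub r : s <= r <= t -> a <= r <= b.
    by move=> /andP[sr rt]; rewrite (le_trans as_ sr) (le_trans rt tb).
  apply: (@enorm_increment _ z dz (fun r => L * r) (fun=> L)) => // r /sub rab.
  - exact: hz.
  - by apply: is_derive_eq; rewrite scale_real mulr1.
  - exact: le.
move=> s t /andP[sa sb] /andP[ta tb]; have [st|/ltW ts] := leP s t.
  by rewrite ger0_norm ?subr_ge0 // key.
by rewrite enorm_distrC distrC ger0_norm ?subr_ge0 // key.
Qed.

(* [sqrt (|z|^2 + e^2)] replaces [|z|], which need not be differentiable. *)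
Lemma gronwall n (z dz : R -> 'cV[R]_n) (G dG : R -> R) (L T : R) : 0 <= L ->
  (forall t, 0 <= t <= T -> is_derive t 1 z (dz t)) ->
  (forall t, 0 <= t <= T -> is_derive t 1 G (dG t)) ->
  (forall t, 0 <= t <= T -> 0 <= dG t) ->
  (forall t, 0 <= t <= T -> enorm (dz t) <= L * enorm (z t) + dG t) ->
  forall t, 0 <= t <= T ->
    enorm (z t) <= (enorm (z 0) + (G t - G 0)) * expR (L * t).
Proof.
move=> L0 hz hG dG0 le t /andP[t0 tT].
apply/ler_addgt0Pr => e e0.
(* Regularizing raises the initial value by at most [c], hence the final bound by
   [c * expR (L * t) = e]. *)
pose c := e / expR (L * t).
have c0 : 0 < c by rewrite divr_gt0 ?expR_gt0.
pose q s := enorm (z s) ^+ 2 + c ^+ 2.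
have q0 s : 0 < q s by rewrite ltr_wpDl ?sqr_ge0 // exprn_gt0.
pose f s := Num.sqrt (q s).
have f0 s : 0 < f s by rewrite sqrtr_gt0.
have zf s : enorm (z s) <= f s.
  rewrite -(ger0_norm (enorm_ge0 (z s))) -sqrtr_sqr ler_wsqrtr // lerDl.
  exact: sqr_ge0.
have df s : 0 <= s <= T -> is_derive s 1 f (dot (z s) (dz s) / f s).
  move=> sT.
  have dq : is_derive s 1 q (2 * dot (z s) (dz s)).
    have h := is_derive_enorm_sqr (hz s sT).
    by apply: is_derive_eq; rewrite addr0.
  apply: is_derive_eq; first exact: (is_derive1_comp (is_derive1_sqrt (q0 s)) dq).
  by have := f0 s; rewrite -/(f s) => /lt0r_neq0 ?; field.
have dE (s : R) : is_derive s 1 (fun s => expR (- L * s)) (- L * expR (- L * s)).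
  by apply: is_derive_eq; rewrite scale_real mulr1 mulrC.
(* The integrating factor removes the term [L f]; as it is at most 1 and [dG >= 0], what remains
   grows no faster than [G]. *)
have main : expR (- L * t) * f t - expR (- L * 0) * f 0 <= G t - G 0.
  apply: (@le_increment (fun s => expR (- L * s) * f s) G
    (fun s => expR (- L * s) * (dot (z s) (dz s) / f s) +
              f s * (- L * expR (- L * s))) dG) => // s /andP[s0 st].
  - apply: is_deriveM => //; apply: df; rewrite s0 (le_trans st tT).
    by [].
  - by apply: hG; rewrite s0 (le_trans st tT).
  have sT : 0 <= s <= T by rewrite s0 (le_trans st tT).
  have E1 : expR (- L * s) <= 1 by rewrite -expR0 ler_expR mulNr oppr_le0 mulr_ge0.
  have E0 := expR_gt0 (- L * s).
  have h1 : dot (z s) (dz s) / f s <= L * f s + dG s.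
    rewrite ler_pdivrMr //; apply: le_trans (dot_le _ _) _.
    rewrite mulrC; apply: ler_pM; rewrite ?enorm_ge0 //.
    apply: le_trans (le s sT) _; rewrite lerD2r ler_wpM2l //.
  have := dG0 s sT.
  have : expR (- L * s) * (dot (z s) (dz s) / f s) <= expR (- L * s) * (L * f s + dG s).
    by rewrite ler_wpM2l // ltW.
  have : expR (- L * s) * dG s <= 1 * dG s by rewrite ler_wpM2r // dG0.
  lra.
rewrite mulr0 expR0 mul1r in main.
have ft : f t <= (f 0 + (G t - G 0)) * expR (L * t).
  rewrite -ler_pdivrMr ?expR_gt0 // -expRN -mulNr mulrC.
  by move: main; lra.
have f0le : f 0 <= enorm (z 0) + c.
  rewrite -(@ler_pXn2r _ 2) ?nnegrE ?addr_ge0 ?enorm_ge0 ?(ltW c0) ?(ltW (f0 _)) //.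
  rewrite sqr_sqrtr ?(ltW (q0 _)) // sqrrD /q lerD2r lerDl.
  by rewrite mulrn_wge0 // mulr_ge0 ?enorm_ge0 // ltW.
apply: le_trans (zf t) _; apply: le_trans ft _.
have -> : e = c * expR (L * t) by rewrite divfK // gt_eqF ?expR_gt0.
by rewrite -mulrDl ler_wpM2r ?expR_ge0 //; lra.
Qed.

End Calculus.

(** * Uniform continuity on compact sets and entrywise convergence *)

Section UniformContinuity.
Context {R : realType}.

Lemma within_continuousP (Z W : normedModType R) (D : set Z) (f : Z -> W) :
  {within D, continuous f} <->
  forall x, D x -> forall e : R, 0 < e -> exists2 r : R, 0 < r &
    forall y, D y -> `|x - y| < r -> `|f x - f y| < e.
Proof.
split=> [cf x Dx e e0|cf].
  have := cf x; rewrite /continuous_at /= => /cvgrPdist_lt /(_ e e0).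
  rewrite -[X in \near X, _](nbhs_subspace_in Dx) => /nbhs_normP[r r0 h].
  by exists r => // y Dy xy; exact: h.
rewrite continuous_subspace_in => x /set_mem Dx.
apply/cvgrPdist_lt => e e0; rewrite -[X in \near X, _](nbhs_subspace_in Dx).
have [r r0 h] := cf x Dx e e0.
by apply/nbhs_normP; exists r => // y xy Dy; exact: h.
Qed.

Lemma compact_uniform_continuous (Z W : normedModType R) (D : set Z) (f : Z -> W) :
  compact D -> {within D, continuous f} ->
  forall e : R, 0 < e -> exists2 r : R, 0 < r &
    forall x y, D x -> D y -> `|x - y| < r -> `|f x - f y| < e.
Proof.
move=> /compact_near_coveringP/near_covering_withinP cD /within_continuousP cf e e0.
pose P (r : R) x := forall y, D y -> `|x - y| < r -> `|f x - f y| < e.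
have : \forall r \near (0:R)^'+, forall x, D x -> P r x.
  apply: cD => x Dx; have e2 : 0 < e / 2 by rewrite divr_gt0.
  have [r r0 h] := cf x Dx _ e2.
  have r2 : 0 < r / 2 by rewrite divr_gt0.
  exists ([set y | `|x - y| < r / 2], [set s | s < r / 2]).
    split => /=; first by apply/nbhs_normP; exists (r / 2).
    exact: nbhs_right_lt.
  move=> [y s] /= [xy sr] Dy z Dz yz.
  rewrite (splitr e) -(subrKA (f x)); apply: le_lt_trans (ler_normD _ _) _.
  rewrite ltrD //.
    by rewrite distrC h //; apply: lt_trans xy _; lra.
  rewrite h // -(subrKA y); apply: le_lt_trans (ler_normD _ _) _.
  by lra.
move=> H; have [r [r0 hr]] : exists r : R, 0 < r /\ forall x, D x -> P r x.
  near (0:R)^'+ => r; exists r; split => //.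
  near: r; exact: H.
by exists r => // x y Dx Dy; exact: hr.
Unshelve. all: by end_near. Qed.

Lemma cvg_mx (I : Type) (F : set_system I) p q (f : I -> 'M[R]_(p, q))
    (l : 'M[R]_(p, q)) :
  Filter F -> (forall i j, f x i j @[x --> F] --> l i j) -> f x @[x --> F] --> l.
Proof.
move=> FF h; apply/cvgrPdist_le => e e0; near=> x.
rewrite [leLHS]/Num.Def.normr/= mx_normrE (bigmax_le _ (ltW e0))//= => i _.
rewrite !mxE; move: i; near: x; apply: filter_forall => /= -[i j].
exact: ((cvgrPdist_le _ _).1 (h i j)).
Unshelve. all: by end_near. Qed.

Lemma cvg_mulmx (I : Type) (F : set_system I) p q r
    (f : I -> 'M[R]_(p, q)) (g : I -> 'M[R]_(q, r)) (A : 'M[R]_(p, q)) (B : 'M[R]_(q, r)) :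
  Filter F ->
  f x @[x --> F] --> A -> g x @[x --> F] --> B -> f x *m g x @[x --> F] --> A *m B.
Proof.
move=> FF fA gB; apply: cvg_mx => i j.
have coord u v (h : I -> 'M[R]_(u, v)) (M : 'M[R]_(u, v)) k l : h x @[x --> F] --> M ->
    h x k l @[x --> F] --> M k l.
  by move=> hM; apply: (@cvg_comp _ _ _ h (fun M => M k l) _ _ _ hM); exact: coord_continuous.
under eq_cvg do rewrite mxE; rewrite mxE.
have -> : (fun x => \sum_k f x i k * g x k j) = \sum_k (fun x => f x i k * g x k j).
  by apply/funext => x; rewrite fct_sumE.
elim/big_rec2: _ => [|k h l _ hl]; first exact: cvg_cst.
by apply: cvgD hl; apply: cvgM; exact: coord.
Qed.

Lemma bounded_on_segment (W : normedModType R) (T : R) (f : R -> W) :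
  {within `[0, T], continuous f} ->
  exists2 M : R, 0 <= M & forall t, 0 <= t <= T -> `|f t| <= M.
Proof.
move=> cf; have := continuous_compact cf (@segment_compact R 0 T).
move/compact_bounded => [M [_ h]]; exists (`|M| + 1); first by rewrite addr_ge0.
move=> t tT; apply: (h (`|M| + 1)); first by rewrite ltr_pwDr // ler_norm.
by exists t; rewrite //= in_itv.
Qed.

End UniformContinuity.

(** * Extension from a segment and primitives of continuous functions *)

Section Clamp.
Context {R : realType} (T : R).
Hypothesis T0 : 0 <= T.

(** A 1-Lipschitz retraction of the line onto [[0, T]]: composing with it extends a function
    continuous on the segment to a continuous function on the whole line. *)
Definition clamp (t : R) : R := Num.max 0 (Num.min T t).

Lemma clamp_in t : 0 <= clamp t <= T.
Proof.
apply/andP; split; rewrite /clamp; case: (leP T t) => ?;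
  [case: (leP 0 T)|case: (leP 0 t)|case: (leP 0 T)|case: (leP 0 t)] => ? //; lra.
Qed.

Lemma clamp_id t : 0 <= t <= T -> clamp t = t.
Proof.
by move=> /andP[? ?]; rewrite /clamp; case: (leP T t) => ?; case: leP => ?; lra.
Qed.

Lemma clamp_lip s t : `|clamp s - clamp t| <= `|s - t|.
Proof.
have := ler_norm (s - t); have := ler_norm (t - s); rewrite (distrC t s).
move=> ? ?; rewrite ler_norml /clamp.
case: (leP T t) => ?; [case: (leP 0 T)|case: (leP 0 t)] => ?;
  (case: (leP T s) => ?; [case: (leP 0 T)|case: (leP 0 s)] => ?); lra.
Qed.

Lemma continuous_clamp (W : normedModType R) (f : R -> W) :
  {within `[0, T], continuous f} -> continuous (fun t => f (clamp t)).
Proof.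
move=> /within_continuousP cf t; apply/cvgrPdist_lt => e e0.
have It s : `[0, T]%classic (clamp s) by rewrite /= in_itv /= clamp_in.
have [r r0 h] := cf _ (It t) e e0.
apply/nbhs_normP; exists r => // s ts /=; apply: h => //.
exact: le_lt_trans (clamp_lip _ _) ts.
Qed.

End Clamp.

Section Primitives.
Context {R : realType} (T : R).
Hypothesis T0 : 0 <= T.

Lemma primitive_exists (f : R -> R) : {within `[0, T], continuous f} ->
  exists2 F : R -> R, F 0 = 0 &
    forall t, 0 <= t <= T -> is_derive t 1 F (f t).
Proof.
move=> cf; pose g t := f (clamp T t).
have cg : continuous g by exact: continuous_clamp.
(* Integrating from -1, with room up to [T + 1], makes 0 and [T] interior points, so the derivative
   there is two-sided. *)
pose G x : R := (\int[lebesgue_measure]_(t in `[- 1, x]) g t).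
have dG t : 0 <= t <= T -> is_derive t 1 G (f t).
  move=> tT; have tT1 : t < T + 1 by lra.
  have ig : lebesgue_measure.-integrable `[-1, T + 1] (EFin \o g).
    apply: continuous_compact_integrable; first exact: segment_compact.
    exact: continuous_subspaceT.
  have [||d1 d2] := continuous_FTC1_closed tT1 ig.
  - lra.
  - exact: cg.
  by split => //; rewrite -derive1E d2 /g clamp_id.
exists (fun t => G t - G 0); first by rewrite subrr.
by move=> t tT; have h := dG t tT; apply: is_derive_eq; rewrite subr0.
Qed.

Lemma vector_primitive_exists n (f : R -> 'cV[R]_n) : {within `[0, T], continuous f} ->
  exists2 F : R -> 'cV[R]_n, F 0 = 0 &
    forall t, 0 <= t <= T -> is_derive t 1 F (f t).
Proof.
move=> /within_continuousP cf.
have /choice[F hF] : forall i, exists F : R -> R, F 0 = 0 /\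
    forall t, 0 <= t <= T -> is_derive t 1 F (f t i 0).
  move=> i; have [|F F0 dF] := @primitive_exists (fun t => f t i 0); last by exists F.
  apply/within_continuousP => x Ix e e0; have [r r0 h] := cf x Ix e e0.
  exists r => // y Iy xy; apply: le_lt_trans (h y Iy xy).
  by have := coord_le_norm (f x - f y) i 0; rewrite !mxE.
exists (fun t => \col_i F i t).
  by apply/colP => i; rewrite !mxE; have [] := hF i.
move=> t tT; apply/is_derive_mxP => i j; rewrite ord1.
have [_ /(_ t tT)] := hF i.
by under [fun s => (\col__ _) _ _]eq_fun do rewrite mxE.
Qed.

End Primitives.

(** * Linear differential equations *)

Section LinearODE.
Context {R : realType}.

Lemma le0_geometric (x C : R) : (forall k, x <= C * 2^-1 ^+ k) -> x <= 0.
Proof.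
move=> h; rewrite leNgt; apply/negP => x0.
have C0 : 0 < C by apply: lt_le_trans x0 _; have := h 0%N; rewrite expr0 mulr1.
have := archi_boundP (ltW (divr_gt0 C0 x0)); set k := Num.bound _ => kC.
have := h k; rewrite leNgt => /negP; apply.
rewrite exprVn ltr_pdivrMr ?exprn_gt0 // mulrC -ltr_pdivrMr //.
by apply: lt_trans kC _; rewrite -natrX ltr_nat ltn_expl.
Qed.

Lemma geometric_limit p q (u : nat -> 'M[R]_(p, q)) (M : R) :
  (forall k, `|u k.+1 - u k| <= M * 2^-1 ^+ k) ->
  exists l, forall k, `|l - u k| <= M * 2 * 2^-1 ^+ k.
Proof.
move=> h.
have M0 : 0 <= M by have := h 0%N; rewrite expr0 mulr1; exact: le_trans.
(* The exact partial sum of the geometric series, rather than its bound, is what lets the induction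
   on [j] close. *)
have h2 k j : `|u (k + j)%N - u k| <= M * 2 * (2^-1 ^+ k - 2^-1 ^+ (k + j)).
  elim: j => [|j IH]; first by rewrite addn0 !subrr normr0 mulr0.
  rewrite addnS -(subrKA (u (k + j)%N)); apply: le_trans (ler_normD _ _) _.
  have := h (k + j)%N; rewrite exprS; lra.
have h3 k j : (k <= j)%N -> `|u j - u k| <= M * 2 * 2^-1 ^+ k.
  move=> kj; have := h2 k (j - k)%N; rewrite subnKC //.
  have : 0 <= (2^-1 : R) ^+ j by rewrite exprn_ge0 // invr_ge0.
  move=> j0; have : 0 <= M * 2^-1 ^+ j by rewrite mulr_ge0.
  lra.
have cu : cvgn u.
  apply/cauchy_cvgP/cauchy_exP => e e0.
  have [k hk] : exists k, M * 2 * 2^-1 ^+ k < e.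
    apply: contrapT => H; have : e <= 0; last by lra.
    apply: (@le0_geometric _ (M * 2)) => k; rewrite leNgt; apply/negP => H'.
    by apply: H; exists k.
  exists (u k); change (\forall n \near \oo, ball (u k) e (u n)); near=> n; rewrite -ball_normE /= distrC.
  by apply: le_lt_trans hk; apply: h3; near: n; exact: nbhs_infty_ge.
exists (limn u) => k.
have : `|u n - u k| @[n --> \oo] --> `|limn u - u k|.
  by apply: cvg_norm; apply: cvgB => //; exact: cvg_cst.
move=> /cvg_lim <- //; apply: limr_le.
  by apply: is_cvg_norm; apply: is_cvgB => //; exact: is_cvg_cst.
by near=> n; apply: h3; near: n; exact: nbhs_infty_ge.
Unshelve. all: by end_near. Qed.

(* Picard iteration; in the norm weighted by [expR (2 L t)] each step halves the
   distance between consecutive iterates. *)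
Lemma linear_ode_exists n (T : R) (a : R -> 'M[R]_n) (b : R -> 'cV[R]_n) y0 :
  0 <= T ->
  {within `[0, T], continuous a} -> {within `[0, T], continuous b} ->
  exists2 y : R -> 'cV[R]_n, y 0 = y0 &
    forall t, 0 <= t <= T -> is_derive t 1 y (a t *m y t + b t).
Proof.
move=> T0 ca cb.
pose rhs (y : R -> 'cV[R]_n) t := a t *m y t + b t.
have crhs y : {within `[0, T], continuous y} -> {within `[0, T], continuous (rhs y)}.
  by move=> cy t; apply: cvgD (cb t); exact: cvg_mulmx (ca t) (cy t).
(* [Phi] is the Picard map, with a dummy value at a discontinuous [y]. *)
have /choice[Phi hPhi] : forall y, exists z, {within `[0, T], continuous y} ->
    z 0 = y0 /\ forall t, 0 <= t <= T -> is_derive t 1 z (rhs y t).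
  move=> y; have [cy|ncy] := pselect ({within `[0, T], continuous y}); last by exists y.
  have [F F0 dF] := vector_primitive_exists T0 (crhs y cy).
  exists (fun t => y0 + F t) => _; split=> [|t tT]; first by rewrite F0 addr0.
  by have h := dF t tT; apply: is_derive_eq; rewrite add0r.
have derive_cont z dz : (forall t, 0 <= t <= T -> is_derive t 1 z (dz t)) ->
    {within `[0, T], continuous (z : R -> 'cV[R]_n)}.
  by move=> h; apply: derivable_within_continuous => t; rewrite in_itv /= => /h[].
pose Y k := iter k Phi (fun=> y0).
have cY k : {within `[0, T], continuous (Y k)}.
  elim: k => [|k IH]; first exact: cst_continuous.
  by have [_ h] := hPhi (Y k) IH; exact: derive_cont h.
have Y0 k : Y k 0 = y0 by case: k => // k; have [] := hPhi (Y k) (cY k).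
have dY k t : 0 <= t <= T -> is_derive t 1 (Y k.+1) (rhs (Y k) t).
  by have [_] := hPhi (Y k) (cY k); exact.
have [Ma Ma0 hMa] := bounded_on_segment ca.
pose L := (n * n)%:R * Ma + 1.
have L0 : 0 < L by rewrite ltr_wpDl // mulr_ge0 ?ler0n.
have aL t v : 0 <= t <= T -> enorm (a t *m v) <= L * enorm v.
  move=> tT; apply: le_trans (enorm_mulmx_norm _ _) _.
  rewrite ler_wpM2r ?enorm_ge0 // /L; apply: ler_wpDr => //.
  by rewrite ler_wpM2l ?ler0n // hMa.
have [D0 D00 hD0] : exists2 D, 0 <= D & forall t, 0 <= t <= T -> enorm (Y 1 t - Y 0 t) <= D.
  have [M0 M00 h0] := bounded_on_segment (cY 0).
  have [M1 M10 h1] := bounded_on_segment (cY 1).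
  exists (n%:R * (M1 + M0)); first by rewrite mulr_ge0 ?ler0n ?addr_ge0.
  move=> t tT; apply: le_trans (enorm_le_norm _) _; rewrite ler_wpM2l ?ler0n //.
  by apply: le_trans (ler_normB _ _) _; rewrite lerD ?h0 ?h1.
have E1 t : 0 <= t -> 1 <= expR (2 * L * t).
  by move=> t0; rewrite -expR0 ler_expR !mulr_ge0 // ltW.
have step k t : 0 <= t <= T -> enorm (Y k.+1 t - Y k t) <= D0 * 2^-1 ^+ k * expR (2 * L * t).
  elim: k t => [|k IH] t /andP[t0 tT].
    rewrite expr0 mulr1; apply: le_trans (hD0 t _) _; first by rewrite t0.
    by rewrite ler_peMr ?E1.
  (* The derivative of [G] is [L] times the bound at rank [k]: the 2 in the exponent pays for the
     halving. *)
  pose G s := D0 * 2^-1 ^+ k.+1 * expR (2 * L * s).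
  have dG (s : R) : is_derive s 1 G (L * (D0 * 2^-1 ^+ k * expR (2 * L * s))).
    have h : is_derive s 1 (fun s => expR (2 * L * s)) (2 * L * expR (2 * L * s)).
      by apply: is_derive_eq; rewrite scale_real mulr1 mulrC.
    by apply: is_derive_eq; rewrite scale_real exprS; field.
  have : enorm ((Y k.+2 t - Y k.+1 t) - (Y k.+2 0 - Y k.+1 0)) <= G t - G 0.
    apply: (@enorm_increment R n (fun s => Y k.+2 s - Y k.+1 s)
      (fun s => rhs (Y k.+1) s - rhs (Y k) s) G
      (fun s => L * (D0 * 2^-1 ^+ k * expR (2 * L * s)))) => // s /andP[s0 st].
      by apply: is_deriveB; apply: dY; rewrite s0 (le_trans st tT).
    have sT : 0 <= s <= T by rewrite s0 (le_trans st tT).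
    rewrite /rhs opprD addrACA subrr addr0 -mulmxBr.
    by apply: le_trans (aL _ _ sT) _; rewrite ler_wpM2l ?(ltW L0) // IH.
  rewrite !Y0 subrr subr0 => /le_trans; apply.
  by rewrite gerBl /G mulr_ge0 ?expR_ge0 // mulr_ge0 // exprn_ge0.
pose M := D0 * expR (2 * L * T).
have stepM k t : 0 <= t <= T -> `|Y k.+1 t - Y k t| <= M * 2^-1 ^+ k.
  move=> tT; apply: le_trans (norm_le_enorm _) _; apply: le_trans (step k t tT) _.
  rewrite /M mulrAC ler_wpM2r ?exprn_ge0 // ler_wpM2l // ler_expR.
  by case/andP: tT => _ tT; rewrite ler_wpM2l // mulr_ge0 // ltW.
have /choice[y hy] : forall t, exists l, 0 <= t <= T ->
    forall k, `|l - Y k t| <= M * 2 * 2^-1 ^+ k.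
  move=> t; have [tT|tT] := pselect (0 <= t <= T); last by exists 0.
  by have [l hl] := geometric_limit (u := fun k => Y k t) (M := M) (fun k => stepM k t tT); exists l.
have M0 : 0 <= M by rewrite mulr_ge0 ?expR_ge0.
have small (e C : R) : 0 < e -> exists k, C * 2^-1 ^+ k < e.
  move=> e0; apply: contrapT => H; have : e <= 0; last by lra.
  apply: (@le0_geometric e C) => k; rewrite leNgt; apply/negP => H'.
  by apply: H; exists k.
have cy : {within `[0, T], continuous y}.
  apply/within_continuousP => t; rewrite /= in_itv /= => tT e e0.
  have e3 : 0 < e / 3 by rewrite divr_gt0.
  have [k hk] := small _ (M * 2) e3.
  have /within_continuousP/(_ t) := cY k; rewrite /= in_itv /= => /(_ tT _ e3)[r r0 h].
  exists r => // s; rewrite /= in_itv /= => sT ts.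
  have := h s; rewrite /= in_itv /= => /(_ sT ts) h'.
  rewrite -(subrKA (Y k t)); apply: le_lt_trans (ler_normD _ _) _.
  have hs := hy s sT k; rewrite distrC in hs.
  have := ler_normD (Y k t - Y k s) (Y k s - y s); rewrite subrKA.
  have := hy t tT k; lra.
(* The limit [y] is only known to be continuous on the segment. [Phi y] agrees with it there and is
   differentiable, endpoints included, so [Phi y] is the solution returned. *)
have [z0 dz] := hPhi y cy; have zy t : 0 <= t <= T -> Phi y t = y t.
  move=> tT; apply/eqP; rewrite -subr_eq0 -normr_le0.
  pose C := L * (n%:R * (M * 2)).
  apply: (@le0_geometric _ (C * T + M * 2 * 2^-1)) => k.
  have : enorm ((Phi y t - Y k.+1 t) - (Phi y 0 - Y k.+1 0)) <= C * 2^-1 ^+ k * `|t - 0|.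
    apply: (@enorm_lipschitz R n (fun s => Phi y s - Y k.+1 s)
       (fun s => rhs y s - rhs (Y k) s) _ 0 T) => //; last by rewrite lexx.
      by move=> s sT; apply: is_deriveB; [exact: dz|exact: dY].
    move=> s sT; rewrite /rhs opprD addrACA subrr addr0 -mulmxBr.
    apply: le_trans (aL _ _ sT) _; rewrite /C -!mulrA ler_wpM2l ?(ltW L0) //.
    apply: le_trans (enorm_le_norm _) _; rewrite ler_wpM2l ?ler0n //.
    by have := hy s sT k; rewrite -!mulrA; exact.
  rewrite z0 Y0 subrr !subr0 => h1.
  have /andP[t0 tT'] := tT; rewrite ger0_norm // in h1.
  have := hy t tT k.+1; rewrite exprS distrC => h2.
  have h3 := le_trans (norm_le_enorm _) h1.
  rewrite -(subrKA (Y k.+1 t)); apply: le_trans (ler_normD _ _) _.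
  have p0 : 0 <= C * 2^-1 ^+ k by rewrite !mulr_ge0 ?ler0n ?exprn_ge0 // ltW.
  have : C * 2^-1 ^+ k * t <= C * 2^-1 ^+ k * T by rewrite ler_wpM2l.
  lra.
exists (Phi y) => // t tT; have := dz t tT.
by rewrite /rhs zy.
Unshelve. all: by end_near. Qed.

End LinearODE.

(** * Absolutely continuous solutions are classical *)

Section AbsoluteContinuity.
Context {R : realType}.

(** The supremum of the [c] with [Q a c] satisfies [Q a c] itself, by the local property at that
    point, and the same property pushes it up to [b]. This compactness principle serves twice: for
    the tagged partition behind absolute continuity, and for the exchange of time integral and
    expectation. *)
Lemma cousin (Q : R -> R -> Prop) (a b : R) : a <= b ->
  (forall l m r, a <= l -> l <= m -> m <= r -> r <= b -> Q l m -> Q m r -> Q l r) ->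
  (forall t, a <= t <= b -> exists2 delta : R, 0 < delta &
     forall l r, a <= l -> l <= t -> t <= r -> r <= b -> r - l < delta -> Q l r) ->
  Q a b.
Proof.
move=> ab tr loc; pose S := [set c | a <= c <= b /\ Q a c].
have Sa : S a.
  split; first by rewrite lexx.
  have [|d d0 h] := loc a; first by rewrite lexx.
  by apply: h; rewrite // subrr.
have Sub : has_ubound S by exists b => c [/andP[]].
have hS : has_sup S by split; [exists a|].
pose c := sup S.
have ac : a <= c by exact: ub_le_sup.
have cb : c <= b by apply: ge_sup; [exists a|move=> x [/andP[]]].
have [|d d0 h] := loc c; first by rewrite ac.
have d2 : 0 < d / 2 by rewrite divr_gt0.
have [s [/andP[as_ sb] Qs] cs] := sup_adherent d2 hS; rewrite -/c in cs.
have sc : s <= c by apply: ub_le_sup => //; split => //; rewrite as_.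
have Qc : Q a c.
  apply: (tr a s c) => //; apply: h => //; lra.
have [bc|cneb] := eqVneq c b; first by rewrite -bc.
have cltb : c < b by rewrite lt_neqAle cneb.
pose r := Num.min b (c + d / 2).
have cr : c < r by rewrite /r lt_min cltb /=; lra.
have rb : r <= b by rewrite /r ge_min lexx.
have rd : r <= c + d / 2 by rewrite /r ge_min lexx orbT.
have Sr : S r.
  split; first by rewrite rb andbT (le_trans ac (ltW cr)).
  apply: (tr a c r) => //; first exact: ltW.
  by apply: h => //; [exact: ltW|lra].
have := ub_le_sup Sub Sr; rewrite -/c; lra.
Qed.

(** Turns a small measure of [O] into the small total length that absolute continuity asks for. *)
Lemma sum_lengths_le (N : nat) (l r : 'I_N -> R) (O : set R) :
  measurable O -> (forall i, l i <= r i) ->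
  (forall i, `]l i, r i[ `<=` O) ->
  trivIset setT (fun i => `]l i, r i[%classic) ->
  ((\sum_i (r i - l i))%:E <= lebesgue_measure O)%E.
Proof.
move=> mO lr lrO tI.
have mi i : measurable (`]l i, r i[%classic : set R) by exact: measurable_itv.
have mU : measurable (\big[setU/set0]_i `]l i, r i[%classic : set R).
  exact: bigsetU_measurable.
apply: (@le_trans _ _ (lebesgue_measure (\big[setU/set0]_i `]l i, r i[%classic : set R))).
  rewrite measure_semi_additive_ord // -sumEFin; apply: lee_sum => i _.
  have := lebesgue_measure_itv `]l i, r i[; rewrite /= lte_fin => ->.
  case: ltP => // rl.
  by rewrite lee_fin subr_le0.
apply: le_measure; rewrite ?inE //.
by rewrite -bigcup_seq => x [i _]; exact: lrO.
Qed.

Lemma abs_continuousB (V : normedModType R) (a b : R) (f g : R -> V) :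
  abs_continuous a b f -> abs_continuous a b g ->
  abs_continuous a b (fun t => f t - g t).
Proof.
move=> fac gac e e0; have e2 : 0 < e / 2 by rewrite divr_gt0.
have [d1 d10 h1] := fac _ e2; have [d2 d20 h2] := gac _ e2.
exists (Num.min d1 d2); first by rewrite lt_min d10.
move=> N l r lr tI; rewrite lt_min => /andP[s1 s2].
apply: le_lt_trans (_ : _ <= \sum_i `|f (r i) - f (l i)| + \sum_i `|g (r i) - g (l i)|) _.
  rewrite -big_split; apply: ler_sum => i _.
  rewrite opprB [g (l i) - f (l i)]addrC addrACA [- g (r i) + g (l i)]addrC.
  by apply: le_trans (ler_normD _ _) _; rewrite [`|g (l i) - _|]distrC.
by rewrite (splitr e) ltrD ?h1 ?h2.
Qed.

Lemma abs_continuous_sub (V : normedModType R) (a b a' b' : R) (f : R -> V) :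
  a <= a' -> b' <= b -> abs_continuous a b f -> abs_continuous a' b' f.
Proof.
move=> aa bb fac e e0; have [d d0 h] := fac e e0; exists d => // N l r lr.
apply: h => i; have [h1 [h2 h3]] := lr i.
by rewrite (le_trans aa h1) (le_trans h3 bb).
Qed.

Lemma lipschitz_abs_continuous (V : normedModType R) (a b L : R) (f : R -> V) :
  (forall s t, a <= s <= b -> a <= t <= b -> `|f t - f s| <= L * `|t - s|) ->
  abs_continuous a b f.
Proof.
move=> lip e e0; pose L' := `|L| + 1.
have L'0 : 0 < L' by rewrite ltr_wpDl.
exists (e / L'); first by rewrite divr_gt0.
move=> N l r lr _; rewrite ltr_pdivlMr // mulrC mulr_sumr; apply: le_lt_trans.
apply: ler_sum => i _; have [al [lri rb]] := lr i.
apply: le_trans (lip _ _ _ _) _.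
- by rewrite al (le_trans lri rb).
- by rewrite rb (le_trans al lri).
rewrite ger0_norm ?subr_ge0 // ler_wpM2r ?subr_ge0 // /L'.
by apply: le_trans (ler_norm _) _; rewrite lerDl.
Qed.

Lemma abs_continuous_within (V : normedModType R) (a b : R) (f : R -> V) :
  abs_continuous a b f -> {within `[a, b], continuous f}.
Proof.
move=> fac; apply/within_continuousP => x; rewrite /= in_itv /= => /andP[ax xb] e e0.
have [d d0 h] := fac e e0; exists d => // y; rewrite /= in_itv /= => /andP[ay yb] xy.
have trivI (l r : R) : trivIset setT (fun i : 'I_1 => `]l, r[%classic : set R).
  by move=> i j _ _ _; rewrite !ord1.
have [xley|/ltW ylex] := leP x y.
- have := h 1%N (fun=> x) (fun=> y); rewrite !big_ord1 distrC; apply=> //.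
  by rewrite -(ger0_norm (_ : 0 <= y - x)) ?subr_ge0 // distrC.
- have := h 1%N (fun=> y) (fun=> x); rewrite !big_ord1; apply=> //.
  by rewrite -(ger0_norm (_ : 0 <= x - y)) ?subr_ge0.
Qed.

Lemma is_derive0_near (V : normedModType R) (g : R -> V) (t e : R) : 0 < e ->
  is_derive t 1 g 0 -> exists2 delta : R, 0 < delta &
    forall s, `|s - t| < delta -> `|g s - g t| <= e * `|s - t|.
Proof.
move=> e0 [/cvg_ex[l dl] dg].
have l0 : l = 0 by rewrite -dg; apply/esym/cvg_lim.
move: dl; rewrite l0 => /cvgrPdist_le /(_ e e0) /nbhs_normP [d d0 h].
exists d => // s sd; have [->|st] := eqVneq s t; first by rewrite !subrr !normr0 mulr0.
have st0 : s - t != 0 by rewrite subr_eq0.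
have := h (s - t); rewrite /= !sub0r !normrN => /(_ sd st0).
rewrite normrZ normrV ?unitfE // [_%:A]mulr1 subrK mulrC ler_pdivrMr ?normr_gt0 //.
Qed.

(* Cousin's lemma gives a tagged partition in which every interval is either
   tagged outside the exceptional null set, where the increment is at most
   [e] times the length, or contained in an open set of small measure. *)
Lemma abs_continuous_derive0 (V : normedModType R) (a b : R) (g : R -> V) :
  a <= b -> abs_continuous a b g ->
  {ae lebesgue_measure, forall t : R, a <= t <= b -> is_derive t 1 g 0} ->
  g b = g a.
Proof.
move=> ab gac [B [mB B0 hB]]; apply/eqP; rewrite -subr_eq0 -normr_le0.
apply/ler_addgt0Pr => e e0; rewrite add0r.
pose c := e / (2 * (b - a + 1)).
have ba1 : 0 < b - a + 1 by lra.
have c0 : 0 < c by rewrite divr_gt0 // mulr_gt0.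
have e2 : 0 < e / 2 by rewrite divr_gt0.
have [d d0 hd] := gac _ e2.
have Bfin : (lebesgue_measure B < +oo)%E by rewrite B0 ltry.
have [W [oW BW mWB]] := lebesgue_regularity_outer mB Bfin d0.
have mW : measurable W by exact: open_measurable.
have muW : (lebesgue_measure W < d%:E)%E.
  by rewrite -(setDUK BW) setUC measureU0 //; exact: measurableD.
(* [s] collects the intervals tagged in the null set, ordered from left to right so that
   concatenation keeps their interiors disjoint. All other intervals are already absorbed in the
   term [c * (r - l)]. *)
pose ok l r (s : seq (R * R)) :=
  [/\ pairwise (fun p q : R * R => p.2 <= q.1) s,
      forall p, p \in s -> [/\ l <= p.1, p.1 <= p.2, p.2 <= r & `[p.1, p.2] `<=` W]
    & `|g r - g l| <= c * (r - l) + \sum_(p <- s) `|g p.2 - g p.1|].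
have [s [ps hs gs]] : exists s, ok a b s.
  apply: (@cousin (fun l r => exists s, ok l r s)) => //.
    move=> l m r al lm mr rb [s1 [p1 h1 g1]] [s2 [p2 h2 g2]].
    exists (s1 ++ s2); split.
    - rewrite pairwise_cat p1 p2 !andbT; apply/allrelP => x y xs ys.
      have [_ _ xm _] := h1 x xs; have [my _ _ _] := h2 y ys.
      exact: le_trans xm my.
    - move=> p; rewrite mem_cat => /orP[/h1[? ? pm ?]|/h2[mp ? ? ?]]; split => //.
        exact: le_trans pm mr.
      exact: le_trans lm mp.
    - rewrite big_cat /= -(subrKA (g m)); apply: le_trans (ler_normD _ _) _; lra.
  move=> t tab; have [Bt|nBt] := pselect (B t).
    have /nbhs_normP[r r0 hr] := open_nbhs_nbhs (conj oW (BW _ Bt)).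
    exists r => // l u al lt tu ub ul; exists [:: (l, u)]; split => //.
      move=> p; rewrite inE => /eqP -> /=; split => //; first exact: le_trans lt tu.
      move=> x; rewrite /= in_itv /= => /andP[lx xu]; apply: hr => /=.
      by rewrite ltr_norml; lra.
    rewrite big_cons big_nil addr0 lerDr mulr_ge0 ?(ltW c0) // subr_ge0.
    exact: le_trans lt tu.
  have dg : is_derive t 1 g 0.
    by apply: contrapT => H; apply: nBt; apply: hB => /= /(_ tab).
  have [r r0 hr] := is_derive0_near c0 dg.
  exists r => // l u al lt tu ub ul; exists [::]; split => //.
  rewrite big_nil addr0 -(subrKA (g t)); apply: le_trans (ler_normD _ _) _.
  have := hr u; have := hr l; rewrite (distrC (g l)) (distrC l) !ger0_norm ?subr_ge0 //.
  move=> /(_ ltac:(lra)) ? /(_ ltac:(lra)) ?; lra.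
pose l (i : 'I_(size s)) := (nth (0, 0) s i).1.
pose r (i : 'I_(size s)) := (nth (0, 0) s i).2.
have lr i : [/\ a <= l i, l i <= r i, r i <= b & `[l i, r i] `<=` W].
  by apply: hs; exact: mem_nth.
have tI : trivIset setT (fun i => `]l i, r i[%classic : set R).
  have key (i j : 'I_(size s)) : (i < j)%N -> r i <= l j.
    by move=> ij; move/(pairwiseP (0, 0)) : ps; apply; rewrite ?inE /= ?ltn_ord.
  move=> i j _ _ [x [/=]]; rewrite !in_itv /= => /andP[lx xr] /andP[lx' xr'].
  apply/val_inj; case: (ltngtP i j) => // /key h; exfalso; lra.
have sumd : \sum_i (r i - l i) < d.
  rewrite -lte_fin; apply: le_lt_trans muW; apply: sum_lengths_le => //.
    by move=> i; have [] := lr i.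
  by move=> i; have [_ _ _ h] := lr i; apply: subset_trans h; exact: subset_itv_oo_cc.
have := hd _ l r _ tI sumd.
have -> : \sum_i `|g (r i) - g (l i)| = \sum_(p <- s) `|g p.2 - g p.1|.
  by rewrite (big_nth (0, 0)) big_mkord.
move=> /(_ _)/ltW H; apply: le_trans gs _.
have : c * (b - a) <= e / 2.
  have -> : e / 2 = c * (b - a + 1) by rewrite /c; field; rewrite gt_eqF.
  by rewrite ler_wpM2l ?(ltW c0) //; lra.
have := H (fun i => let: And4 h1 h2 h3 _ := lr i in conj h1 (conj h2 h3)).
lra.
Qed.

(** Subtracting a primitive [F] of the continuous [h] leaves an absolutely continuous function with
    zero derivative almost everywhere, hence a constant. [z = x 0 + F] is returned because nothing
    is known of [x] outside [[0, T]], so [x] itself may lack a two-sided derivative at the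
    endpoints. *)
Lemma caratheodory_classical n (T : R) (x h : R -> 'cV[R]_n) : 0 <= T ->
  abs_continuous 0 T x -> {within `[0, T], continuous h} ->
  {ae lebesgue_measure, forall t : R, 0 <= t <= T -> is_derive t 1 x (h t)} ->
  exists2 z : R -> 'cV[R]_n, (forall t, 0 <= t <= T -> z t = x t) &
    forall t, 0 <= t <= T -> is_derive t 1 z (h t).
Proof.
move=> T0 xac ch dx; have [F F0 dF] := vector_primitive_exists T0 ch.
have [M M0 hM] := bounded_on_segment ch.
have Fac : abs_continuous 0 T F.
  apply: (@lipschitz_abs_continuous _ _ _ (n%:R * M)) => s t sT tT.
  apply: le_trans (norm_le_enorm _) _.
  apply: (enorm_lipschitz dF) => // u uT; apply: le_trans (enorm_le_norm _) _.
  by rewrite ler_wpM2l ?ler0n ?hM.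
exists (fun t => x 0 + F t) => t tT; last first.
  by have := dF t tT => ?; apply: is_derive_eq; rewrite add0r.
have /andP[t0 tT'] := tT.
have := @abs_continuous_derive0 _ 0 t (fun s => x s - F s) t0.
rewrite F0 subr0 => <-; first by rewrite subrK.
  by apply: (abs_continuous_sub (lexx 0) tT'); exact: abs_continuousB.
apply: (@filterS _ _ (ae_filter_ringOfSetsType lebesgue_measure) _ _ _ dx) => s hs /andP[s0 st].
have sT : 0 <= s <= T by rewrite s0 (le_trans st tT').
have := hs sT => ?; have := dF s sT => ?.
by apply: is_derive_eq; rewrite subrr.
Qed.

Lemma classical_abs_continuous n (T : R) (z h : R -> 'cV[R]_n) :
  {within `[0, T], continuous h} ->
  (forall t, 0 <= t <= T -> is_derive t 1 z (h t)) -> abs_continuous 0 T z.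
Proof.
move=> ch dz; have [M M0 hM] := bounded_on_segment ch.
apply: (@lipschitz_abs_continuous _ _ _ (n%:R * M)) => s t sT tT.
apply: le_trans (norm_le_enorm _) _.
apply: (enorm_lipschitz dz) => // u uT; apply: le_trans (enorm_le_norm _) _.
by rewrite ler_wpM2l ?ler0n ?hM.
Qed.

End AbsoluteContinuity.

(** * Expectations of continuous functions *)

Section Expectation.
Context {R : realType} {V : normedModType R}.
Variables (mu : probability (Borel V) R) (K : set V).
Hypothesis cK : compact K.
Hypothesis muK : mu K = 1%E.

Let mK : measurable (K : set (Borel V)).
Proof.
rewrite -(setCK K); apply: measurableC; apply: sub_sigma_algebra.
by apply: closed_openC; exact: compact_closed (@norm_hausdorff _ _) cK.
Qed.

(** Open sets have relatively open preimages, which are Borel because the compact [K] is closed, and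
    [f] is bounded on [K]. Linearity and monotonicity of all expectations below rest on this. *)
Lemma continuous_integrable (f : V -> R) : {within K, continuous f} ->
  mu.-integrable K (EFin \o f).
Proof.
move=> cf; apply: measurable_bounded_integrable => //.
- by have h : (mu K < +oo)%E by rewrite muK ltry.
- apply: (measurability _ (RGenOpens.measurableE R)).
  move=> _ [_ [a [b ->] <-]].
  have /continuousP/(_ _ (interval_open _ _ : open (`]a, b[%classic : set R))) := cf.
  move=> /(_ isT isT)/open_subspaceP[W oW WD]; rewrite setIC -WD.
  by apply: measurableI => //; exact: sub_sigma_algebra.
- have /compact_bounded[M [_ mrt]] := continuous_compact cf cK.
  by exists M; split; rewrite ?num_real // => ? ? ? ?; exact: mrt.
Qed.

Local Notation E f := (\int[mu]_(w in K) f w).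

Lemma expectationD (f g : V -> R) :
  {within K, continuous f} -> {within K, continuous g} ->
  E (fun w => f w + g w) = E f + E g.
Proof. by move=> cf cg; rewrite RintegralD //; exact: continuous_integrable. Qed.

Lemma expectationB (f g : V -> R) :
  {within K, continuous f} -> {within K, continuous g} ->
  E (fun w => f w - g w) = E f - E g.
Proof. by move=> cf cg; rewrite RintegralB //; exact: continuous_integrable. Qed.

Lemma expectationZ (f : V -> R) a :
  {within K, continuous f} -> E (fun w => a * f w) = a * E f.
Proof. by move=> cf; rewrite RintegralZl //; exact: continuous_integrable. Qed.

Lemma expectation_cst (a : R) : E (fun=> a) = a.
Proof.
rewrite Rintegral_cst //; transitivity (a * fine (1%E : \bar R)); last by rewrite /= mulr1.
by congr (_ * fine _); exact: muK.
Qed.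

Lemma expectation_le (f g : V -> R) :
  {within K, continuous f} -> {within K, continuous g} ->
  (forall w, K w -> f w <= g w) -> E f <= E g.
Proof.
move=> cf cg fg.
exact: (le_Rintegral mK (continuous_integrable cf) (continuous_integrable cg)).
Qed.

Lemma expectation_dist (f g : V -> R) (e : R) :
  {within K, continuous f} -> {within K, continuous g} ->
  (forall w, K w -> `|f w - g w| <= e) -> `|E f - E g| <= e.
Proof.
move=> cf cg fg; rewrite -expectationB //.
have cfg : {within K, continuous (fun w => f w - g w)}.
  by move=> w; apply: cvgB; [exact: cf|exact: cg].
have ce a : {within K, continuous (fun=> a : R)} by move=> w; exact: cvg_cst.
rewrite ler_norml -{1}(expectation_cst (- e)) -[X in _ && (_ <= X)](expectation_cst e).
by apply/andP; split; apply: expectation_le => // w /fg; rewrite ler_norml => /andP[].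
Qed.

End Expectation.

(** * Uniformly convergent subsequences *)

Section UniformSubsequence.
Context {R : realType}.

Lemma uniform_cvg_dist {Z : choiceType} (W : normedModType R) (D : set Z)
    (f : nat -> Z -> W) (g : Z -> W) :
  (forall e : R, 0 < e -> exists N, forall j, (N <= j)%N ->
     forall z, D z -> `|g z - f j z| < e) ->
  {uniform D, f @ \oo --> g}.
Proof.
move=> h P /uniform_nbhs[E [entE EP]].
have [e e0 eE] : exists2 e : R, 0 < e & forall x y : W, `|x - y| < e -> E (x, y).
  move: entE; rewrite -entourage_ballE => -[e /= e0 eE]; exists e => // x y xy.
  by apply: eE; rewrite /= -ball_normE.
have [N hN] := h e e0.
change (\forall j \near \oo, P (f j)); near=> j; apply: EP => z Dz; apply: eE; apply: hN => //.
by near: j; exact: nbhs_infty_ge.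
Unshelve. all: by end_near. Qed.

Lemma nbhs_dist (W : normedModType R) (y : W) (r : R) : 0 < r ->
  nbhs y [set z | `|y - z| < r].
Proof. by move=> r0; apply/nbhs_normP; exists r. Qed.

(* A cluster point in the product topology inherits the modulus of
   equicontinuity, so closeness on a finite grid is uniform closeness. *)
Lemma equicontinuous_subsequence m (T : R) (U : set 'cV[R]_m)
    (u : nat -> R -> 'cV[R]_m) : 0 <= T -> compact U ->
  (forall k t, 0 <= t <= T -> U (u k t)) ->
  (forall e : R, 0 < e -> exists2 d : R, 0 < d & forall k s t,
     0 <= s <= T -> 0 <= t <= T -> `|s - t| < d -> `|u k s - u k t| < e) ->
  exists (phi : nat -> nat) (us : R -> 'cV[R]_m),
    [/\ {homo phi : i j / (i < j)%N}, forall t, 0 <= t <= T -> U (us t)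
      & forall e : R, 0 < e -> exists N, forall j, (N <= j)%N ->
          forall t, 0 <= t <= T -> `|us t - u (phi j) t| < e].
Proof.
move=> T0 cU uU equi.
(* Clamping keeps the values in [U] at every real [t], so that Tychonoff's theorem applies to the
   product over the whole line. *)
pose v k t := u k (clamp T t).
have cK := @tychonoff R (fun=> 'cV[R]_m) (fun=> U) (fun=> cU).
pose F := (v k : prod_topology (fun _ : R => 'cV[R]_m)) @[k --> \oo].
have FK : F [set f : R -> 'cV[R]_m | forall t, U (f t)].
  change (\forall k \near \oo, forall t, U (v k t)).
  by apply: nearW => k t; apply: uU; exact: clamp_in.
have [us [usU cl]] := cK F _ FK.
have F_us : Filter (nbhs (us : prod_topology (fun _ : R => 'cV[R]_m))).
  exact: nbhs_filter.
have near_pt t (e : R) : 0 < e ->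
    nbhs (us : prod_topology (fun _ : R => 'cV[R]_m)) [set f | `|us t - f t| < e].
  move=> e0; have := @proj_continuous R (fun=> 'cV[R]_m) t us.
  move=> /(_ [set y | `|us t - y| < e]); apply.
  exact: nbhs_dist.
have clus B N : nbhs (us : prod_topology (fun _ : R => 'cV[R]_m)) B ->
    exists2 k, (N <= k)%N & B (v k).
  move=> Bn; have FN : F [set f | exists2 k, (N <= k)%N & f = v k].
    change (\forall k \near \oo, exists2 k', (N <= k')%N & v k = v k').
    by near=> k; exists k => //; near: k; exact: nbhs_infty_ge.
  by have [f [[k Nk ->] Bf]] := cl _ _ FN Bn; exists k.
have close N (e : R) : 0 < e -> exists2 k, (N <= k)%N &
    forall t, 0 <= t <= T -> `|us t - u k t| < e.
  move=> e0; have e4 : 0 < e / 4 by rewrite divr_gt0.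
  have e8 : 0 < e / 8 by rewrite divr_gt0.
  have [d d0 hd] := equi _ e4.
  have us_equi s t : 0 <= s <= T -> 0 <= t <= T -> `|s - t| < d -> `|us s - us t| < e / 2.
    move=> sT tT st.
    have [k _ [ks kt]] : exists2 k, (0 <= k)%N &
        `|us s - v k s| < e / 8 /\ `|us t - v k t| < e / 8.
      apply: (clus [set f | `|us s - f s| < e / 8 /\ `|us t - f t| < e / 8] 0%N).
      exact: (@filterI _ _ F_us _ _ (near_pt s _ e8) (near_pt t _ e8)).
    rewrite /v !clamp_id // in ks kt; have := hd k s t sT tT st.
    rewrite distrC in kt.
    have := ler_normD (us s - u k s) (u k s - u k t).
    have := ler_normD (us s - u k t) (u k t - us t); rewrite !subrKA; lra.
  pose h := d / 2; have h0 : 0 < h by rewrite divr_gt0.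
  (* The grid points [i * h] with [i < M] include, for each [t] of the segment, one at distance less
     than [h] to its left. *)
  pose M := (Num.truncn (T / h)).+1.
  have [k Nk /= hk] : exists2 k, (N <= k)%N &
      forall i : 'I_M, `|us (i%:R * h) - v k (i%:R * h)| < e / 4.
    apply: (clus [set f | forall i : 'I_M, `|us (i%:R * h) - f (i%:R * h)| < e / 4]).
    apply: (@filter_forall _ _ (fun (i : 'I_M) f => `|us (i%:R * h) - f (i%:R * h)| < e / 4)
      _ F_us) => i.
    exact: near_pt.
  exists k => // t tT; have /andP[t0 tT'] := tT.
  have th0 : 0 <= t / h by rewrite divr_ge0 // ltW.
  have /andP[i1 i2] := truncn_itv th0.
  set i := Num.truncn (t / h) in i1 i2.
  have iM : (i < M)%N.
    by rewrite ltnS /i; apply: le_truncn; rewrite ler_pM2r ?invr_gt0.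
  have := hk (Ordinal iM); rewrite /=; set s := i%:R * h => hs.
  have st : s <= t by rewrite /s -ler_pdivlMr.
  have ts : t < s + h by move: i2; rewrite ltr_pdivrMr // -natr1 mulrDl mul1r.
  have s0 : 0 <= s by rewrite mulr_ge0 // ltW.
  have sT : 0 <= s <= T by rewrite s0 (le_trans st tT').
  rewrite /v clamp_id // in hs.
  have tsd : `|t - s| < d by rewrite ger0_norm ?subr_ge0 // /h in ts *; lra.
  have := us_equi t s tT sT tsd; rewrite distrC in tsd; have := hd k s t sT tT tsd.
  have := ler_normD (us t - us s) (us s - u k s).
  have := ler_normD (us t - u k s) (u k s - u k t); rewrite !subrKA; lra.
(* [sel (N, j)] is an index at least [N] with error below [1 / (j + 1)]; feeding it the successor of
   the previous index makes [phi] strictly increasing. *)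
have /choice[sel hsel] : forall Nj : nat * nat, exists k, (Nj.1 <= k)%N /\
    forall t, 0 <= t <= T -> `|us t - u k t| < Nj.2.+1%:R^-1.
  move=> [N j]; have [|k Nk hk] := close N j.+1%:R^-1; last by exists k.
  by rewrite invr_gt0.
pose phi := fix phi j := if j is j'.+1 then sel ((phi j').+1, j) else sel (0%N, 0%N).
have phiS j : (phi j < phi j.+1)%N by have [] := hsel ((phi j).+1, j.+1).
exists phi, us; split.
- by apply: homo_ltn => // x y z; exact: ltn_trans.
- by [].
- move=> e e0; have einv := archi_boundP (ltW (divr_gt0 ltr01 e0)).
  exists (Num.bound (1 / e)) => j Nj t tT.
  have lt1 : `|us t - u (phi j) t| < j.+1%:R^-1.
    case: j {Nj} => [|j]; first by have [_ h] := hsel (0%N, 0%N); exact: h.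
    by have [_ h] := hsel ((phi j).+1, j.+1); exact: h.
  apply: lt_trans lt1 _; rewrite invf_plt ?posrE // -div1r.
  by apply: lt_le_trans einv _; rewrite ler_nat (leq_trans Nj).
Unshelve. all: by end_near. Qed.

End UniformSubsequence.

(** * Differential calculus on segments *)

Section DerivativeOnSegment.
Context {R : realType} (T : R).
Hypothesis T0 : 0 <= T.

(* [f] is the derivative of [x] along [0, T], one-sided at the endpoints. *)
Definition has_derivative_on (W : normedModType R) (x f : R -> W) : Prop :=
  exists2 z : R -> W, (forall t, 0 <= t <= T -> z t = x t) &
    forall t, 0 <= t <= T -> is_derive t 1 z (f t).

Lemma has_derivative_onB (W : normedModType R) (x y f g : R -> W) :
  has_derivative_on x f -> has_derivative_on y g ->
  has_derivative_on (fun t => x t - y t) (fun t => f t - g t).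
Proof.
move=> [z zx dz] [z' zy dz']; exists (fun t => z t - z' t) => t tT.
  by rewrite zx ?zy.
by apply: is_deriveB; [exact: dz|exact: dz'].
Qed.

Lemma has_derivative_onD (W : normedModType R) (x y f g : R -> W) :
  has_derivative_on x f -> has_derivative_on y g ->
  has_derivative_on (fun t => x t + y t) (fun t => f t + g t).
Proof.
move=> [z zx dz] [z' zy dz']; exists (fun t => z t + z' t) => t tT.
  by rewrite zx ?zy.
by apply: is_deriveD; [exact: dz|exact: dz'].
Qed.

Lemma has_derivative_onZ (a : R) (x f : R -> R) :
  has_derivative_on x f -> has_derivative_on (fun t => a * x t) (fun t => a * f t).
Proof.
move=> [z zx dz]; exists (fun t => a * z t) => t tT; first by rewrite zx.
exact: (@is_deriveZ _ _ _ z a t 1 _ (dz t tT)).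
Qed.

Lemma has_derivative_on_ext (W : normedModType R) (x f g : R -> W) :
  (forall t, 0 <= t <= T -> f t = g t) ->
  has_derivative_on x f -> has_derivative_on x g.
Proof. by move=> fg [z zx dz]; exists z => // t tT; rewrite -fg //; exact: dz. Qed.

Lemma has_derivative_on_dot n (p x f g : R -> 'cV[R]_n) :
  has_derivative_on p f -> has_derivative_on x g ->
  has_derivative_on (fun t => dot (p t) (x t)) (fun t => dot (f t) (x t) + dot (p t) (g t)).
Proof.
move=> [z zp dz] [z' zx dz']; exists (fun t => dot (z t) (z' t)) => t tT.
  by rewrite zp ?zx.
by have := is_derive_dot (dz t tT) (dz' t tT); rewrite zp ?zx.
Qed.

Lemma has_derivative_on_rev (W : normedModType R) (x f : R -> W) :
  has_derivative_on x f ->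
  has_derivative_on (fun t => x (T - t)) (fun t => - f (T - t)).
Proof.
move=> [z zx dz].
have rev t : 0 <= t <= T -> 0 <= T - t <= T by lra.
exists (fun t => z (-1 * t + T)) => t tT.
  by rewrite mulN1r addrC zx // rev.
have -> : - f (T - t) = -1 *: f (T - t) by rewrite scaleN1r.
by apply: is_derive_comp_affine; rewrite mulN1r addrC; apply: dz; exact: rev.
Qed.

Lemma has_derivative_on_id : has_derivative_on (id : R -> R) (fun=> 1).
Proof. by exists id => // t _; exact: is_derive_id. Qed.

Lemma has_derivative_on_linear (a : R) : has_derivative_on (fun t => a * t) (fun=> a).
Proof.
by apply: has_derivative_on_ext (has_derivative_onZ a has_derivative_on_id) => t _; rewrite mulr1.
Qed.

Lemma has_derivative_on_le (F G f g : R -> R) a b :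
  has_derivative_on F f -> has_derivative_on G g -> 0 <= a -> a <= b -> b <= T ->
  (forall t, a <= t <= b -> f t <= g t) -> F b - F a <= G b - G a.
Proof.
move=> [z zF dz] [z' zG dz'] a0 ab bT fg.
have sub t : a <= t <= b -> 0 <= t <= T by lra.
rewrite -!zF -?zG; try lra.
exact: (le_increment ab (fun t h => dz t (sub t h)) (fun t h => dz' t (sub t h))).
Qed.

Lemma has_derivative_on_nondecreasing (F f : R -> R) a b :
  has_derivative_on F f -> (forall t, 0 <= t <= T -> 0 <= f t) ->
  0 <= a -> a <= b -> b <= T -> F a <= F b.
Proof.
move=> dF f0 a0 ab bT.
have := has_derivative_on_le (has_derivative_on_linear 0) dF a0 ab bT.
by rewrite !mul0r subrr subr_ge0; apply => t tab; apply: f0; lra.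
Qed.

Lemma has_derivative_on_gronwall n (x f : R -> 'cV[R]_n) (G g : R -> R) (L : R) : 0 <= L ->
  has_derivative_on x f -> has_derivative_on G g ->
  (forall t, 0 <= t <= T -> 0 <= g t) ->
  (forall t, 0 <= t <= T -> enorm (f t) <= L * enorm (x t) + g t) ->
  forall t, 0 <= t <= T ->
    enorm (x t) <= (enorm (x 0) + (G t - G 0)) * expR (L * t).
Proof.
move=> L0 [z zx dz] [z' zG dz'] g0 fg t tT.
have Z0 : 0 <= (0 : R) <= T by lra.
rewrite -!zx // -!zG //; apply: (gronwall L0 dz dz') => // s sT.
by rewrite zx //; exact: fg.
Qed.

Lemma has_derivative_on_lipschitz n (x f : R -> 'cV[R]_n) (L : R) :
  has_derivative_on x f -> (forall t, 0 <= t <= T -> enorm (f t) <= L) ->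
  forall s t, 0 <= s <= T -> 0 <= t <= T -> enorm (x t - x s) <= L * `|t - s|.
Proof.
move=> [z zx dz] fL s t sT tT; rewrite -!zx //.
exact: (enorm_lipschitz dz).
Qed.

Lemma has_derivative_on_continuous (W : normedModType R) (x f : R -> W) :
  has_derivative_on x f -> {within `[0, T], continuous x}.
Proof.
move=> [z zx dz].
have /within_continuousP cz : {within `[0, T], continuous z}.
  by apply: derivable_within_continuous => t; rewrite in_itv /= => /dz[].
apply/within_continuousP => t It e e0; have [r r0 h] := cz t It e e0.
have inI u : `[0, T]%classic u -> 0 <= u <= T by rewrite /= in_itv.
by exists r => // s Is ts; rewrite -!zx ?inI //; exact: h.
Qed.

Lemma primitive_on (f : R -> R) : {within `[0, T], continuous f} ->
  exists2 F : R -> R, F 0 = 0 & has_derivative_on F f.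
Proof. by move=> cf; have [F F0 dF] := primitive_exists T0 cf; exists F => //; exists F. Qed.

Lemma has_derivative_on_sqr (x f : R -> R) : has_derivative_on x f ->
  has_derivative_on (fun t => x t ^+ 2) (fun t => 2 * (x t * f t)).
Proof.
move=> [z zx dz]; exists (fun t => z t ^+ 2) => t tT; first by rewrite zx.
have := dz t tT; rewrite -zx // => dzt; apply: is_derive_eq.
by rewrite scale_real mulr_natl mulr2n.
Qed.

(* Cauchy-Schwarz for [y' = sqrt Q'], from [2 l y' <= l^2 + Q'] with [l = y t / t]. *)
Lemma sqr_primitive_le (y Q g : R -> R) t : y 0 = 0 -> Q 0 = 0 ->
  has_derivative_on y g -> has_derivative_on Q (fun t => g t ^+ 2) ->
  0 <= t <= T -> y t ^+ 2 <= t * Q t.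
Proof.
move=> y0 Q0 dy dQ /andP[t0 tT].
have [->|tn0] := eqVneq t 0; first by rewrite y0 expr0n mul0r.
have tp : 0 < t by rewrite lt_neqAle eq_sym tn0.
pose l := y t / t.
have := has_derivative_on_le (has_derivative_onZ (2 * l) dy)
  (has_derivative_onD (has_derivative_on_linear (l ^+ 2)) dQ) (lexx 0) t0 tT.
rewrite y0 Q0 !mulr0 addr0 !subr0 => H.
have {H} : 2 * l * y t <= l ^+ 2 * t + Q t.
  by apply: H => s _; rewrite -subr_ge0; have := sqr_ge0 (l - g s); congr (0 <= _); ring.
have -> : 2 * l * y t = l ^+ 2 * t + y t ^+ 2 / t by rewrite /l; field.
by rewrite lerD2l ler_pdivrMr // mulrC.
Qed.

End DerivativeOnSegment.

(** * Mean value estimates along segments of a convex set *)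

Section PartialsOnSegments.
Context {R : realType} {m : nat}.

Lemma convex_setP (W : lmodType R) (U : set W) (u v : W) (s : R) : convex_set U ->
  U u -> U v -> 0 <= s <= 1 -> U (u + s *: (v - u)).
Proof.
move=> cU Uu Uv s01.
have := cU v u (Itv01 (proj1 (andP s01)) (proj2 (andP s01))).
move=> /(_ (mem_set Uv) (mem_set Uu))/set_mem.
have -> // : u + s *: (v - u) = s *: v + (1 - s) *: u.
by rewrite scalerBr scalerBl scale1r addrCA.
Qed.

Lemma has_partials_near (W : normedModType R) (U : set 'cV[R]_m) (f : 'cV[R]_m -> W) df :
  has_partials_on U f df -> forall u, U u -> forall e : R, 0 < e ->
  exists2 r : R, 0 < r & forall v, U v -> `|v - u| < r ->
    `|f v - f u - \sum_i (v - u) i 0 *: df u i| <= e * `|v - u|.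
Proof.
move=> hf u Uu e e0; have H := hf u Uu.
have : \forall v \near within U (nbhs u),
    `|f v - f u - \sum_i (v - u) i 0 *: df u i| <= e * `|v - u|.
  move: H; set g := (X in X = _) => gE.
  change (\forall v \near within U (nbhs u), `|g v| <= e * `|v - u|).
  by rewrite gE; apply: littleoP.
move=> /nbhs_normP[r r0 h]; exists r => // v Uv vu; apply: h => //=.
by rewrite distrC.
Qed.

(** Differentiability is asked for inside the segment only: at its ends, a function given on [U] has
    a one-sided derivative at best. As for increments in time, testing against [z 1 - z 0] reduces
    to the scalar mean value theorem. *)
Lemma segment_lipschitz n (z dz : R -> 'cV[R]_n) (L : R) :
  {within `[0, 1], continuous z} ->
  (forall s : R, 0 < s < 1 -> is_derive s 1 z (dz s)) ->
  (forall s : R, 0 < s < 1 -> enorm (dz s) <= L) -> enorm (z 1 - z 0) <= L.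
Proof.
move=> cz hz hL; set v := z 1 - z 0.
have cf : {within `[0, 1], continuous (fun s => dot v (z s))}.
  apply/within_continuousP => x Ix e e0.
  have e1 : 0 < e / (enorm v + 1) / (n%:R + 1).
    by rewrite !divr_gt0 // ltr_wpDl ?enorm_ge0 ?ler0n.
  have /within_continuousP/(_ x Ix _ e1)[r r0 h] := cz.
  exists r => // y Iy xy; rewrite -dotBr; apply: le_lt_trans (dot_norm_le _ _) _.
  have n1 : 0 < n%:R + 1 :> R by rewrite ltr_wpDl ?ler0n.
  have v1 : 0 < enorm v + 1 by rewrite ltr_wpDl ?enorm_ge0.
  have := h y Iy xy; rewrite ltr_pdivlMr // ltr_pdivlMr // => h'.
  apply: le_lt_trans h'; rewrite mulrC.
  apply: ler_pM; rewrite ?enorm_ge0 ?lerDl //.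
  apply: le_trans (enorm_le_norm _) _; rewrite mulrC ler_wpM2l ?lerDl //.
have [|//|c cI E] := @MVT R (fun s => dot v (z s)) (fun s => dot v (dz s)) 0 1 ltr01.
  by move=> s; rewrite in_itv /= => s01; apply: is_derive_cdot; exact: hz.
have [v0|v0] := eqVneq (enorm v) 0.
  by rewrite v0; apply: le_trans (enorm_ge0 (dz c)) (hL c _); move: cI; rewrite in_itv.
have vp : 0 < enorm v by rewrite lt_neqAle eq_sym v0 enorm_ge0.
rewrite -(ler_pM2l vp) -expr2 -dotvv {2}/v dotBr E subr0 mulr1.
apply: le_trans (dot_le _ _) _; rewrite ler_wpM2l ?enorm_ge0 // hL //.
Qed.

(* Three applications of the mean value theorem to the convex function
   [c s^2 / 2 - f s]. *)
Lemma second_derivative_gap (f df ddf : R -> R) (c : R) :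
  {within `[0, 1], continuous f} ->
  (forall s : R, 0 < s < 1 -> is_derive s 1 f (df s)) ->
  (forall s : R, 0 < s < 1 -> is_derive s 1 df (ddf s)) ->
  (forall s : R, 0 < s < 1 -> ddf s <= c) ->
  forall s : R, 0 < s < 1 ->
    (1 - s) * f 0 + s * f 1 - c / 2 * (s * (1 - s)) <= f s.
Proof.
move=> cf hf hdf hc s /andP[s0 s1].
have cfs a b : 0 <= a -> b <= 1 -> {within `[a, b], continuous f}.
  move=> a0 b1; apply: continuous_subspaceW cf => x /=; rewrite !in_itv /= => /andP[ax xb].
  by rewrite (le_trans a0 ax) (le_trans xb b1).
pose g (x : R) := c / 2 * x ^+ 2 - f x.
pose dg x := c * x - df x.
have hg (x : R) : 0 < x < 1 -> is_derive x 1 g (dg x).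
  move=> x01; apply: is_deriveB; last exact: hf.
  by apply: is_derive_eq; rewrite /GRing.scale /=; field.
have cg a b : 0 <= a -> b <= 1 -> {within `[a, b], continuous g}.
  have cp : continuous (fun x : R => c / 2 * x ^+ 2).
    by move=> y; apply: cvgM; [exact: cvg_cst|exact: exprn_continuous].
  move=> a0 b1 x; apply: cvgB; last exact: cfs.
  exact: (continuous_subspaceT cp).
have [||c1 c1I E1] := @MVT R g dg 0 s s0.
  by move=> x; rewrite in_itv /= => ?; apply: hg; lra.
  by apply: cg => //; exact: ltW.
have [||c2 c2I E2] := @MVT R g dg s 1 s1.
  by move=> x; rewrite in_itv /= => ?; apply: hg; lra.
  by apply: cg => //; exact: ltW.
rewrite in_itv /= in c1I; rewrite in_itv /= in c2I.
have c12 : c1 <= c2 by lra.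
have dgle : dg c1 <= dg c2.
  have := @le_increment R df (fun x => c * x) ddf (fun=> c) c1 c2 c12.
  rewrite /dg => H; have : df c2 - df c1 <= c * c2 - c * c1; last by lra.
  apply: H => x xc; [|by apply: is_derive_eq; rewrite scale_real mulr1|].
    by apply: hdf; lra.
  by apply: hc; lra.
have : (1 - s) * (dg c1 * s) <= (1 - s) * (dg c2 * s).
  by rewrite ler_wpM2l ?subr_ge0 ?(ltW s1) // ler_wpM2r // ltW.
move: E1 E2; rewrite /g subr0 expr0n /= expr1n => E1 E2.
have -> : (1 - s) * (dg c1 * s) = (1 - s) * (c / 2 * s ^+ 2 - f s - (c / 2 * 0 - f 0)).
  by rewrite E1.
have -> : (1 - s) * (dg c2 * s) = s * (c / 2 * 1 - f 1 - (c / 2 * s ^+ 2 - f s)).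
  by rewrite E2; ring.
move=> H; rewrite -subr_ge0 in H; rewrite -subr_ge0; move: H; congr (0 <= _).
ring.
Qed.

Section AlongSegment.
Variables (U : set 'cV[R]_m) (u v : 'cV[R]_m).
Hypotheses (cU : convex_set U) (Uu : U u) (Uv : U v).

Let path (s : R) := u + s *: (v - u).

Let pathU s : 0 <= s <= 1 -> U (path s).
Proof. exact: convex_setP. Qed.

Let path0 : path 0 = u.
Proof. by rewrite /path scale0r addr0. Qed.

Let path1 : path 1 = v.
Proof. by rewrite /path scale1r addrC subrK. Qed.

Let pathB s t : path t - path s = (t - s) *: (v - u).
Proof. by rewrite /path opprD addrACA subrr add0r scalerBl. Qed.

(** One first-order expansion, endpoints included, yields both the derivative inside the segment and
    continuity on all of it. The 1 in [h] covers the case [u = v]. *)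
Lemma partials_segment_estimate (W : normedModType R) (f : 'cV[R]_m -> W) df :
  has_partials_on U f df -> forall s, 0 <= s <= 1 -> forall e : R, 0 < e ->
  exists2 r : R, 0 < r & forall t, 0 <= t <= 1 -> `|t - s| < r ->
    `|f (path t) - f (path s) - (t - s) *: \sum_i (v - u) i 0 *: df (path s) i|
      <= e * `|t - s|.
Proof.
move=> hf s s01 e e0; pose h := `|v - u| + 1.
have h0 : 0 < h by rewrite ltr_wpDl.
have eh : 0 < e / h by rewrite divr_gt0.
have [r r0 hr] := has_partials_near hf (pathU s01) eh.
exists (r / h) => [|t t01 ts]; first by rewrite divr_gt0.
have leh : `|path t - path s| <= h * `|t - s|.
  by rewrite pathB normrZ mulrC ler_wpM2r // lerDl.
have near_s : `|path t - path s| < r.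
  by apply: le_lt_trans leh _; rewrite mulrC -ltr_pdivlMr.
have := hr _ (pathU t01) near_s.
have -> : \sum_i (path t - path s) i 0 *: df (path s) i =
    (t - s) *: \sum_i (v - u) i 0 *: df (path s) i.
  rewrite scaler_sumr; apply: eq_bigr => i _.
  have -> : (path t - path s) i 0 = (t - s) * (v - u) i 0 by rewrite pathB mxE.
  by rewrite scalerA.
move=> /le_trans; apply; rewrite -mulrA ler_wpM2l ?(ltW e0) //.
by rewrite ler_pdivrMl // mulrC.
Qed.

Lemma partials_segment_derive (W : normedModType R) (f : 'cV[R]_m -> W) df :
  has_partials_on U f df -> forall s : R, 0 < s < 1 ->
  is_derive s 1 (fun s => f (path s)) (\sum_i (v - u) i 0 *: df (path s) i).
Proof.
move=> hf s /andP[s0 s1]; set D := \sum_i _.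
have cv : (fun h : R => h^-1 *: (((fun s => f (path s)) \o shift s) (h *: 1) - f (path s)))
    @ 0^' --> D.
  apply/cvgrPdist_le => e e0.
  have s01 : 0 <= s <= 1 by rewrite !ltW.
  have [r r0 hr] := partials_segment_estimate hf s01 e0.
  have k0 : 0 < Num.min r (Num.min s (1 - s)) by rewrite !lt_min r0 s0 subr_gt0.
  exists (Num.min r (Num.min s (1 - s))) => //= h.
  rewrite /ball_ /= sub0r normrN !lt_min => /and3P[hr' hs hs1] hn0.
  have scale1 : h *: (1 : R) = h by exact: mulr1.
  rewrite scale1.
  have hsB : h + s - s = h by rewrite addrK.
  have t01 : 0 <= h + s <= 1.
    have := ler_norm h; have := ler_norm (- h); rewrite normrN; lra.
  have := hr _ t01; rewrite hsB => /(_ hr') H.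
  rewrite -(scalerK hn0 D) -scalerBr normrZ normrV ?unitfE // ler_pdivrMl ?normr_gt0 //.
  by rewrite distrC mulrC.
by split; [apply/cvg_ex; exists D|exact: cvg_lim].
Qed.

Lemma partials_segment_continuous (W : normedModType R) (f : 'cV[R]_m -> W) df :
  has_partials_on U f df -> {within `[0, 1], continuous (fun s => f (path s))}.
Proof.
move=> hf; apply/within_continuousP => s; rewrite /= in_itv /= => s01 e e0.
have [r r0 hr] := partials_segment_estimate hf s01 ltr01.
set D := \sum_i _ in hr; pose c := `|D| + 1.
have c0 : 0 < c by rewrite ltr_wpDl.
exists (Num.min r (e / c)); first by rewrite lt_min r0 divr_gt0.
move=> t; rewrite /= in_itv /= => t01; rewrite distrC lt_min => /andP[tr te].
rewrite distrC -(subrK ((t - s) *: D) (f _ - _)).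
apply: le_lt_trans (ler_normD _ _) _; rewrite normrZ.
apply: (@le_lt_trans _ _ (c * `|t - s|)); last by rewrite mulrC -ltr_pdivlMr.
by have := hr t t01 tr; rewrite /c; lra.
Qed.

Lemma partials_lipschitz n (f : 'cV[R]_m -> 'cV[R]_n) df (G : R) :
  has_partials_on U f df ->
  (forall w, U w -> enorm (\sum_i (v - u) i 0 *: df w i) <= G) ->
  enorm (f v - f u) <= G.
Proof.
move=> hf hG.
have := segment_lipschitz (partials_segment_continuous hf) (partials_segment_derive hf).
rewrite path0 path1; apply => s /andP[s0 s1].
by apply: hG; apply: pathU; rewrite !ltW.
Qed.

Lemma second_partials_gap (f : 'cV[R]_m -> R) df ddf (c : R) :
  has_partials_on U f df ->
  (forall j, has_partials_on U (fun w => df w j) (fun w i => ddf w i j)) ->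
  (forall w, U w -> \sum_j \sum_i (v - u) j 0 * ((v - u) i 0 * ddf w i j) <= c) ->
  forall s, 0 < s < 1 ->
    (1 - s) * f u + s * f v - c / 2 * (s * (1 - s)) <= f (u + s *: (v - u)).
Proof.
move=> hf hdf hc s s01.
have := @second_derivative_gap (fun s => f (path s))
  (fun s => \sum_j (v - u) j 0 *: df (path s) j)
  (fun s => \sum_j (v - u) j 0 *: \sum_i (v - u) i 0 *: ddf (path s) i j) c
  (partials_segment_continuous hf) (partials_segment_derive hf).
rewrite path0 path1 => H; apply: H => // r /andP[r0 r1].
- have -> : (fun s => \sum_j (v - u) j 0 *: df (path s) j) =
      \sum_j (fun s => (v - u) j 0 *: df (path s) j).
    by apply/funext => x; rewrite fct_sumE.
  apply: is_derive_sum => j; apply: is_deriveZ.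
  by apply: (partials_segment_derive (hdf j)); rewrite r0.
- have r01 : 0 <= r <= 1 by rewrite !ltW.
  apply: le_trans (hc _ (pathU r01)); rewrite le_eqVlt; apply/orP; left; apply/eqP.
  by apply: eq_bigr => j _; rewrite scale_real mulr_sumr.
Qed.

End AlongSegment.

End PartialsOnSegments.

(** * Dependence of the coefficients on the control *)

Section PartialsOfComposites.
Context {R : realType} {m : nat} (U : set 'cV[R]_m).

Lemma has_partials_intro (W : normedModType R) (f : 'cV[R]_m -> W) df :
  (forall u, U u -> forall e : R, 0 < e -> exists2 r : R, 0 < r &
    forall v, U v -> `|v - u| < r ->
      `|f v - f u - \sum_i (v - u) i 0 *: df u i| <= e * `|v - u|) ->
  has_partials_on U f df.
Proof.
move=> h u Uu; apply/eqoP => e e0; have [r r0 hr] := h u Uu e e0.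
have : \forall v \near within U (nbhs u),
    `|f v - f u - \sum_i (v - u) i 0 *: df u i| <= e * `|v - u|.
  rewrite near_withinE; apply: filterS (nbhs_dist u r0) => v /= uv Uv.
  by apply: hr => //; rewrite distrC.
exact.
Qed.

(** Applied to [M |-> M y], [M |-> q . (M y)] and [x |-> q . x], it brings [A] and [B] down to the
    vector-valued and scalar functions for which the segment estimates hold. *)
Lemma has_partials_linear (W W' : normedModType R) (L : W -> W') (K : R) f df :
  (forall a x y, L (a *: x + y) = a *: L x + L y) -> (forall x, `|L x| <= K * `|x|) ->
  has_partials_on U f df ->
  has_partials_on U (fun v => L (f v)) (fun v i => L (df v i)).
Proof.
move=> linL bL hf; apply: has_partials_intro => u Uu e e0.
have K0 : 0 < `|K| + 1 by rewrite ltr_wpDl.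
have eK : 0 < e / (`|K| + 1) by rewrite divr_gt0.
have [r r0 hr] := has_partials_near hf Uu eK.
have L0 : L 0 = 0.
  by have := linL (-1) 0 0; rewrite scaler0 addr0 scaleN1r addNr.
have LD x y : L (x + y) = L x + L y by rewrite -[x in LHS]scale1r linL scale1r.
have LZ a x : L (a *: x) = a *: L x by rewrite -[a *: x]addr0 linL L0 addr0.
have Lsum (F : 'I_m -> W) : L (\sum_i F i) = \sum_i L (F i).
  by elim/big_rec2 : _ => // i x y _ <-; rewrite LD.
have LB x y : L (x - y) = L x - L y by rewrite -scaleN1r addrC linL scaleN1r addrC.
exists r => // v Uv uv.
under eq_bigr do rewrite -LZ; rewrite -Lsum -!LB; apply: le_trans (bL _) _.
apply: (@le_trans _ _ ((`|K| + 1) * `|f v - f u - \sum_i (v - u) i 0 *: df u i|)).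
  by rewrite ler_wpM2r // (le_trans (ler_norm K)) // lerDl.
by rewrite -ler_pdivlMl // mulrA [_^-1 * e]mulrC; exact: hr.
Qed.

Lemma has_partials_onD (W : normedModType R) (f g : 'cV[R]_m -> W) df dg :
  has_partials_on U f df -> has_partials_on U g dg ->
  has_partials_on U (fun v => f v + g v) (fun v i => df v i + dg v i).
Proof.
move=> hf hg; apply: has_partials_intro => u Uu e e0.
have e2 : 0 < e / 2 by rewrite divr_gt0.
have [r r0 hr] := has_partials_near hf Uu e2.
have [r' r'0 hr'] := has_partials_near hg Uu e2.
exists (Num.min r r') => [|v Uv]; first by rewrite lt_min r0.
rewrite lt_min => /andP[vr vr'].
have -> : f v + g v - (f u + g u) - \sum_i (v - u) i 0 *: (df u i + dg u i) =
    (f v - f u - \sum_i (v - u) i 0 *: df u i) + (g v - g u - \sum_i (v - u) i 0 *: dg u i).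
  under eq_bigr do rewrite scalerDr.
  by rewrite big_split /= !opprD [f v + g v + (- f u - g u)]addrACA [LHS]addrACA.
apply: le_trans (ler_normD _ _) _.
by rewrite [X in X * _]splitr mulrDl lerD ?hr ?hr'.
Qed.

End PartialsOfComposites.

Section ProblemEstimates.
Context {R : realType} {d d' m n : nat} (P : problem R d d' m n).
Hypothesis HP : standing_assumptions P.

Local Notation T := (hT P).

Lemma T_ge0 : 0 <= T. Proof. by rewrite ltW // (hT_gt0 HP). Qed.

Lemma domain_in t w u : 0 <= t <= T -> Omt P w -> U P u -> domain (P := P) (t, w, u).
Proof. by move=> tT Ow Uu; split => //; split => //=; rewrite in_itv. Qed.

Lemma U_segment u v s : U P u -> U P v -> 0 <= s <= 1 -> U P (u + s *: (v - u)).
Proof. exact: convex_setP (U_convex HP). Qed.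

Lemma G_A_ge0 : 0 <= G_A P.
Proof.
apply: sup_ge0 => _ [z _ <-]; apply: sup_ge0 => _ [v _ <-]; exact: spnorm_ge0.
Qed.

Lemma G_B_ge0 : 0 <= G_B P.
Proof.
apply: sup_ge0 => _ [z _ <-]; apply: sup_ge0 => _ [v _ <-]; exact: enorm_ge0.
Qed.

Lemma H_A_ge0 : 0 <= H_A P.
Proof.
apply: sup_ge0 => _ [z _ <-]; apply: sup_ge0 => _ [v _ <-]; exact: spnorm_ge0.
Qed.

Lemma H_B_ge0 : 0 <= H_B P.
Proof.
apply: sup_ge0 => _ [z _ <-]; apply: sup_ge0 => _ [v _ <-]; exact: enorm_ge0.
Qed.

Let enormZ_le k a (x : 'cV[R]_k) : enorm (a *: x) <= `|a| * enorm x.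
Proof. by rewrite enormZ. Qed.

Section AtPoint.
Variables (t : R) (w : cpath T d).
Hypotheses (tT : 0 <= t <= T) (Ow : Omt P w).

Lemma duA_le u (v : 'cV[R]_m) : U P u ->
  spnorm (\sum_i v i 0 *: duA P t w u i) <= G_A P * enorm v.
Proof.
move=> Uu; apply: le_trans (opnorm1_le (@spnormD _ _ _) (@spnormZ_le _ _ _) _ _) _.
rewrite ler_wpM2r ?enorm_ge0 //; apply: ub_le_sup; first exact: GA_finite.
by exists (t, w, u) => //; exact: domain_in.
Qed.

Lemma duB_le u (v : 'cV[R]_m) : U P u ->
  enorm (\sum_i v i 0 *: duB P t w u i) <= G_B P * enorm v.
Proof.
move=> Uu; apply: le_trans (opnorm1_le (@enormD _ _) (@enormZ_le _) _ _) _.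
rewrite ler_wpM2r ?enorm_ge0 //; apply: ub_le_sup; first exact: GB_finite.
by exists (t, w, u) => //; exact: domain_in.
Qed.

Lemma duuA_le u (v : 'cV[R]_m) : U P u ->
  spnorm (\sum_i \sum_j (v i 0 * v j 0) *: duuA P t w u i j) <= H_A P * enorm v ^+ 2.
Proof.
move=> Uu; apply: le_trans (opnorm2_le (@spnormD _ _ _) (@spnormZ_le _ _ _) _ _) _.
rewrite ler_wpM2r ?sqr_ge0 //; apply: ub_le_sup; first exact: HA_finite.
by exists (t, w, u) => //; exact: domain_in.
Qed.

Lemma duuB_le u (v : 'cV[R]_m) : U P u ->
  enorm (\sum_i \sum_j (v i 0 * v j 0) *: duuB P t w u i j) <= H_B P * enorm v ^+ 2.
Proof.
move=> Uu; apply: le_trans (opnorm2_le (@enormD _ _) (@enormZ_le _) _ _) _.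
rewrite ler_wpM2r ?sqr_ge0 //; apply: ub_le_sup; first exact: HB_finite.
by exists (t, w, u) => //; exact: domain_in.
Qed.

(** The mean value inequality is available for the Euclidean norm; used on [A y] for each fixed [y],
    it bounds the spectral norm. *)
Lemma A_lipschitz u v : U P u -> U P v ->
  spnorm (A P t w v - A P t w u) <= G_A P * enorm (v - u).
Proof.
move=> Uu Uv; have tI : (`[0, T] : set R)%classic t by rewrite /= in_itv.
have [hA _ _] := A_C2 HP tI Ow.
apply: spnorm_le => [|y]; first by rewrite mulr_ge0 ?G_A_ge0 ?enorm_ge0.
rewrite mulmxBl.
apply: (partials_lipschitz (U_convex HP) Uu Uv (f := fun x => A P t w x *m y)
  (df := fun x i => duA P t w x i *m y)).
- apply: (has_partials_linear (L := fun M : 'M[R]_n => M *m y)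
    (K := (n * n)%:R * enorm y)) hA.
  + by move=> a x z; rewrite mulmxDl scalemxAl.
  + move=> M; apply: le_trans (norm_le_enorm _) _.
    by rewrite -mulrA [enorm y * _]mulrC mulrA; exact: enorm_mulmx_norm.
- move=> x Ux; under eq_bigr do rewrite scalemxAl.
  rewrite -mulmx_suml; apply: le_trans (enorm_mulmx _ _) _.
  by rewrite ler_wpM2r ?enorm_ge0 // duA_le.
Qed.

Lemma B_lipschitz u v : U P u -> U P v ->
  enorm (B P t w v - B P t w u) <= G_B P * enorm (v - u).
Proof.
move=> Uu Uv; have tI : (`[0, T] : set R)%classic t by rewrite /= in_itv.
have [hB _ _] := B_C2 HP tI Ow.
by apply: (partials_lipschitz (U_convex HP) Uu Uv hB) => x Ux; exact: duB_le.
Qed.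

(** Along the segment the second derivative of the pairing is at most
    [|q| (H_A |y| + H_B) |v - u|^2]; a function with second derivative at most [c] lies above its
    chord up to [c s (1 - s) / 2]. *)
Lemma pairing_gap u v (q y : 'cV[R]_n) s : U P u -> U P v -> 0 < s < 1 ->
  (1 - s) * dot q (A P t w u *m y + B P t w u) +
  s * dot q (A P t w v *m y + B P t w v) -
  enorm q * (H_A P * enorm y + H_B P) * enorm (v - u) ^+ 2 / 2 * (s * (1 - s)) <=
  dot q (A P t w (u + s *: (v - u)) *m y + B P t w (u + s *: (v - u))).
Proof.
move=> Uu Uv s01; have tI : (`[0, T] : set R)%classic t by rewrite /= in_itv.
have [hA hhA _] := A_C2 HP tI Ow; have [hB hhB _] := B_C2 HP tI Ow.
pose LA (M : 'M[R]_n) : R := dot q (M *m y).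
have LA_lin a x z : LA (a *: x + z) = a *: LA x + LA z.
  by rewrite /LA mulmxDl -scalemxAl dotDr dotZr.
have LA_bd M : `|LA M| <= enorm q * ((n * n)%:R * enorm y) * `|M|.
  apply: le_trans (dot_norm_le _ _) _; rewrite -mulrA ler_wpM2l ?enorm_ge0 //.
  by rewrite -mulrA [enorm y * _]mulrC mulrA; exact: enorm_mulmx_norm.
have LB_lin a (x z : 'cV[R]_n) : dot q (a *: x + z) = a *: dot q x + dot q z.
  by rewrite dotDr dotZr.
have LB_bd (x : 'cV[R]_n) : `|dot q x| <= enorm q * n%:R * `|x|.
  apply: le_trans (dot_norm_le _ _) _; rewrite -mulrA ler_wpM2l ?enorm_ge0 //.
  exact: enorm_le_norm.
rewrite ![dot q (_ + B P _ _ _)]dotDr.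
apply: (second_partials_gap (U_convex HP) Uu Uv
  (f := fun x => LA (A P t w x) + dot q (B P t w x))
  (df := fun x i => LA (duA P t w x i) + dot q (duB P t w x i))
  (ddf := fun x i j => LA (duuA P t w x i j) + dot q (duuB P t w x i j))) => //.
- apply: has_partials_onD; [exact: has_partials_linear hA|exact: has_partials_linear hB].
- move=> j; apply: has_partials_onD.
    exact: (has_partials_linear LA_lin LA_bd (hhA j)).
  exact: (has_partials_linear LB_lin LB_bd (hhB j)).
move=> x Ux; rewrite exchange_big /=.
pose h := v - u.
have -> : \sum_i \sum_j h j 0 * (h i 0 *
      (LA (duuA P t w x i j) + dot q (duuB P t w x i j))) =
    LA (\sum_i \sum_j (h i 0 * h j 0) *: duuA P t w x i j) +
    dot q (\sum_i \sum_j (h i 0 * h j 0) *: duuB P t w x i j).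
  have LA0 : LA 0 = 0 by rewrite /LA mul0mx dot0r.
  have LA_sum (F : 'I_m -> 'M[R]_n) : LA (\sum_i F i) = \sum_i LA (F i).
    by elim/big_rec2 : _ => // i a b _ <-; rewrite /LA mulmxDl dotDr.
  have LB_sum (F : 'I_m -> 'cV[R]_n) : dot q (\sum_i F i) = \sum_i dot q (F i).
    by elim/big_rec2 : _ => [|i a b _ <-]; rewrite ?dot0r ?dotDr.
  rewrite LA_sum LB_sum -big_split; apply: eq_bigr => i _ /=.
  rewrite LA_sum LB_sum -big_split; apply: eq_bigr => j _ /=.
  by rewrite /LA -scalemxAl !dotZr; ring.
apply: le_trans (lerD (ler_norm _) (ler_norm _)) _.
apply: le_trans (lerD (dot_mulmx_le _ _ _) (dot_norm_le _ _)) _.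
rewrite -mulrDr -mulrA ler_wpM2l ?enorm_ge0 // mulrDl lerD ?duuB_le //.
by rewrite mulrAC ler_wpM2r ?enorm_ge0 // duuA_le.
Qed.

End AtPoint.

End ProblemEstimates.

(** * States and adjoints *)

Section LinearODEEstimates.
Context {R : realType} (T : R) {n : nat}.
Hypothesis T0 : 0 <= T.

Lemma linear_ode_bound (x : R -> 'cV[R]_n) (a : R -> 'M[R]_n) (b : R -> 'cV[R]_n)
    (L c : R) : 0 <= L -> 0 <= c ->
  has_derivative_on T x (fun t => a t *m x t + b t) ->
  (forall t v, 0 <= t <= T -> enorm (a t *m v) <= L * enorm v) ->
  (forall t, 0 <= t <= T -> enorm (b t) <= c) ->
  forall t, 0 <= t <= T -> enorm (x t) <= (enorm (x 0) + T * c) * expR (T * L).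
Proof.
move=> L0 c0 dx aL bc t tT; have /andP[t0 tleT] := tT.
apply: le_trans.
  apply: (has_derivative_on_gronwall L0 dx (has_derivative_on_linear T c)
    (fun s _ => c0) _ tT) => s sT.
  by apply: le_trans (enormD _ _) _; rewrite lerD ?aL ?bc.
rewrite /= mulr0 subr0; apply: ler_pM; rewrite ?expR_ge0 ?addr_ge0 ?enorm_ge0 ?mulr_ge0 //.
  by rewrite lerD2l mulrC ler_wpM2r.
by rewrite ler_expR mulrC ler_wpM2r.
Qed.

(** The difference solves a linear equation with coefficient [a] and source [(a - a') y + (b - b')],
    to which Gronwall applies. The source is bounded through a primitive [G], so that it may be an
    integral of the distance of the controls as well as a constant. *)
Lemma linear_ode_diff (x y : R -> 'cV[R]_n) (a a' : R -> 'M[R]_n)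
    (b b' : R -> 'cV[R]_n) (L : R) (G g : R -> R) : 0 <= L ->
  has_derivative_on T x (fun t => a t *m x t + b t) ->
  has_derivative_on T y (fun t => a' t *m y t + b' t) ->
  has_derivative_on T G g -> G 0 = 0 -> (forall t, 0 <= t <= T -> 0 <= g t) ->
  (forall t v, 0 <= t <= T -> enorm (a t *m v) <= L * enorm v) ->
  (forall t, 0 <= t <= T -> enorm ((a t - a' t) *m y t + (b t - b' t)) <= g t) ->
  forall t, 0 <= t <= T ->
    enorm (x t - y t) <= (enorm (x 0 - y 0) + G t) * expR (T * L).
Proof.
move=> L0 dx dy dG G0 g0 aL hg t tT; have /andP[t0 tleT] := tT.
have Gt : 0 <= G t.
  by rewrite -G0; exact: (has_derivative_on_nondecreasing dG).
apply: le_trans.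
  apply: (has_derivative_on_gronwall L0 (has_derivative_onB dx dy) dG g0 _ tT) => s sT.
  have -> : a s *m x s + b s - (a' s *m y s + b' s) =
      a s *m (x s - y s) + ((a s - a' s) *m y s + (b s - b' s)).
    rewrite mulmxBr mulmxBl opprD addrACA [RHS]addrA; congr (_ + _).
    by rewrite addrA subrK.
  by apply: le_trans (enormD _ _) _; rewrite lerD ?aL ?hg.
rewrite G0 subr0 ler_wpM2l ?addr_ge0 ?enorm_ge0 //.
by rewrite ler_expR mulrC ler_wpM2r.
Qed.

End LinearODEEstimates.

Section StatesAndAdjoints.
Context {R : realType} {d d' m n : nat} (P : problem R d d' m n).
Hypothesis HP : standing_assumptions P.

Local Notation T := (hT P).
Local Notation trajectory := (R -> cpath T d -> 'cV[R]_n).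

Let T0 : 0 <= T := T_ge0 HP.

Definition continuous_control (u : R -> 'cV[R]_m) : Prop :=
  {within `[0, T], continuous u} /\ forall t, 0 <= t <= T -> U P (u t).

Let segP t : (`[0, T] : set R)%classic t -> 0 <= t <= T.
Proof. by rewrite /= in_itv. Qed.

Let inSeg t : 0 <= t <= T -> (`[0, T] : set R)%classic t.
Proof. by rewrite /= in_itv. Qed.

Lemma Om_in w : Om P w -> Omt P w.
Proof. exact: Om_Omt. Qed.

Lemma A_le t w u : 0 <= t <= T -> Om P w -> U P u -> spnorm (A P t w u) <= M_A P.
Proof.
by move=> tT Ow Uu; apply: A_bound => //; apply: domain_in => //; exact: Om_in.
Qed.

Lemma B_le t w u : 0 <= t <= T -> Om P w -> U P u -> enorm (B P t w u) <= M_B P.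
Proof.
by move=> tT Ow Uu; apply: B_bound => //; apply: domain_in => //; exact: Om_in.
Qed.

Lemma A_mul_le t w u v : 0 <= t <= T -> Om P w -> U P u ->
  enorm (A P t w u *m v) <= M_A P * enorm v.
Proof.
move=> tT Ow Uu; apply: le_trans (enorm_mulmx _ _) _.
by rewrite ler_wpM2r ?enorm_ge0 ?A_le.
Qed.

Lemma At_mul_le t w u v : 0 <= t <= T -> Om P w -> U P u ->
  enorm ((A P t w u)^T *m v) <= M_A P * enorm v.
Proof.
move=> tT Ow Uu; apply: le_trans (enorm_trmx_mul _ _) _.
by rewrite ler_wpM2r ?enorm_ge0 ?A_le.
Qed.

(** [Omt] is only open and bounded, so compactness comes from restricting the parameters to [Om]. *)
Lemma uniform_on_domain (W : normedModType R) (f : R -> cpath T d -> 'cV[R]_m -> W) :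
  {within domain (P := P), continuous (fun z => f z.1.1 z.1.2 z.2)} ->
  forall e : R, 0 < e -> exists2 r : R, 0 < r & forall t s w w' u v,
    0 <= t <= T -> 0 <= s <= T -> Om P w -> Om P w' -> U P u -> U P v ->
    `|t - s| < r -> `|w - w'| < r -> `|u - v| < r -> `|f t w u - f s w' v| < e.
Proof.
move=> cf e e0.
pose D : set (R * cpath T d * 'cV[R]_m) := (`[0, T] `*` Om P) `*` U P.
have cD : compact D.
  apply: compact_setX (U_compact HP); apply: compact_setX (Om_compact HP).
  exact: segment_compact.
have cfD : {within D, continuous (fun z : R * cpath T d * 'cV[R]_m => f z.1.1 z.1.2 z.2)}.
  apply: continuous_subspaceW cf => -[[t w] u] [[tT Ow] Uu].
  by split => //; split => //; exact: Om_in.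
have [r r0 hr] := compact_uniform_continuous cD cfD e0.
exists r => // t s w w' u v tT sT Ow Ow' Uu Uv ts ww uv.
apply: (hr (t, w, u) (s, w', v)); [by do 2?split => //; exact: inSeg..|].
by rewrite !prod_normE /= !gt_max ts ww uv.
Qed.

Lemma A_uniform (e : R) : 0 < e -> exists2 r : R, 0 < r & forall t s w w' u,
  0 <= t <= T -> 0 <= s <= T -> Om P w -> Om P w' -> U P u ->
  `|t - s| < r -> `|w - w'| < r -> spnorm (A P t w u - A P s w' u) <= e.
Proof.
move=> e0; have k0 : 0 < (n * n)%:R + 1 :> R by rewrite ltr_wpDl ?ler0n.
have [r r0 hr] := uniform_on_domain (A_continuous HP) (divr_gt0 e0 k0).
exists r => // t s w w' u tT sT Ow Ow' Uu ts ww; apply: le_trans (spnorm_le_norm _) _.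
have h : `|u - u| < r by rewrite subrr normr0.
have := ltW (hr t s w w' u u tT sT Ow Ow' Uu Uu ts ww h).
rewrite ler_pdivlMr // mulrC; apply: le_trans.
by rewrite ler_wpM2r // lerDl.
Qed.

Lemma B_uniform (e : R) : 0 < e -> exists2 r : R, 0 < r & forall t s w w' u,
  0 <= t <= T -> 0 <= s <= T -> Om P w -> Om P w' -> U P u ->
  `|t - s| < r -> `|w - w'| < r -> enorm (B P t w u - B P s w' u) <= e.
Proof.
move=> e0; have k0 : 0 < n%:R + 1 :> R by rewrite ltr_wpDl ?ler0n.
have [r r0 hr] := uniform_on_domain (B_continuous HP) (divr_gt0 e0 k0).
exists r => // t s w w' u tT sT Ow Ow' Uu ts ww; apply: le_trans (enorm_le_norm _) _.
have h : `|u - u| < r by rewrite subrr normr0.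
have := ltW (hr t s w w' u u tT sT Ow Ow' Uu Uu ts ww h).
rewrite ler_pdivlMr // mulrC; apply: le_trans.
by rewrite ler_wpM2r // lerDl.
Qed.

Lemma path_continuous (W : normedModType R) (f : R -> cpath T d -> 'cV[R]_m -> W) u w :
  {within domain (P := P), continuous (fun z => f z.1.1 z.1.2 z.2)} ->
  continuous_control u -> Om P w -> {within `[0, T], continuous (fun t => f t w (u t))}.
Proof.
move=> cf [/within_continuousP cu uU] Ow; apply/within_continuousP => t It e e0.
have [r r0 hr] := uniform_on_domain cf e0; have [r' r'0 hr'] := cu t It r r0.
exists (Num.min r r') => [|s Is]; first by rewrite lt_min r0.
rewrite lt_min => /andP[tr tr'].
have [tT sT] := (segP It, segP Is).
by apply: hr => //; [exact: uU|exact: uU|rewrite subrr normr0|exact: hr'].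
Qed.

Lemma C1_on_continuous (V W : normedModType R) (D K : set V) (f : V -> W) :
  K `<=` D -> C1_on D f -> {within K, continuous f}.
Proof.
move=> KD [fd _]; apply: continuous_in_subspaceT => w /set_mem /KD /fd.
exact: differentiable_continuous.
Qed.

Lemma x0_continuous : {within Om P, continuous (x0 P)}.
Proof. exact: C1_on_continuous (@Om_in) (x0_C1 HP). Qed.

Lemma F_continuous : {within Om P, continuous (F P)}.
Proof. exact: C1_on_continuous (@Om_in) (F_C1 HP). Qed.

Lemma x0_le w : Om P w -> enorm (x0 P w) <= x0_norm P.
Proof.
move=> Ow; apply: ub_le_sup; last by exists w.
have := continuous_compact x0_continuous (Om_compact HP).
move=> /compact_bounded[M [_ h]]; exists (n%:R * (`|M| + 1)) => _ [w' Ow' <-].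
apply: le_trans (enorm_le_norm _) _; rewrite ler_wpM2l //.
by apply: h; [rewrite ltr_pwDr // ler_norm|exists w'].
Qed.

Lemma F_le t w : 0 <= t <= T -> Om P w -> enorm (F P w t) <= M_Om' P.
Proof.
move=> tT Ow; apply: le_trans (cpath_norm_ub _ tT) _.
by apply: Om'_bound => //; apply: F_Om' => //; exact: Om_in.
Qed.

Lemma F_dist t w w' : 0 <= t <= T -> enorm (F P w t - F P w' t) <= `|F P w - F P w'|.
Proof. exact: (cpath_norm_ub (F P w - F P w')). Qed.

Lemma x0_norm_ge0 : 0 <= x0_norm P.
Proof. by apply: sup_ge0 => _ [w _ <-]; exact: enorm_ge0. Qed.

Lemma MA_ge0 : 0 <= M_A P. Proof. exact: ltW (MA_gt0 HP). Qed.
Lemma MB_ge0 : 0 <= M_B P. Proof. exact: ltW (MB_gt0 HP). Qed.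
Lemma alpha_ge0 : 0 <= alpha P. Proof. exact: ltW (alpha_gt0 HP). Qed.
Lemma MOm'_ge0 : 0 <= M_Om' P. Proof. exact: ltW (MOm'_gt0 HP). Qed.

Lemma M_X_ge0 : 0 <= M_X P.
Proof.
by rewrite mulr_ge0 ?expR_ge0 // addr_ge0 ?x0_norm_ge0 // mulr_ge0 // MB_ge0.
Qed.

Lemma tracking_ge0 : 0 <= spnorm (C P) * M_X P + M_Om' P.
Proof. by rewrite addr_ge0 ?MOm'_ge0 // mulr_ge0 ?spnorm_ge0 ?M_X_ge0. Qed.

Lemma M_P_ge0 : 0 <= M_P P.
Proof.
by rewrite !mulr_ge0 ?expR_ge0 ?spnorm_ge0 ?alpha_ge0 ?tracking_ge0.
Qed.

Lemma C_X_ge0 : 0 <= C_X P.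
Proof.
rewrite mulr_ge0 ?expR_ge0 // addr_ge0 ?(G_B_ge0 P) //.
by rewrite mulr_ge0 ?(G_A_ge0 P) ?M_X_ge0.
Qed.

Lemma state_derivative u x w : continuous_control u -> is_state P u x -> Om P w ->
  has_derivative_on T (x^~ w) (fun t => A P t w (u t) *m x t w + B P t w (u t)).
Proof.
move=> cu sx Ow; have [xac _ dx] := sx w Ow.
apply: caratheodory_classical => //.
  move=> t; apply: cvgD.
    apply: cvg_mulmx; first exact: (path_continuous (A_continuous HP) cu Ow).
    exact: (abs_continuous_within xac).
  exact: (path_continuous (B_continuous HP) cu Ow).
Qed.

Lemma state_init u x w : is_state P u x -> Om P w -> x 0 w = x0 P w.
Proof. by move=> sx /sx[]. Qed.

Lemma state_exists u : continuous_control u -> exists x, is_state P u x.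
Proof.
move=> cu.
have /choice[y hy] : forall w, exists y : R -> 'cV[R]_n, Om P w -> y 0 = x0 P w /\
    forall t, 0 <= t <= T -> is_derive t 1 y (A P t w (u t) *m y t + B P t w (u t)).
  move=> w; have [Ow|nOw] := pselect (Om P w); last by exists (fun=> 0).
  have [y y0 dy] := linear_ode_exists (x0 P w) T0
    (path_continuous (A_continuous HP) cu Ow) (path_continuous (B_continuous HP) cu Ow).
  by exists y.
exists (fun t w => y w t) => w Ow; have [y0 dy] := hy w Ow; split => //.
  apply: (classical_abs_continuous _ dy) => t; apply: cvgD.
    apply: cvg_mulmx; first exact: (path_continuous (A_continuous HP) cu Ow).
    by apply: (@has_derivative_on_continuous _ T _ (y w)); exists (y w) => //; exact: dy.
  exact: (path_continuous (B_continuous HP) cu Ow).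
by apply: aeW => t It; apply: dy; exact: segP.
Qed.

Let adjoint_source (x : trajectory) w t : 'cV[R]_n :=
  (2 * alpha P) *: ((C P)^T *m (C P *m x t w - F P w t)).

Let adjoint_source_continuous x w : {within `[0, T], continuous (x^~ w)} ->
  {within `[0, T], continuous (adjoint_source x w)}.
Proof.
move=> cx t; apply: cvgZr; apply: cvg_mulmx; first exact: cvg_cst.
apply: cvgB; first by apply: cvg_mulmx; [exact: cvg_cst|exact: cx].
exact: (cpathP (F P w)).1.
Qed.

Let trmx_path_continuous u w : continuous_control u -> Om P w ->
  {within `[0, T], continuous (fun t => (A P t w (u t))^T)}.
Proof.
move=> cu Ow t; apply: cvg_mx => i j; rewrite mxE; under eq_cvg do rewrite mxE.
have h := path_continuous (A_continuous HP) cu Ow.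
exact: (@cvg_comp _ _ _ (fun t => A P t w (u t)) (fun M => M j i) _ _ _ (h t)
  (@coord_continuous _ _ _ _ _ _)).
Qed.

Lemma adjoint_derivative u x p w : continuous_control u -> is_state P u x ->
  is_adjoint P u x p -> Om P w ->
  has_derivative_on T (p^~ w) (fun t => - ((A P t w (u t))^T *m p t w) +
    (2 * alpha P) *: ((C P)^T *m (C P *m x t w - F P w t))).
Proof.
move=> cu sx ap Ow; have [pac _ dp] := ap w Ow.
have cx := has_derivative_on_continuous (state_derivative cu sx Ow).
apply: caratheodory_classical => //.
  move=> t; apply: cvgD; last exact: adjoint_source_continuous.
  apply: cvgN; apply: cvg_mulmx; first exact: trmx_path_continuous.
  exact: (abs_continuous_within pac).
Qed.

Lemma adjoint_final u x p w : is_adjoint P u x p -> Om P w -> p T w = 0.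
Proof. by move=> ap /ap[]. Qed.

(** In reversed time the adjoint starts from 0, so every forward Gronwall estimate applies to it. *)
Lemma adjoint_reversed u x p w : continuous_control u -> is_state P u x ->
  is_adjoint P u x p -> Om P w ->
  has_derivative_on T (fun t => p (T - t) w)
    (fun t => (A P (T - t) w (u (T - t)))^T *m p (T - t) w - adjoint_source x w (T - t)).
Proof.
move=> cu sx ap Ow.
have := has_derivative_on_rev (adjoint_derivative cu sx ap Ow).
by apply: has_derivative_on_ext => t _; rewrite opprD opprK.
Qed.

Let rev_in t : 0 <= t <= T -> 0 <= T - t <= T.
Proof. by move=> /andP[? ?]; apply/andP; split; lra. Qed.

Lemma continuous_reverse (W : normedModType R) (f : R -> W) :
  {within `[0, T], continuous f} -> {within `[0, T], continuous (fun t => f (T - t))}.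
Proof.
move=> /within_continuousP cf; apply/within_continuousP => t /segP tT e e0.
have [r r0 h] := cf (T - t) (inSeg (rev_in tT)) e e0; exists r => // s /segP sT ts.
apply: h; first exact: inSeg (rev_in sT).
have -> : T - t - (T - s) = s - t by ring.
by rewrite distrC.
Qed.

Lemma adjoint_exists u x : continuous_control u -> is_state P u x ->
  exists p, is_adjoint P u x p.
Proof.
move=> cu sx.
have /choice[p hp] : forall w, exists p : R -> 'cV[R]_n, Om P w -> p T = 0 /\
    forall t, 0 <= t <= T -> is_derive t 1 p
      (- ((A P t w (u t))^T *m p t) + adjoint_source x w t).
  move=> w; have [Ow|nOw] := pselect (Om P w); last by exists (fun=> 0).
  have cx := has_derivative_on_continuous (state_derivative cu sx Ow).
  have cs : {within `[0, T], continuous (fun t => - adjoint_source x w (T - t))}.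
    by move=> t; apply: cvgN; apply: continuous_reverse; exact: adjoint_source_continuous.
  (* [q] solves the reversed equation from the value 0; the adjoint is [q (T - t)], written
     [-1 * t + T] to fit [is_derive_comp_affine]. *)
  have [q q0 dq] := linear_ode_exists 0 T0
    (continuous_reverse (trmx_path_continuous cu Ow)) cs.
  exists (fun t => q (-1 * t + T)) => _; split=> [|t tT]; first by rewrite mulN1r addNr.
  have rt : -1 * t + T = T - t by rewrite mulN1r addrC.
  have E : - ((A P t w (u t))^T *m q (-1 * t + T)) + adjoint_source x w t =
      -1 *: ((A P (T - (-1 * t + T)) w (u (T - (-1 * t + T))))^T *m q (-1 * t + T)
         - adjoint_source x w (T - (-1 * t + T))).
    have TT : T - (T - t) = t by ring.
    by rewrite rt TT scaleN1r opprD opprK.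
  rewrite E; apply: is_derive_comp_affine; apply: dq; rewrite rt; exact: rev_in.
exists (fun t w => p w t) => w Ow; have [p0 dp] := hp w Ow; split => //.
  apply: (classical_abs_continuous _ dp) => t; apply: cvgD.
    apply: cvgN; apply: cvg_mulmx; first exact: trmx_path_continuous.
    by apply: (@has_derivative_on_continuous _ T _ (p w)); exists (p w) => //; exact: dp.
  apply: adjoint_source_continuous.
  exact: has_derivative_on_continuous (state_derivative cu sx Ow).
by apply: aeW => t It; apply: dp; exact: segP.
Qed.

(** The origin of [M_X]: Gronwall with rate [M_A], source [M_B] and initial value at most
    [x0_norm]. *)
Lemma state_le u x t w : continuous_control u -> is_state P u x ->
  0 <= t <= T -> Om P w -> enorm (x t w) <= M_X P.
Proof.
move=> cu sx tT Ow; have uU := cu.2.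
apply: le_trans (linear_ode_bound MA_ge0 MB_ge0 (state_derivative cu sx Ow) _ _ tT) _.
- by move=> s v sT; apply: A_mul_le => //; exact: uU.
- by move=> s sT; apply: B_le => //; exact: uU.
rewrite ler_wpM2r ?expR_ge0 // lerD2r (state_init sx Ow).
exact: x0_le.
Qed.

Lemma tracking_le u x t w : continuous_control u -> is_state P u x ->
  0 <= t <= T -> Om P w ->
  enorm (C P *m x t w - F P w t) <= spnorm (C P) * M_X P + M_Om' P.
Proof.
move=> cu sx tT Ow; apply: le_trans (enormB _ _) _; apply: lerD; last exact: F_le.
apply: le_trans (enorm_mulmx _ _) _.
by rewrite ler_wpM2l ?spnorm_ge0 // (state_le cu sx).
Qed.

Let adjoint_source_le u x t w : continuous_control u -> is_state P u x ->
  0 <= t <= T -> Om P w -> enorm (adjoint_source x w t) <=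
    2 * alpha P * spnorm (C P) * (spnorm (C P) * M_X P + M_Om' P).
Proof.
move=> cu sx tT Ow; have a2 : 0 <= 2 * alpha P by rewrite mulr_ge0 ?alpha_ge0.
rewrite enormZ ger0_norm // -mulrA ler_wpM2l //.
apply: le_trans (enorm_trmx_mul _ _) _.
by rewrite ler_wpM2l ?spnorm_ge0 // (tracking_le cu sx).
Qed.

(** The origin of [M_P]: in reversed time the initial value is 0 and the source is at most
    [2 alpha |C| (|C| M_X + M_Om')]. *)
Lemma adjoint_le u x p t w : continuous_control u -> is_state P u x ->
  is_adjoint P u x p -> 0 <= t <= T -> Om P w -> enorm (p t w) <= M_P P.
Proof.
move=> cu sx ap tT Ow; have uU := cu.2.
have c0 : 0 <= 2 * alpha P * spnorm (C P) * (spnorm (C P) * M_X P + M_Om' P).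
  by rewrite !mulr_ge0 ?spnorm_ge0 ?alpha_ge0 ?tracking_ge0.
have := linear_ode_bound MA_ge0 c0 (adjoint_reversed cu sx ap Ow) _ _ (rev_in tT).
have -> : T - (T - t) = t by ring.
rewrite subr0 (adjoint_final ap Ow) enorm0 add0r => H.
apply: le_trans (H _ _) _.
- by move=> s v sT; apply: At_mul_le => //; [exact: rev_in|exact/uU/rev_in].
- by move=> s sT; rewrite enormN; apply: (adjoint_source_le cu sx) => //; exact: rev_in.
by rewrite le_eqVlt /M_P; apply/orP; left; apply/eqP; ring.
Qed.

Definition state_speed : R := M_A P * M_X P + M_B P.

Definition adjoint_speed : R := M_A P * M_P P +
  2 * alpha P * spnorm (C P) * (spnorm (C P) * M_X P + M_Om' P).

Lemma state_speed_ge0 : 0 <= state_speed.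
Proof. by rewrite addr_ge0 ?MB_ge0 // mulr_ge0 ?MA_ge0 ?M_X_ge0. Qed.

Lemma adjoint_speed_ge0 : 0 <= adjoint_speed.
Proof.
rewrite addr_ge0 //; first by rewrite mulr_ge0 ?MA_ge0 ?M_P_ge0.
by rewrite !mulr_ge0 ?spnorm_ge0 ?alpha_ge0 ?tracking_ge0.
Qed.

Lemma state_lipschitz u x s t w : continuous_control u -> is_state P u x ->
  0 <= s <= T -> 0 <= t <= T -> Om P w ->
  enorm (x t w - x s w) <= state_speed * `|t - s|.
Proof.
move=> cu sx sT tT Ow; have uU := cu.2.
apply: (has_derivative_on_lipschitz (state_derivative cu sx Ow)) => // r rT.
apply: le_trans (enormD _ _) _; apply: lerD; last by apply: B_le => //; exact: uU.
apply: le_trans (A_mul_le _ rT Ow (uU _ rT)) _.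
by rewrite ler_wpM2l ?MA_ge0 // (state_le cu sx).
Qed.

Lemma adjoint_lipschitz u x p s t w : continuous_control u -> is_state P u x ->
  is_adjoint P u x p -> 0 <= s <= T -> 0 <= t <= T -> Om P w ->
  enorm (p t w - p s w) <= adjoint_speed * `|t - s|.
Proof.
move=> cu sx ap sT tT Ow; have uU := cu.2.
apply: (has_derivative_on_lipschitz (adjoint_derivative cu sx ap Ow)) => // r rT.
apply: le_trans (enormD _ _) _; rewrite enormN; apply: lerD.
  apply: le_trans (At_mul_le _ rT Ow (uU _ rT)) _.
  by rewrite ler_wpM2l ?MA_ge0 // (adjoint_le cu sx ap).
exact: (adjoint_source_le cu sx).
Qed.

Let control_gap u u' x t w : continuous_control u -> continuous_control u' ->
  is_state P u x -> 0 <= t <= T -> Om P w ->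
  enorm ((A P t w (u' t) - A P t w (u t)) *m x t w + (B P t w (u' t) - B P t w (u t)))
    <= (G_A P * M_X P + G_B P) * enorm (u' t - u t).
Proof.
move=> cu cu' sx tT Ow; have [uU u'U] := (cu.2 _ tT, cu'.2 _ tT).
apply: le_trans (enormD _ _) _; rewrite mulrDl; apply: lerD; last first.
  by apply: B_lipschitz => //; exact: Om_in.
apply: le_trans (enorm_mulmx _ _) _; rewrite mulrAC; apply: ler_pM.
- exact: spnorm_ge0.
- exact: enorm_ge0.
- by apply: A_lipschitz => //; exact: Om_in.
- exact: (state_le cu sx).
Qed.

(** Changing the control moves the right-hand side by at most [(G_A M_X + G_B) |u' - u|], and
    Gronwall multiplies this by [expR (T * M_A)]: hence [C_X]. The running integral [y t] is kept,
    since the decrease of the cost integrates [y y']. *)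
Lemma state_stability u u' x x' y t w : continuous_control u -> continuous_control u' ->
  is_state P u x -> is_state P u' x' ->
  has_derivative_on T y (fun t => enorm (u' t - u t)) -> y 0 = 0 ->
  0 <= t <= T -> Om P w -> enorm (x' t w - x t w) <= C_X P * y t.
Proof.
move=> cu cu' sx sx' dy y0 tT Ow; set g := G_A P * M_X P + G_B P.
have g0 : 0 <= g by rewrite addr_ge0 ?(G_B_ge0 P) // mulr_ge0 ?(G_A_ge0 P) ?M_X_ge0.
have dG := has_derivative_onZ g dy.
have := linear_ode_diff MA_ge0 (state_derivative cu' sx' Ow) (state_derivative cu sx Ow) dG.
rewrite y0 mulr0 (state_init sx Ow) (state_init sx' Ow) subrr enorm0 => H.
have -> : C_X P * y t = (0 + g * y t) * expR (T * M_A P).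
  by rewrite add0r /C_X [T * _]mulrC mulrAC.
apply: H => // s sT; first by rewrite mulr_ge0 ?enorm_ge0.
  by move=> v; apply: A_mul_le => //; exact: cu'.2.
exact: control_gap.
Qed.

(** The same estimate for a uniform distance of the controls, as needed for uniform convergence of
    the states. *)
Lemma state_stability_sup u u' x x' e t w :
  continuous_control u -> continuous_control u' ->
  is_state P u x -> is_state P u' x' -> 0 <= e ->
  (forall s, 0 <= s <= T -> enorm (u' s - u s) <= e) ->
  0 <= t <= T -> Om P w -> enorm (x' t w - x t w) <= C_X P * T * e.
Proof.
move=> cu cu' sx sx' e0 uu tT Ow; set g := G_A P * M_X P + G_B P.
have g0 : 0 <= g by rewrite addr_ge0 ?(G_B_ge0 P) // mulr_ge0 ?(G_A_ge0 P) ?M_X_ge0.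
have dG := has_derivative_on_linear T (g * e).
have := linear_ode_diff MA_ge0 (state_derivative cu' sx' Ow) (state_derivative cu sx Ow) dG.
rewrite mulr0 (state_init sx Ow) (state_init sx' Ow) subrr enorm0 => H.
apply: le_trans (H _ _ _ _ _ tT) _ => //.
- by move=> s sT; rewrite mulr_ge0.
- by move=> s v sT; apply: A_mul_le => //; exact: cu'.2.
- move=> s sT; apply: le_trans (control_gap cu cu' sx sT Ow) _.
  by rewrite ler_wpM2l // uu.
rewrite /C_X -/g [T * M_A P]mulrC.
have -> : g * expR (M_A P * T) * T * e = g * e * T * expR (M_A P * T) by ring.
by rewrite add0r ler_wpM2r ?expR_ge0 // ler_wpM2l ?mulr_ge0 //; case/andP: tT.
Qed.

(** The Gronwall constant of the reversed adjoint, per unit of uniform distance of the controls: the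
    coefficient moves by [G_A] against [|p| <= M_P], and the state moves by [C_X T], which enters
    the source through [2 alpha |C|^2]. *)
Definition adjoint_stability_constant : R :=
  T * (G_A P * M_P P + 2 * alpha P * spnorm (C P) ^+ 2 * (C_X P * T)) * expR (T * M_A P).

Let adjoint_source_gap_ge0 :
  0 <= G_A P * M_P P + 2 * alpha P * spnorm (C P) ^+ 2 * (C_X P * T).
Proof.
apply: addr_ge0; first by apply: mulr_ge0; [exact: (G_A_ge0 P)|exact: M_P_ge0].
apply: mulr_ge0; last by apply: mulr_ge0 => //; exact: C_X_ge0.
apply: mulr_ge0; last exact: sqr_ge0.
by apply: mulr_ge0 => //; exact: alpha_ge0.
Qed.

(** Trajectory and parameter may both differ, so one formula serves two controls at one [w], where
    [v' = 0], and one control at two parameters. *)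
Let source_diff x x' w w' t v v' : x t w - x' t w' = v -> F P w t - F P w' t = v' ->
  - adjoint_source x w t - - adjoint_source x' w' t =
  - ((2 * alpha P) *: ((C P)^T *m (C P *m v - v'))).
Proof.
move=> <- <-; rewrite /adjoint_source -opprD -scalerBr -mulmxBr; congr (- (_ *: (_ *m _))).
by rewrite mulmxBr !opprB addrACA [RHS]addrACA; congr (_ + _); rewrite addrC.
Qed.

Let source_diff_le v v' a b : enorm v <= a -> enorm v' <= b ->
  enorm (- ((2 * alpha P) *: ((C P)^T *m (C P *m v - v')))) <=
  2 * alpha P * spnorm (C P) * (spnorm (C P) * a + b).
Proof.
move=> va vb; have a2 : 0 <= 2 * alpha P by rewrite mulr_ge0 ?alpha_ge0.
rewrite enormN enormZ ger0_norm // -mulrA ler_wpM2l //.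
apply: le_trans (enorm_trmx_mul _ _) _; rewrite ler_wpM2l ?spnorm_ge0 //.
apply: le_trans (enormB _ _) _; apply: lerD => //.
by apply: le_trans (enorm_mulmx _ _) _; rewrite ler_wpM2l ?spnorm_ge0.
Qed.

Lemma adjoint_stability u u' x x' p p' e t w :
  continuous_control u -> continuous_control u' ->
  is_state P u x -> is_state P u' x' -> is_adjoint P u x p -> is_adjoint P u' x' p' ->
  0 <= e -> (forall s, 0 <= s <= T -> enorm (u' s - u s) <= e) ->
  0 <= t <= T -> Om P w -> enorm (p' t w - p t w) <= adjoint_stability_constant * e.
Proof.
move=> cu cu' sx sx' ap ap' e0 uu tT Ow.
set g := (G_A P * M_P P + 2 * alpha P * spnorm (C P) ^+ 2 * (C_X P * T)) * e.
have g0 : 0 <= g by apply: mulr_ge0 => //; exact: adjoint_source_gap_ge0.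
have := linear_ode_diff MA_ge0 (adjoint_reversed cu' sx' ap' Ow)
  (adjoint_reversed cu sx ap Ow) (has_derivative_on_linear T g).
rewrite mulr0 !subr0 (adjoint_final ap Ow) (adjoint_final ap' Ow) subrr enorm0 => H.
have := H _ _ _ _ (T - t) (rev_in tT).
have -> : T - (T - t) = t by ring.
move=> {}H; apply: le_trans (H _ _ _ _) _ => //.
- by move=> s v sT; apply: At_mul_le (rev_in sT) Ow _; exact: cu'.2 (rev_in sT).
- move=> s /rev_in; move: (T - s) => r rT.
  apply: le_trans (enormD _ _) _; rewrite /g mulrDl; apply: lerD.
    rewrite -linearB /=; apply: le_trans (enorm_trmx_mul _ _) _.
    rewrite mulrAC; apply: ler_pM; rewrite ?spnorm_ge0 ?enorm_ge0 //.
      apply: le_trans (A_lipschitz HP rT (Om_in Ow) (cu.2 _ rT) (cu'.2 _ rT)) _.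
      by rewrite ler_wpM2l ?(G_A_ge0 P) // uu.
    exact: (adjoint_le cu sx ap).
  rewrite (@source_diff x' x w w r _ 0 erefl); last by rewrite subrr.
  apply: le_trans (source_diff_le (state_stability_sup cu cu' sx sx' e0 uu rT Ow) (_ : _ <= 0)) _.
    by rewrite enorm0.
  by rewrite addr0 le_eqVlt; apply/orP; left; apply/eqP; ring.
have -> : adjoint_stability_constant * e = T * g * expR (T * M_A P).
  by rewrite /adjoint_stability_constant /g; ring.
rewrite add0r ler_wpM2r ?expR_ge0 // mulrC ler_wpM2r //.
by case/andP: (rev_in tT).
Qed.

(** At two parameters, one control gives two linear equations whose data are close by compactness of
    [Om]. Continuity in [w] is what makes expectations of states tractable. *)
Lemma state_uniform (e : R) : 0 < e -> exists2 r : R, 0 < r &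
  forall u x t w w', continuous_control u -> is_state P u x -> 0 <= t <= T ->
    Om P w -> Om P w' -> `|w - w'| < r -> enorm (x t w - x t w') <= e.
Proof.
(* If [x0], [A] and [B] each move by at most [c], the initial gap is [c] and the source gap
   [c (M_X + 1)], so Gronwall gives [c K]. *)
move=> e0; pose K := (1 + T * (M_X P + 1)) * expR (T * M_A P).
have K0 : 0 < K.
  by rewrite mulr_gt0 ?expR_gt0 // ltr_pwDl // mulr_ge0 // addr_ge0 ?M_X_ge0.
have c0 : 0 < e / K by rewrite divr_gt0.
set c := e / K in c0.
have [r1 r10 h1] := A_uniform c0; have [r2 r20 h2] := B_uniform c0.
have n1 : 0 < n%:R + 1 :> R by rewrite ltr_wpDl ?ler0n.
have [r3 r30 h3] := compact_uniform_continuous (Om_compact HP) x0_continuous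
  (divr_gt0 c0 n1).
exists (Num.min r1 (Num.min r2 r3)); first by rewrite !lt_min r10 r20.
move=> u x t w w' cu sx tT Ow Ow'; rewrite !lt_min => /and3P[w1 w2 w3].
have g0 : 0 <= c * (M_X P + 1) by rewrite mulr_ge0 ?(ltW c0) // addr_ge0 ?M_X_ge0.
have h : enorm (x0 P w - x0 P w') <= c.
  apply: le_trans (enorm_le_norm _) _.
  have := ltW (h3 w w' Ow Ow' w3); rewrite ler_pdivlMr // mulrC; apply: le_trans.
  by rewrite ler_wpM2r // lerDl.
have := linear_ode_diff MA_ge0 (state_derivative cu sx Ow) (state_derivative cu sx Ow')
  (has_derivative_on_linear T (c * (M_X P + 1))).
rewrite mulr0 (state_init sx Ow) (state_init sx Ow') => H.
apply: le_trans (H _ _ _ _ _ tT) _ => //.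
- by move=> s v sT; apply: A_mul_le => //; exact: cu.2.
- move=> s sT; have ss : `|s - s| < r1 by rewrite subrr normr0.
  have ss' : `|s - s| < r2 by rewrite subrr normr0.
  apply: le_trans (enormD _ _) _; rewrite mulrDr mulr1; apply: lerD; last first.
    by apply: h2 => //; exact: cu.2.
  apply: le_trans (enorm_mulmx _ _) _; apply: ler_pM; rewrite ?spnorm_ge0 ?enorm_ge0 //.
    by apply: h1 => //; exact: cu.2.
  exact: (state_le cu sx).
have -> : e = (c + c * (M_X P + 1) * T) * expR (T * M_A P).
  rewrite -[LHS](divfK (lt0r_neq0 K0)) -/c /K; ring.
rewrite ler_wpM2r ?expR_ge0 // lerD // ler_wpM2l //.
by case/andP: tT.
Qed.

Lemma adjoint_uniform (e : R) : 0 < e -> exists2 r : R, 0 < r &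
  forall u x p t w w', continuous_control u -> is_state P u x -> is_adjoint P u x p ->
    0 <= t <= T -> Om P w -> Om P w' -> `|w - w'| < r -> enorm (p t w - p t w') <= e.
Proof.
(* A shift of at most [c] in [A], in the state and in [F] changes the source of the reversed
   equation by at most [c k]. The 1 added in [K] keeps it positive. *)
move=> e0; pose k := M_P P + 2 * alpha P * spnorm (C P) * (spnorm (C P) + 1).
have k0 : 0 <= k.
  rewrite addr_ge0 ?M_P_ge0 // !mulr_ge0 ?alpha_ge0 ?spnorm_ge0 //.
  by rewrite addr_ge0 ?spnorm_ge0.
pose K := T * k * expR (T * M_A P) + 1.
have K0 : 0 < K by rewrite ltr_wpDl // !mulr_ge0 ?expR_ge0.
have c0 : 0 < e / K by rewrite divr_gt0.
set c := e / K in c0.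
have [r1 r10 h1] := A_uniform c0; have [r2 r20 h2] := state_uniform c0.
have [r3 r30 h3] := compact_uniform_continuous (Om_compact HP) F_continuous c0.
exists (Num.min r1 (Num.min r2 r3)); first by rewrite !lt_min r10 r20.
move=> u x p t w w' cu sx ap tT Ow Ow'; rewrite !lt_min => /and3P[w1 w2 w3].
have g0 : 0 <= c * k by rewrite mulr_ge0 // ltW.
have := linear_ode_diff MA_ge0 (adjoint_reversed cu sx ap Ow)
  (adjoint_reversed cu sx ap Ow') (has_derivative_on_linear T (c * k)).
rewrite mulr0 !subr0 (adjoint_final ap Ow) (adjoint_final ap Ow') subrr enorm0 => H.
have := H _ _ _ _ (T - t) (rev_in tT).
have -> : T - (T - t) = t by ring.
move=> {}H; apply: le_trans (H _ _ _ _) _ => //.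
- by move=> s v sT; apply: At_mul_le (rev_in sT) Ow _; exact: cu.2 (rev_in sT).
- move=> s /rev_in; move: (T - s) => r rT.
  have rr : `|r - r| < r1 by rewrite subrr normr0.
  apply: le_trans (enormD _ _) _; rewrite /k mulrDr; apply: lerD.
    rewrite -linearB /=; apply: le_trans (enorm_trmx_mul _ _) _.
    apply: ler_pM; rewrite ?spnorm_ge0 ?enorm_ge0 //.
      by apply: h1 => //; exact: cu.2.
    exact: (adjoint_le cu sx ap).
  rewrite (source_diff erefl erefl).
  apply: le_trans (source_diff_le (h2 _ _ _ _ _ cu sx rT Ow Ow' w2) (_ : _ <= c)) _.
    by apply: le_trans (F_dist _ _ rT) _; exact: ltW (h3 _ _ Ow Ow' w3).
  by rewrite le_eqVlt; apply/orP; left; apply/eqP; ring.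
rewrite add0r.
apply: (@le_trans _ _ (c * (T * k * expR (T * M_A P)))).
  have -> : c * (T * k * expR (T * M_A P)) = c * k * T * expR (T * M_A P) by ring.
  rewrite ler_wpM2r ?expR_ge0 // ler_wpM2l //.
  by case/andP: (rev_in tT).
have -> : e = c * K by rewrite /c divfK // gt_eqF.
by rewrite ler_wpM2l ?(ltW c0) // lerDl.
Qed.

End StatesAndAdjoints.

(** * Strong concavity of the Hamiltonian *)

Section Pairing.
Context {R : realType}.

Lemma le_limit_segment (a b : R) : (forall s, 0 < s < 1 -> a * (1 - s) <= b) -> a <= b.
Proof.
move=> key; rewrite leNgt; apply/negP => ba.
have half : 0 < (2^-1 : R) < 1 by lra.
have b2 := key _ half; have a0 : 0 < a by lra.
(* This [s] makes [a * (1 - s)] the midpoint of [a] and [b], which exceeds [b]. *)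
pose s := (a - b) / (2 * a).
have s0 : 0 < s by apply: divr_gt0; lra.
have s1 : s < 1 by rewrite ltr_pdivrMr; lra.
have := key s; rewrite s0 s1 => /(_ isT).
have -> : a * (1 - s) = a - (a - b) / 2 by rewrite /s; field; rewrite gt_eqF.
lra.
Qed.

Lemma cvg_dot (I : Type) (F : set_system I) n (f g : I -> 'cV[R]_n)
    (a b : 'cV[R]_n) : Filter F ->
  f x @[x --> F] --> a -> g x @[x --> F] --> b -> dot (f x) (g x) @[x --> F] --> dot a b.
Proof.
move=> FF fa gb.
have coord (h : I -> 'cV[R]_n) (c : 'cV[R]_n) i : h x @[x --> F] --> c ->
    h x i 0 @[x --> F] --> c i 0.
  by move=> hc; apply: (@cvg_comp _ _ _ h (fun M => M i 0) _ _ _ hc); exact: coord_continuous.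
have -> : (fun x => dot (f x) (g x)) = \sum_i (fun x => f x i 0 * g x i 0).
  by apply/funext => x; rewrite fct_sumE.
rewrite /dot; elim/big_rec2: _ => [|i h l _ hl]; first exact: cvg_cst.
by apply: cvgD hl; apply: cvgM; exact: coord.
Qed.

Lemma cvg_enorm_sqr (I : Type) (Fi : set_system I) k (f : I -> 'cV[R]_k) (a : 'cV[R]_k) :
  Filter Fi -> f i @[i --> Fi] --> a -> enorm (f i) ^+ 2 @[i --> Fi] --> enorm a ^+ 2.
Proof. by move=> FF fa; under eq_cvg do rewrite -dotvv; rewrite -dotvv; exact: cvg_dot. Qed.

(** An exact splitting: [p - p'] is paired with the first data, [p'] with the differences of [x],
    [A] and [B]. It serves changes of control, of time and of iterate alike. *)
Lemma pairing_dist n (A A' : 'M[R]_n) (B B' x x' p p' : 'cV[R]_n) (MA MB MX MP : R) :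
  0 <= MP -> 0 <= MX -> spnorm A <= MA -> enorm B <= MB -> enorm x <= MX ->
  enorm x' <= MX -> enorm p' <= MP ->
  `|dot p (A *m x + B) - dot p' (A' *m x' + B')| <=
  enorm (p - p') * (MA * MX + MB) +
  MP * (MA * enorm (x - x') + spnorm (A - A') * MX + enorm (B - B')).
Proof.
move=> MP0 MX0 hA hB hx hx' hp.
have -> : dot p (A *m x + B) - dot p' (A' *m x' + B') =
    dot (p - p') (A *m x + B) +
    dot p' (A *m (x - x') + (A - A') *m x' + (B - B')).
  by rewrite mulmxBr mulmxBl dotBl !(dotDr, dotNr); ring.
have MA0 : 0 <= MA := le_trans (spnorm_ge0 _) hA.
apply: le_trans (ler_normD _ _) _; apply: lerD; apply: le_trans (dot_norm_le _ _) _.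
  rewrite ler_wpM2l ?enorm_ge0 //; apply: le_trans (enormD _ _) _; apply: lerD => //.
  by apply: le_trans (enorm_mulmx _ _) _; rewrite ler_pM ?spnorm_ge0 ?enorm_ge0.
apply: ler_pM; rewrite ?enorm_ge0 //; apply: le_trans (enormD _ _) _; apply: lerD => //.
apply: le_trans (enormD _ _) _; apply: lerD.
  by apply: le_trans (enorm_mulmx _ _) _; rewrite ler_wpM2r ?enorm_ge0.
by apply: le_trans (enorm_mulmx _ _) _; rewrite ler_wpM2l ?spnorm_ge0.
Qed.

End Pairing.

Section Hamiltonian.
Context {R : realType} {d d' m n : nat} (P : problem R d d' m n).
Hypothesis HP : standing_assumptions P.

Local Notation T := (hT P).
Local Notation trajectory := (R -> cpath T d -> 'cV[R]_n).
Local Notation E f := (\int[mu P]_(w in Om P) f w).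

(** What the Hamiltonian needs of a trajectory at a fixed time: continuity in [w], for
    integrability, and the a priori bound, [M_X] for states and [M_P] for adjoints. *)
Definition slice (M : R) (y : cpath T d -> 'cV[R]_n) : Prop :=
  {within Om P, continuous y} /\ forall w, Om P w -> enorm (y w) <= M.

Lemma state_slice u x t : continuous_control P u -> is_state P u x -> 0 <= t <= T ->
  slice (M_X P) (x t).
Proof.
move=> cu sx tT; split=> [|w Ow]; last exact: (state_le HP cu sx).
apply/within_continuousP => w Ow e e0; have e2 : 0 < e / 2 by rewrite divr_gt0.
have [r r0 h] := state_uniform HP e2; exists r => // w' Ow' ww.
apply: le_lt_trans (norm_le_enorm _) _.
by apply: le_lt_trans (h _ _ _ _ _ cu sx tT Ow Ow' ww) _; lra.
Qed.

Lemma adjoint_slice u x p t : continuous_control P u -> is_state P u x ->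
  is_adjoint P u x p -> 0 <= t <= T -> slice (M_P P) (p t).
Proof.
move=> cu sx ap tT; split=> [|w Ow]; last exact: (adjoint_le HP cu sx ap).
apply/within_continuousP => w Ow e e0; have e2 : 0 < e / 2 by rewrite divr_gt0.
have [r r0 h] := adjoint_uniform HP e2; exists r => // w' Ow' ww.
apply: le_lt_trans (norm_le_enorm _) _.
by apply: le_lt_trans (h _ _ _ _ _ _ cu sx ap tT Ow Ow' ww) _; lra.
Qed.

Lemma section_continuous (W : normedModType R) (f : R -> cpath T d -> 'cV[R]_m -> W) t v :
  {within domain (P := P), continuous (fun z => f z.1.1 z.1.2 z.2)} ->
  0 <= t <= T -> U P v -> {within Om P, continuous (fun w => f t w v)}.
Proof.
move=> cf tT Uv; apply/within_continuousP => w Ow e e0.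
have [r r0 h] := uniform_on_domain HP cf e0; exists r => // w' Ow' ww.
by apply: h; rewrite ?subrr ?normr0.
Qed.

Lemma F_section_continuous t : 0 <= t <= T ->
  {within Om P, continuous (fun w => F P w t)}.
Proof.
move=> tT; have /within_continuousP cF := F_continuous HP.
apply/within_continuousP => w Ow e e0; have [r r0 h] := cF w Ow e e0.
exists r => // w' Ow' ww; apply: le_lt_trans (norm_le_enorm _) _.
by apply: le_lt_trans (F_dist _ _ tT) _; exact: h.
Qed.

Definition pairing (x p : cpath T d -> 'cV[R]_n) (v : 'cV[R]_m) t w : R :=
  dot (p w) (A P t w v *m x w + B P t w v).

Lemma pairing_continuous x p v t a b : slice a x -> slice b p -> 0 <= t <= T -> U P v ->
  {within Om P, continuous (pairing x p v t)}.
Proof.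
move=> [cx _] [cp _] tT Uv w; apply: cvg_dot; first exact: cp.
apply: cvgD; last exact: (section_continuous (B_continuous HP)).
by apply: cvg_mulmx; [exact: (section_continuous (A_continuous HP))|exact: cx].
Qed.

Lemma tracking_cost_continuous x t a : slice a x -> 0 <= t <= T ->
  {within Om P, continuous (fun w => alpha P * enorm (C P *m x w - F P w t) ^+ 2)}.
Proof.
move=> [cx _] tT w; apply: cvgM; first exact: cvg_cst.
apply: cvg_enorm_sqr.
apply: cvgB; last exact: (F_section_continuous tT).
by apply: cvg_mulmx; [exact: cvg_cst|exact: cx].
Qed.

(** Isolates the tracking term, which does not contain the control and so cancels whenever two
    controls are compared at one time. *)
Lemma hamiltonianE x p v t a b : slice a x -> slice b p -> 0 <= t <= T -> U P v ->
  hamiltonian P x p v t = E (pairing x p v t) -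
    E (fun w => alpha P * enorm (C P *m x w - F P w t) ^+ 2) - beta P * enorm v ^+ 2.
Proof.
move=> sx sp tT Uv; have cK := Om_compact HP; have muK := measure_Om HP.
have c1 := pairing_continuous sx sp tT Uv; have c2 := tracking_cost_continuous sx tT.
have c3 : {within Om P, continuous (fun=> beta P * enorm v ^+ 2 : R)}.
  by move=> w; exact: cvg_cst.
have c12 : {within Om P, continuous (fun w => pairing x p v t w -
    alpha P * enorm (C P *m x w - F P w t) ^+ 2)}.
  by move=> w; apply: cvgB; [exact: c1|exact: c2].
rewrite /hamiltonian (expectationB cK muK c12 c3) (expectationB cK muK c1 c2).
by rewrite (expectation_cst cK muK).
Qed.

(** The [kappa] of the overview. The term [beta |u|^2] contributes curvature [2 beta], the pairing
    takes away at most [M_P (H_A M_X + H_B)], and [kappa] is half of what is left. *)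
Definition concavity_gap : R := beta P - M_P P * (H_A P * M_X P + H_B P) / 2.

(* The second derivative of the pairing along a segment is at most
   [M_P (H_A M_X + H_B)] times the squared length, so the Hamiltonian is
   strongly concave along segments of [U]. *)
Lemma maximizer_gap x p u t v : 0 < concavity_gap ->
  slice (M_X P) x -> slice (M_P P) p -> 0 <= t <= T -> U P u ->
  (forall v, U P v -> hamiltonian P x p v t <= hamiltonian P x p u t) -> U P v ->
  concavity_gap * enorm (v - u) ^+ 2 <= hamiltonian P x p u t - hamiltonian P x p v t.
Proof.
move=> k0 sx sp tT Uu umax Uv; have cK := Om_compact HP; have muK := measure_Om HP.
set D := enorm (v - u) ^+ 2; set X := _ - _.
have D0 : 0 <= D by exact: sqr_ge0.
(* The maximizer [u] is compared with the intermediate point [u + s (v - u)]. Strong concavity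
   bounds the Hamiltonian there from below by the chord plus [kappa s (1 - s) D]; dividing by [s]
   and letting [s] tend to 0 gives the full constant [kappa]. *)
have key s : 0 < s < 1 -> concavity_gap * D * (1 - s) <= X.
  move=> s01; have /andP[s0 s1] := s01.
  have Us : U P (u + s *: (v - u)) by apply: U_segment => //; rewrite !ltW.
  have := umax _ Us; rewrite /X !(hamiltonianE sx sp tT) //.
  set cE := E (fun w => alpha P * _).
  set g0 := E (pairing x p u t); set g1 := E (pairing x p v t).
  set gs := E (pairing x p (u + _) t) => maxs.
  set c := M_P P * (H_A P * M_X P + H_B P) * D.
  have gap : (1 - s) * g0 + s * g1 - c / 2 * (s * (1 - s)) <= gs.
    have c0 := pairing_continuous sx sp tT Uu; have c1 := pairing_continuous sx sp tT Uv.
    have cs := pairing_continuous sx sp tT Us.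
    have cc (a : R) : {within Om P, continuous (fun=> a)} by move=> w; exact: cvg_cst.
    have z0 : {within Om P, continuous (fun w => (1 - s) * pairing x p u t w)}.
      by move=> w; apply: cvgM; [exact: cvg_cst|exact: c0].
    have z1 : {within Om P, continuous (fun w => s * pairing x p v t w)}.
      by move=> w; apply: cvgM; [exact: cvg_cst|exact: c1].
    have z01 : {within Om P, continuous (fun w => (1 - s) * pairing x p u t w +
        s * pairing x p v t w)}.
      by move=> w; apply: cvgD; [exact: z0|exact: z1].
    have zc := cc (c / 2 * (s * (1 - s))).
    have zz : {within Om P, continuous (fun w => (1 - s) * pairing x p u t w +
        s * pairing x p v t w - c / 2 * (s * (1 - s)))}.
      by move=> w; apply: cvgB; [exact: z01|exact: zc].
    rewrite /g0 /g1 -(expectationZ cK muK (1 - s) c0) -(expectationZ cK muK s c1).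
    rewrite -(expectationD cK muK z0 z1) -[c / 2 * _](expectation_cst cK muK).
    rewrite -(expectationB cK muK z01 zc).
    apply: (expectation_le cK muK zz cs) => w Ow.
    apply: le_trans (pairing_gap HP tT (Om_in HP Ow) (p w) (x w) Uu Uv s01).
    rewrite lerD2l lerN2; apply: ler_wpM2r.
      by rewrite mulr_ge0 ?(ltW s0) // subr_ge0 ltW.
    apply: ler_wpM2r; first by rewrite invr_ge0.
    apply: ler_wpM2r => //; apply: ler_pM; rewrite ?enorm_ge0 //.
    - by rewrite addr_ge0 ?(H_B_ge0 P) // mulr_ge0 ?(H_A_ge0 P) ?enorm_ge0.
    - exact: sp.2.
    - by rewrite lerD2r ler_wpM2l ?(H_A_ge0 P) // sx.2.
  (* An exact identity, so the quadratic term contributes all of [beta s (1 - s) D]. *)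
  have nE : enorm (u + s *: (v - u)) ^+ 2 =
      (1 - s) * enorm u ^+ 2 + s * enorm v ^+ 2 - s * (1 - s) * D.
    rewrite /D -!dotvv !(dotDl, dotDr, dotZl, dotZr, dotBl, dotBr, dotNl, dotNr) (dotC v u).
    by ring.
  rewrite nE in maxs; rewrite /concavity_gap.
  have H : s * ((beta P - M_P P * (H_A P * M_X P + H_B P) / 2) * D * (1 - s)) <=
      s * (g0 - cE - beta P * enorm u ^+ 2 - (g1 - cE - beta P * enorm v ^+ 2)).
    rewrite -subr_ge0; rewrite -subr_ge0 in maxs; rewrite -subr_ge0 in gap.
    by have := addr_ge0 maxs gap; congr (0 <= _); rewrite /c; field.
  by rewrite ler_pM2l in H.
exact: le_limit_segment key.
Qed.

Lemma expected_pairing_dist x p x' p' v v' t t' (e : R) :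
  slice (M_X P) x -> slice (M_P P) p -> slice (M_X P) x' -> slice (M_P P) p' ->
  0 <= t <= T -> 0 <= t' <= T -> U P v -> U P v' ->
  (forall w, Om P w -> enorm (p w - p' w) * (M_A P * M_X P + M_B P) +
    M_P P * (M_A P * enorm (x w - x' w) + spnorm (A P t w v - A P t' w v') * M_X P +
             enorm (B P t w v - B P t' w v')) <= e) ->
  `|E (pairing x p v t) - E (pairing x' p' v' t')| <= e.
Proof.
move=> sx sp sx' sp' tT tT' Uv Uv' h.
apply: (expectation_dist (Om_compact HP) (measure_Om HP)
  (pairing_continuous sx sp tT Uv) (pairing_continuous sx' sp' tT' Uv')) => w Ow.
apply: le_trans (h w Ow); apply: pairing_dist.
- exact: M_P_ge0.
- exact: M_X_ge0.
- exact: A_le.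
- exact: B_le.
- exact: sx.2.
- exact: sx'.2.
- exact: sp'.2.
Qed.

Definition control_sensitivity : R := M_P P * (G_A P * M_X P + G_B P).

Lemma expected_pairing_lipschitz x p v v' t :
  slice (M_X P) x -> slice (M_P P) p -> 0 <= t <= T -> U P v -> U P v' ->
  `|E (pairing x p v t) - E (pairing x p v' t)| <= control_sensitivity * enorm (v - v').
Proof.
move=> sx sp tT Uv Uv'; apply: expected_pairing_dist => // w Ow.
rewrite !subrr !enorm0 mul0r mulr0 !add0r /control_sensitivity -mulrA.
rewrite ler_wpM2l ?(M_P_ge0 HP) // mulrDl; apply: lerD.
  rewrite mulrAC ler_wpM2r ?(M_X_ge0 HP) //.
  by apply: A_lipschitz => //; exact: Om_in.
by apply: B_lipschitz => //; exact: Om_in.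
Qed.

(** [r] is fixed before the control and its trajectories: [A] and [B] have a uniform modulus in
    time, and the Lipschitz constants [state_speed] and [adjoint_speed] are common to all controls.
    Equicontinuity uniform in [k] rests on this order of quantifiers. *)
Lemma expected_pairing_time (e : R) : 0 < e -> exists2 r : R, 0 < r &
  forall u x p v s t, continuous_control P u -> is_state P u x -> is_adjoint P u x p ->
    0 <= s <= T -> 0 <= t <= T -> U P v -> `|t - s| < r ->
    `|E (pairing (x t) (p t) v t) - E (pairing (x s) (p s) v s)| <= e.
Proof.
move=> e0.
pose K := adjoint_speed P * (M_A P * M_X P + M_B P) +
  M_P P * (M_A P * state_speed P + M_X P + 1) + 1.
have MX0 := M_X_ge0 HP; have MP0 := M_P_ge0 HP; have MA0 := MA_ge0 HP.
have MB0 := MB_ge0 HP; have as0 := adjoint_speed_ge0 HP; have ss0 := state_speed_ge0 HP.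
have K0 : 0 < K.
  rewrite ltr_wpDl // addr_ge0 //; apply: mulr_ge0 => //.
  apply: addr_ge0 => //; apply: addr_ge0 => //; exact: mulr_ge0.
have c0 : 0 < e / K by rewrite divr_gt0.
set c := e / K in c0.
have [r1 r10 h1] := A_uniform HP c0; have [r2 r20 h2] := B_uniform HP c0.
exists (Num.min c (Num.min r1 r2)); first by rewrite !lt_min c0 r10.
move=> u x p v s t cu sx ap sT tT Uv; rewrite !lt_min => /and3P[tsc ts1 ts2].
apply: expected_pairing_dist => //; try exact: state_slice sx _; try exact: adjoint_slice ap _.
move=> w Ow.
have ww r : 0 < r -> `|w - w| < r by rewrite subrr normr0.
have a1 : enorm (p t w - p s w) <= adjoint_speed P * c.
  apply: le_trans (adjoint_lipschitz HP cu sx ap sT tT Ow) _.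
  by rewrite ler_wpM2l // ltW.
have a2 : enorm (x t w - x s w) <= state_speed P * c.
  apply: le_trans (state_lipschitz HP cu sx sT tT Ow) _.
  by rewrite ler_wpM2l // ltW.
have a3 := h1 t s w w v tT sT Ow Ow Uv ts1 (ww _ r10).
have a4 := h2 t s w w v tT sT Ow Ow Uv ts2 (ww _ r20).
have -> : e = adjoint_speed P * c * (M_A P * M_X P + M_B P) +
    M_P P * (M_A P * (state_speed P * c) + c * M_X P + c) + c.
  by rewrite -[LHS](divfK (lt0r_neq0 K0)) -/c /K; ring.
rewrite -[leLHS]addr0; apply: lerD (ltW c0); apply: lerD.
  by rewrite ler_wpM2r // addr_ge0 // mulr_ge0.
rewrite ler_wpM2l //; apply: lerD => //; apply: lerD; first by rewrite ler_wpM2l.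
by rewrite ler_wpM2r.
Qed.

(** Take the gap inequality at time [t] against [u' s] and at time [s] against [u' t]. In the sum
    the tracking and quadratic terms cancel, leaving [2 kappa |u' t - u' s|^2] bounded by two
    variations in time of the expected pairing at a frozen control, each at most [kappa e^2 / 2]. *)
Lemma maximizer_equicontinuous (e : R) : 0 < concavity_gap -> 0 < e ->
  exists2 r : R, 0 < r &
  forall u x p u', continuous_control P u -> is_state P u x -> is_adjoint P u x p ->
    (forall t, 0 <= t <= T -> maximizes_hamiltonian P x p u' t) ->
    forall s t, 0 <= s <= T -> 0 <= t <= T -> `|t - s| < r -> enorm (u' t - u' s) < e.
Proof.
move=> k0 e0; pose c := concavity_gap * e ^+ 2 / 2.
have c0 : 0 < c by rewrite divr_gt0 // mulr_gt0 // exprn_gt0.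
have [r r0 h] := expected_pairing_time c0; exists r => // u x p u' cu sx ap umax s t sT tT ts.
have [Ut maxt] := umax t tT; have [Us maxs] := umax s sT.
have st := state_slice cu sx tT; have ss := state_slice cu sx sT.
have pt := adjoint_slice cu sx ap tT; have ps := adjoint_slice cu sx ap sT.
have g1 := maximizer_gap k0 st pt tT Ut maxt Us.
have g2 := maximizer_gap k0 ss ps sT Us maxs Ut.
rewrite (hamiltonianE st pt tT Ut) (hamiltonianE st pt tT Us) in g1.
rewrite (hamiltonianE ss ps sT Ut) (hamiltonianE ss ps sT Us) in g2.
rewrite enorm_distrC in g1.
have := h _ _ _ _ _ _ cu sx ap sT tT Ut ts; have := h _ _ _ _ _ _ cu sx ap sT tT Us ts.
rewrite !ler_norml => /andP[b1 _] /andP[_ b2].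
have : concavity_gap * enorm (u' t - u' s) ^+ 2 <= concavity_gap * e ^+ 2 / 2.
  move: g1 g2 b1 b2; rewrite -/c.
  move: (E (pairing (x t) (p t) (u' t) t)) (E (pairing (x t) (p t) (u' s) t)).
  move: (E (pairing (x s) (p s) (u' t) s)) (E (pairing (x s) (p s) (u' s) s)).
  move: (E (fun w => alpha P * enorm (C P *m x t w - F P w t) ^+ 2)).
  move: (E (fun w => alpha P * enorm (C P *m x s w - F P w s) ^+ 2)).
  move: (beta P * enorm (u' t) ^+ 2) (beta P * enorm (u' s) ^+ 2) (concavity_gap * _).
  by move=> ? ? ? ? ? ? ? ? ?; lra.
have : concavity_gap * e ^+ 2 / 2 < concavity_gap * e ^+ 2.
  have ke : 0 < concavity_gap * e ^+ 2 by rewrite mulr_gt0 // exprn_gt0.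
  by rewrite gtr_pMr // invf_lt1 // ltr1n.
move=> z1 z2; have := le_lt_trans z2 z1; rewrite ltr_pM2l //.
by rewrite ltr_pXn2r ?nnegrE ?enorm_ge0 // ltW.
Qed.

Lemma hamiltonian_continuous x p t : slice (M_X P) x -> slice (M_P P) p -> 0 <= t <= T ->
  {within U P, continuous (fun v => hamiltonian P x p v t)}.
Proof.
move=> st pt tT.
have cg : {within U P, continuous (fun v => E (pairing x p v t) -
    E (fun w => alpha P * enorm (C P *m x w - F P w t) ^+ 2) - beta P * enorm v ^+ 2)}.
  move=> v; apply: cvgB.
    apply: cvgB; last exact: cvg_cst.
    move: v; apply/within_continuousP => v Uv e e0.
    pose K := control_sensitivity * m%:R + 1.
    have cs0 : 0 <= control_sensitivity.
      apply: mulr_ge0; first exact: M_P_ge0.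
      by rewrite addr_ge0 ?(G_B_ge0 P) // mulr_ge0 ?(G_A_ge0 P) ?(M_X_ge0 HP).
    have K0 : 0 < K by rewrite ltr_wpDl // mulr_ge0.
    exists (e / K) => [|v' Uv' vv]; first by rewrite divr_gt0.
    apply: le_lt_trans (expected_pairing_lipschitz st pt tT Uv Uv') _.
    apply: (@le_lt_trans _ _ (K * `|v - v'|)); last by rewrite mulrC -ltr_pdivlMr.
    apply: (@le_trans _ _ (control_sensitivity * m%:R * `|v - v'|)).
      by rewrite -mulrA ler_wpM2l // enorm_le_norm.
    by rewrite ler_wpM2r // lerDl.
  apply: cvgM; first exact: cvg_cst.
  apply: cvg_enorm_sqr; have cid : continuous (fun z : 'cV[R]_m => z) by move=> z; exact: cvg_id.
  exact: (continuous_subspaceT cid).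
apply/within_continuousP => v Uv e e0; have /within_continuousP/(_ v Uv e e0) := cg.
move=> [r r0 h]; exists r => // v' Uv' vv.
by rewrite !(hamiltonianE st pt tT) //; exact: h.
Qed.

Lemma maximizer_exists u x p t : continuous_control P u -> is_state P u x ->
  is_adjoint P u x p -> 0 <= t <= T ->
  exists v, U P v /\ forall v', U P v' ->
    hamiltonian P (x t) (p t) v' t <= hamiltonian P (x t) (p t) v t.
Proof.
move=> cu sx ap tT.
have cH := hamiltonian_continuous (state_slice cu sx tT) (adjoint_slice cu sx ap tT) tT.
have [v /set_mem Uv vmax] := compact_EVT_max (U_neq0 HP) (U_compact HP) cH.
by exists v; split => // v' Uv'; apply: vmax; exact: mem_set.
Qed.

End Hamiltonian.

(** * Decrease of the cost *)

Section ParametricPrimitive.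
Context {R : realType} {V : normedModType R}.
Variables (mu : probability (Borel V) R) (K : set V) (T : R).
Hypotheses (cK : compact K) (muK : mu K = 1%E) (T0 : 0 <= T).
Variable f : R -> V -> R.
Hypothesis cf : {within `[0, T] `*` K, continuous (fun z => f z.1 z.2)}.

Local Notation E f := (\int[mu]_(w in K) f w).

Lemma joint_uniform (e : R) : 0 < e -> exists2 r : R, 0 < r & forall s t w w',
  0 <= s <= T -> 0 <= t <= T -> K w -> K w' -> `|s - t| < r -> `|w - w'| < r ->
  `|f s w - f t w'| < e.
Proof.
have cD : compact ((`[0, T] : set R) `*` K).
  by apply: compact_setX cK; exact: segment_compact.
move=> e0; have [r r0 h] := compact_uniform_continuous cD cf e0.
exists r => // s t w w' sT tT Kw Kw' st ww.
apply: (h (s, w) (t, w')); rewrite ?prod_normE /= ?gt_max ?st //.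
Qed.

Lemma joint_continuous_time w : K w -> {within `[0, T], continuous (f^~ w)}.
Proof.
move=> Kw; apply/within_continuousP => t It e e0; have [r r0 h] := joint_uniform e0.
exists r => // s Is ts; move: It Is; rewrite /= !in_itv /= => It Is.
by apply: h; rewrite // subrr normr0.
Qed.

Lemma joint_continuous_parameter t : 0 <= t <= T -> {within K, continuous (f t)}.
Proof.
move=> tT; apply/within_continuousP => w Kw e e0; have [r r0 h] := joint_uniform e0.
by exists r => // w' Kw' ww; apply: h; rewrite // subrr normr0.
Qed.

Lemma primitive_family_exists : exists D : V -> R -> R,
  forall w, K w -> D w 0 = 0 /\ has_derivative_on T (D w) (f^~ w).
Proof.
have /choice[D hD] : forall w, exists D : R -> R,
    K w -> D 0 = 0 /\ has_derivative_on T D (f^~ w).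
  move=> w; have [Kw|nKw] := pselect (K w); last by exists (fun=> 0).
  by have [D D0 dD] := primitive_on T0 (joint_continuous_time Kw); exists D.
by exists D.
Qed.

Variable D : V -> R -> R.
Hypothesis dD : forall w, K w -> D w 0 = 0 /\ has_derivative_on T (D w) (f^~ w).

(** A bound on [f s w - f s w'] uniform in time integrates to at most [T] times itself. Continuity
    in [w] allows [D w t] to be integrated over [K]. *)
Lemma primitive_family_continuous t : 0 <= t <= T -> {within K, continuous (fun w => D w t)}.
Proof.
move=> tT; apply/within_continuousP => w Kw e e0; have T1 : 0 < T + 1 by rewrite ltr_wpDl.
have [r r0 h] := joint_uniform (divr_gt0 e0 T1); exists r => // w' Kw' ww.
have [Dw dw] := dD Kw; have [Dw' dw'] := dD Kw'; have /andP[t0 tT'] := tT.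
set c := e / (T + 1) in h; have c0 : 0 < c by rewrite divr_gt0.
apply: (@le_lt_trans _ _ (c * t)); last first.
  by rewrite /c mulrAC ltr_pdivrMr // ltr_pM2l // ltr_pwDr.
have dd := has_derivative_onB dw dw'.
have hc s : 0 <= s <= t -> `|f s w - f s w'| <= c.
  move=> st; have sT : 0 <= s <= T by lra.
  by apply: ltW; apply: h; rewrite ?subrr ?normr0.
rewrite ler_norml; apply/andP; split.
  have := has_derivative_on_le (has_derivative_on_linear T (- c)) dd (lexx 0) t0 tT'.
  rewrite mulr0 Dw Dw' !subr0 mulNr; apply => s /hc.
  by rewrite ler_norml => /andP[].
have := has_derivative_on_le dd (has_derivative_on_linear T c) (lexx 0) t0 tT'.
rewrite mulr0 Dw Dw' !subr0; apply => s /hc.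
by rewrite ler_norml => /andP[].
Qed.

(* Fubini's theorem in the form of an inequality: with [cousin] it reduces to
   short intervals, where [f] is nearly constant in time. *)
Lemma expectation_primitive_ge (Q c : R -> R) : {within `[0, T], continuous c} ->
  has_derivative_on T Q c -> (forall t, 0 <= t <= T -> c t <= E (f t)) ->
  Q T - Q 0 <= E (fun w => D w T).
Proof.
move=> cc dQ cE; have cD t : 0 <= t <= T -> {within K, continuous (fun w => D w t)}.
  exact: primitive_family_continuous.
have Z0 : 0 <= (0 : R) <= T by rewrite lexx.
have ZT : 0 <= T <= T by rewrite lexx andbT.
(* An error of [e] per unit of time is additive over adjacent intervals, as [cousin] requires; half
   of it pays for the variation of [f] in time, half for that of [c]. *)
suff H (e : R) : 0 < e ->
    Q T - Q 0 - e * (T - 0) <= E (fun w => D w T) - E (fun w => D w 0).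
  have ED0 : E (fun w => D w 0) = 0.
    rewrite -[RHS](expectation_cst cK muK); apply: eq_Rintegral => w /set_mem Kw.
    by have [] := dD Kw.
  apply/ler_addgt0Pl => e e0; have T1 : 0 < T + 1 by rewrite ltr_wpDl.
  have := H _ (divr_gt0 e0 T1); rewrite ED0 !subr0.
  have : e / (T + 1) * T <= e by rewrite mulrAC ler_pdivrMr // ler_wpM2l ?(ltW e0) // lerDl.
  by lra.
move=> e0; apply: (@cousin _ (fun l r => Q r - Q l - e * (r - l) <=
  E (fun w => D w r) - E (fun w => D w l)) 0 T T0).
  move=> l m r _ _ _ _.
  move: (E (fun w => D w l)) (E (fun w => D w m)) (E (fun w => D w r)) => x y z; lra.
move=> t tT; have e2 : 0 < e / 2 by rewrite divr_gt0.
have [d1 d10 h1] := joint_uniform e2.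
have It : `[0, T]%classic t by rewrite /= in_itv.
have /within_continuousP/(_ t It _ e2)[d2 d20 h2] := cc.
exists (Num.min d1 d2); first by rewrite lt_min d10.
move=> l r l0 lt tr rT; rewrite lt_min => /andP[rl1 rl2].
have lr : l <= r by exact: le_trans tr.
have lT : 0 <= l <= T by rewrite l0 (le_trans lr).
have r'T : 0 <= r <= T by rewrite rT (le_trans l0).
have close s : l <= s <= r -> `|t - s| < d1 /\ `|t - s| < d2.
  move=> slr; have st : `|t - s| <= r - l by rewrite ler_norml; apply/andP; split; lra.
  by split; apply: le_lt_trans st _.
have incD w : K w -> (f t w - e / 2) * (r - l) <= D w r - D w l.
  move=> Kw; have [_ dw] := dD Kw; rewrite mulrBr.
  apply: (has_derivative_on_le (has_derivative_on_linear T _) dw l0 lr rT) => s sl.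
  have [ts _] := close s sl; have sT : 0 <= s <= T by lra.
  have ww : `|w - w| < d1 by rewrite subrr normr0.
  by have := h1 t s w w tT sT Kw Kw ts ww; rewrite ltr_norml => /andP[_]; lra.
have incQ : Q r - Q l <= (c t + e / 2) * (r - l).
  rewrite mulrBr.
  apply: (has_derivative_on_le dQ (has_derivative_on_linear T _) l0 lr rT) => s sl.
  have [_ ts] := close s sl; have Is : `[0, T]%classic s by rewrite /= in_itv /=; lra.
  by have := h2 s Is ts; rewrite ltr_norml => /andP[+ _]; lra.
have cft := joint_continuous_parameter tT.
have cst a : {within K, continuous (fun=> a : R)} by move=> w; exact: cvg_cst.
have EDle : (E (f t) - e / 2) * (r - l) <= E (fun w => D w r) - E (fun w => D w l).
  rewrite -(expectationB cK muK (cD r r'T) (cD l lT)).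
  rewrite -[X in _ - X](expectation_cst cK muK) -(expectationB cK muK cft (cst _)).
  have cft' : {within K, continuous (fun w => f t w - e / 2)}.
    by move=> w; apply: cvgB; [exact: cft|exact: cvg_cst].
  rewrite mulrC -(expectationZ cK muK _ cft'); apply: (expectation_le cK muK).
  - by move=> w; apply: cvgM; [exact: cvg_cst|exact: cft'].
  - by move=> w; apply: cvgB; [exact: cD|exact: cD].
  - by move=> w Kw; rewrite mulrC; exact: incD.
have : (c t + e / 2) * (r - l) - e * (r - l) <= (E (f t) - e / 2) * (r - l).
  rewrite -mulrBl ler_wpM2r ?subr_ge0 //; have := cE t tT.
  by move: (E (f t)) => x; lra.
move: EDle incQ; move: (E (fun w => D w l)) (E (fun w => D w r)) (E (f t)) => x y z.
move: (_ * (r - l)) (_ * (r - l)) => a b; lra.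
Qed.

End ParametricPrimitive.

(** * Joint continuity in time and parameter *)

Section JointContinuity.
Context {R : realType} {d d' m n : nat} (P : problem R d d' m n).
Hypothesis HP : standing_assumptions P.

Local Notation T := (hT P).
Local Notation trajectory := (R -> cpath T d -> 'cV[R]_n).
Local Notation joint f := {within `[0, T] `*` Om P, continuous f}.

Lemma joint_control u : continuous_control P u -> joint (fun z => u z.1).
Proof.
move=> [/within_continuousP cu _]; apply/within_continuousP => -[t w] [It _] e e0.
have [r r0 h] := cu t It e e0; exists r => // -[s w'] [Is _].
by rewrite prod_normE /= gt_max => /andP[ts _]; exact: h.
Qed.

Lemma joint_domain (W : normedModType R) (f : R -> cpath T d -> 'cV[R]_m -> W) u :
  {within domain (P := P), continuous (fun z => f z.1.1 z.1.2 z.2)} ->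
  continuous_control P u -> joint (fun z => f z.1 z.2 (u z.1)).
Proof.
move=> cf [/within_continuousP cu uU]; apply/within_continuousP => -[t w] [It Ow] e e0.
have [r r0 h] := uniform_on_domain HP cf e0; have [r' r'0 h'] := cu t It r r0.
exists (Num.min r r'); first by rewrite lt_min r0.
move=> [s w'] [Is Ow']; rewrite prod_normE /= gt_max !lt_min => /andP[/andP[tr tr'] /andP[wr _]].
have [tT sT] : 0 <= t <= T /\ 0 <= s <= T by move: It Is; rewrite /= !in_itv.
by apply: h => //; [exact: uU|exact: uU|exact: h'].
Qed.

(** Lipschitz in time uniformly in the parameter, and continuous in the parameter at each time: the
    triangle inequality goes through [(t, w')]. *)
Lemma joint_lipschitz (y : trajectory) L : 0 <= L ->
  (forall s t w, 0 <= s <= T -> 0 <= t <= T -> Om P w ->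
     enorm (y t w - y s w) <= L * `|t - s|) ->
  (forall t, 0 <= t <= T -> {within Om P, continuous (y t)}) ->
  joint (fun z => y z.1 z.2).
Proof.
move=> L0 hL cy; apply/within_continuousP => -[t w] [It Ow] e e0.
have tT : 0 <= t <= T by move: It; rewrite /= in_itv.
have e2 : 0 < e / 2 by rewrite divr_gt0.
have /within_continuousP/(_ w Ow _ e2)[r r0 h] := cy t tT.
have L1 : 0 < L + 1 by rewrite ltr_wpDl.
exists (Num.min r (e / 2 / (L + 1))); first by rewrite lt_min r0 divr_gt0.
move=> [s w'] [Is Ow']; rewrite prod_normE /= gt_max !lt_min => /andP[/andP[_ ts] /andP[wr _]].
have sT : 0 <= s <= T by move: Is; rewrite /= in_itv.
rewrite -(subrKA (y t w')); apply: le_lt_trans (ler_normD _ _) _; rewrite [e]splitr.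
apply: ltrD; first exact: h.
apply: le_lt_trans (norm_le_enorm _) _; apply: le_lt_trans (hL s t w' sT tT Ow') _.
rewrite ltr_pdivlMr // in ts; apply: le_lt_trans ts; rewrite mulrC.
by rewrite ler_wpM2l // lerDl.
Qed.

Lemma joint_state u x : continuous_control P u -> is_state P u x ->
  joint (fun z => x z.1 z.2).
Proof.
move=> cu sx; apply: (joint_lipschitz (state_speed_ge0 HP)) => [s t w|t tT].
  exact: (state_lipschitz HP cu sx).
by have [] := state_slice HP cu sx tT.
Qed.

Lemma joint_adjoint u x p : continuous_control P u -> is_state P u x -> is_adjoint P u x p ->
  joint (fun z => p z.1 z.2).
Proof.
move=> cu sx ap; apply: (joint_lipschitz (adjoint_speed_ge0 HP)) => [s t w|t tT].
  exact: (adjoint_lipschitz HP cu sx ap).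
by have [] := adjoint_slice HP cu sx ap tT.
Qed.

Lemma joint_observation : joint (fun z => F P z.2 z.1).
Proof.
apply/within_continuousP => -[t w] [It Ow] e e0; have e2 : 0 < e / 2 by rewrite divr_gt0.
have /within_continuousP/(_ t It _ e2)[r r0 h] := (cpathP (F P w)).1.
have /within_continuousP/(_ w Ow _ e2)[r' r'0 h'] := F_continuous HP.
exists (Num.min r r'); first by rewrite lt_min r0.
move=> [s w'] [Is Ow']; rewrite prod_normE /= gt_max !lt_min => /andP[/andP[tr _] /andP[_ wr]].
have sT : 0 <= s <= T by move: Is; rewrite /= in_itv.
rewrite -(subrKA (F P w s)); apply: le_lt_trans (ler_normD _ _) _; rewrite [e]splitr.
apply: ltrD; first exact: h.
by apply: le_lt_trans (norm_le_enorm _) _; apply: le_lt_trans (F_dist _ _ sT) _; exact: h'.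
Qed.

Lemma joint_pairing u x p v : continuous_control P u -> is_state P u x ->
  is_adjoint P u x p -> continuous_control P v ->
  joint (fun z => pairing (x z.1) (p z.1) (v z.1) z.1 z.2).
Proof.
move=> cu sx ap cv z; apply: cvg_dot; first exact: (joint_adjoint cu sx ap).
apply: cvgD; last exact: (joint_domain (B_continuous HP) cv).
by apply: cvg_mulmx; [exact: (joint_domain (A_continuous HP) cv)|exact: (joint_state cu sx)].
Qed.

Definition running_cost (u : R -> 'cV[R]_m) (x : trajectory) t w : R :=
  alpha P * enorm (C P *m x t w - F P w t) ^+ 2 + beta P * enorm (u t) ^+ 2.

Lemma joint_running_cost u x : continuous_control P u -> is_state P u x ->
  joint (fun z => running_cost u x z.1 z.2).
Proof.
move=> cu sx z; apply: cvgD; (apply: cvgM; first exact: cvg_cst); apply: cvg_enorm_sqr.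
  apply: cvgB; last exact: joint_observation.
  by apply: cvg_mulmx; [exact: cvg_cst|exact: (joint_state cu sx)].
exact: joint_control.
Qed.

End JointContinuity.

(* The adjoint equation cancels the terms of first order in [x' - x]. *)
Lemma duality_identity {R : realType} k n (A A' : 'M[R]_n) (B B' p x x' : 'cV[R]_n)
    (C : 'M[R]_(k, n)) (F : 'cV[R]_k) (a b v v' : R) :
  a * enorm (C *m x' - F) ^+ 2 + b * v' - (a * enorm (C *m x - F) ^+ 2 + b * v) -
    (dot (- (A^T *m p) + (2 * a) *: (C^T *m (C *m x - F))) (x' - x) +
     dot p (A' *m x' + B' - (A *m x + B))) +
    (dot p (A' *m x + B') - dot p (A *m x + B) - b * (v' - v)) =
  a * enorm (C *m (x' - x)) ^+ 2 - dot p ((A' - A) *m (x' - x)).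
Proof.
set z := x' - x; set e := C *m x - F.
have -> : C *m x' - F = C *m z + e by rewrite /z /e mulmxBr addrA subrK.
have : x' = z + x by rewrite subrK.
clearbody z e => ->; rewrite enorm_sqrD mulmxDr mulmxBl.
rewrite !(dotDl, dotDr, dotBr, dotNl, dotNr, dotZl) !dot_trmx (dotC e).
by ring.
Qed.

Section CostDecrease.
Context {R : realType} {d d' m n : nat} (P : problem R d d' m n).
Hypothesis HP : standing_assumptions P.

Local Notation T := (hT P).
Local Notation trajectory := (R -> cpath T d -> 'cV[R]_n).
Local Notation E f := (\int[mu P]_(w in Om P) f w).

Let T0 : 0 <= T := T_ge0 HP.

(** [J w t] is the cost accumulated up to time [t] at the parameter [w]. The cost functional thus
    appears as the expectation of [J w T], with the time integral inside. *)
Definition cost_primitive u (x : trajectory) (J : cpath T d -> R -> R) : Prop :=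
  forall w, Om P w -> J w 0 = 0 /\ has_derivative_on T (J w) (running_cost u x ^~ w).

Definition control_distance (u u' : R -> 'cV[R]_m) (Q : R -> R) : Prop :=
  Q 0 = 0 /\ has_derivative_on T Q (fun t => enorm (u' t - u t) ^+ 2).

(** Two bounds meet in the primitive [D] of the Hamiltonian gain: [gain] holds from below after
    expectation, [loss] from above at each parameter. Taking the expectation of [loss] and inserting
    [gain] gives the claim. *)
Lemma cost_decrease u x p u' x' J J' Q : 0 < concavity_gap P ->
  continuous_control P u -> continuous_control P u' ->
  is_state P u x -> is_adjoint P u x p -> is_state P u' x' ->
  (forall t, 0 <= t <= T -> maximizes_hamiltonian P x p u' t) ->
  cost_primitive u x J -> cost_primitive u' x' J' -> control_distance u u' Q ->
  E (fun w => J' w T) <= E (fun w => J w T) - (concavity_gap P - C_E P) * Q T.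
Proof.
move=> k0 cu cu' sx ap sx' umax dJ dJ' [Q0 dQ].
have cK := Om_compact HP; have muK := measure_Om HP.
have TT : 0 <= T <= T by rewrite lexx andbT.
pose f t w := pairing (x t) (p t) (u' t) t w - pairing (x t) (p t) (u t) t w -
  beta P * (enorm (u' t) ^+ 2 - enorm (u t) ^+ 2).
have cf : {within `[0, T] `*` Om P, continuous (fun z => f z.1 z.2)}.
  move=> z; apply: cvgB.
    by apply: cvgB; exact: (joint_pairing HP cu sx ap).
  apply: cvgM; first exact: cvg_cst.
  by apply: cvgB; apply: cvg_enorm_sqr; exact: joint_control.
have [D dD] := primitive_family_exists cK T0 cf.
have cdu : {within `[0, T], continuous (fun t => u' t - u t)}.
  by move=> t; apply: cvgB; [exact: cu'.1|exact: cu.1].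
have cdu1 : {within `[0, T], continuous (fun t => enorm (u' t - u t))}.
  move=> t; have h := cdu t.
  exact: (@continuous_comp _ _ _ (fun t : subspace `[0, T] => u' t - u t) enorm t h
    (@enorm_continuous R m _)).
have [y y0 dy] := primitive_on T0 cdu1.
have yge t : 0 <= t <= T -> 0 <= y t.
  move=> /andP[t0 tT]; rewrite -y0.
  by apply: (has_derivative_on_nondecreasing dy) => // s _; exact: enorm_ge0.
have QT t : 0 <= t <= T -> Q t <= Q T.
  move=> /andP[t0 tT].
  by apply: (has_derivative_on_nondecreasing dQ) => // s _; exact: sqr_ge0.
have yQ t : 0 <= t <= T -> y t ^+ 2 <= t * Q T.
  move=> tT; apply: le_trans (sqr_primitive_le y0 Q0 dy dQ tT) _.
  by rewrite ler_wpM2l ?QT //; case/andP: tT.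
have gain : concavity_gap P * Q T <= E (fun w => D w T).
  have := expectation_primitive_ge cK muK T0 cf dD _ (has_derivative_onZ (concavity_gap P) dQ).
  rewrite Q0 mulr0 subr0; apply.
    by move=> t; apply: cvgM; [exact: cvg_cst|apply: cvg_enorm_sqr; exact: cdu].
  move=> t tT; have [Ut maxt] := umax t tT.
  have st := state_slice HP cu sx tT; have pt := adjoint_slice HP cu sx ap tT.
  have Uu := cu.2 t tT.
  have := maximizer_gap HP k0 st pt tT Ut maxt Uu.
  rewrite !(hamiltonianE HP st pt tT) // enorm_distrC => H.
  have c1 := pairing_continuous HP st pt tT Ut; have c2 := pairing_continuous HP st pt tT Uu.
  have c12 : {within Om P, continuous (fun w => pairing (x t) (p t) (u' t) t w -
      pairing (x t) (p t) (u t) t w)}.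
    by move=> w; apply: cvgB; [exact: c1|exact: c2].
  have c3 : {within Om P, continuous
      (fun=> beta P * (enorm (u' t) ^+ 2 - enorm (u t) ^+ 2) : R)}.
    by move=> w; exact: cvg_cst.
  rewrite /f (expectationB cK muK c12 c3) (expectationB cK muK c1 c2).
  rewrite (expectation_cst cK muK); apply: le_trans H _.
  by rewrite le_eqVlt; apply/orP; left; apply/eqP; ring.
have loss w : Om P w -> J' w T <= J w T - D w T + C_E P * Q T.
  move=> Ow; have [J0 dJw] := dJ w Ow; have [J'0 dJ'w] := dJ' w Ow; have [D0 dDw] := dD w Ow.
  have dx := state_derivative HP cu sx Ow; have dx' := state_derivative HP cu' sx' Ow.
  have dp := adjoint_derivative HP cu sx ap Ow.
  (* The quantity followed is [J' - J - p . (x' - x) + D]. Its dot product vanishes at time 0, where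
     the states agree, and at time [T], where [p] is 0. *)
  have dl := has_derivative_onD (has_derivative_onB (has_derivative_onB dJ'w dJw)
    (has_derivative_on_dot dp (has_derivative_onB dx' dx))) dDw.
  (* [c1] weighs [y y'], from the change of [A] paired with [p]; [c2] weighs [t Q(T)], from the
     tracking term. [dr] differentiates the corresponding primitives. *)
  pose c1 := M_P P * G_A P * C_X P; pose c2 := alpha P * spnorm (C P) ^+ 2 * C_X P ^+ 2.
  have dr := has_derivative_onD (has_derivative_onZ (c1 / 2) (has_derivative_on_sqr dy))
    (has_derivative_onZ (c2 * Q T / 2) (has_derivative_on_sqr (has_derivative_on_id T))).
  have := has_derivative_on_le dl dr (lexx 0) T0 (lexx T).
  rewrite (state_init sx Ow) (state_init sx' Ow) (adjoint_final ap Ow) J0 J'0 D0 y0.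
  rewrite (subrr (x0 P w)) dot0l dot0r expr0n /= !mulr0 !subr0 addr0 !subr0 => H.
  have {H} : J' w T - J w T + D w T <= c1 / 2 * y T ^+ 2 + c2 * Q T / 2 * T ^+ 2.
    apply: H => t tT.
    rewrite /running_cost /f /pairing duality_identity; set dx0 := x' t w - x t w.
    have [Uu Uu'] := (cu.2 t tT, cu'.2 t tT).
    have hx : enorm dx0 <= C_X P * y t := state_stability HP cu cu' sx sx' dy y0 tT Ow.
    have cy0 : 0 <= C_X P * y t by apply: mulr_ge0 (C_X_ge0 HP) (yge t tT).
    have b1 : alpha P * enorm (C P *m dx0) ^+ 2 <= c2 * Q T * t.
      have -> : c2 * Q T * t = alpha P * (spnorm (C P) ^+ 2 * C_X P ^+ 2 * (t * Q T)).
        by rewrite /c2; ring.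
      rewrite ler_wpM2l ?(alpha_ge0 HP) //.
      apply: (@le_trans _ _ ((spnorm (C P) * (C_X P * y t)) ^+ 2)).
        rewrite lerXn2r ?nnegrE ?enorm_ge0 //; first exact: mulr_ge0 (spnorm_ge0 _) cy0.
        by apply: le_trans (enorm_mulmx _ _) _; rewrite ler_wpM2l ?spnorm_ge0.
      have -> : (spnorm (C P) * (C_X P * y t)) ^+ 2 =
          spnorm (C P) ^+ 2 * C_X P ^+ 2 * y t ^+ 2 by ring.
      by rewrite ler_wpM2l ?yQ //; apply: mulr_ge0; exact: sqr_ge0.
    have b2 : - dot (p t w) ((A P t w (u' t) - A P t w (u t)) *m dx0) <=
        c1 * (y t * enorm (u' t - u t)).
      apply: le_trans (ler_norm _) _; rewrite normrN.
      apply: le_trans (dot_norm_le _ _) _.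
      have -> : c1 * (y t * enorm (u' t - u t)) =
          M_P P * (G_A P * enorm (u' t - u t) * (C_X P * y t)) by rewrite /c1; ring.
      apply: ler_pM; rewrite ?enorm_ge0 ?(adjoint_le HP cu sx ap) //.
      apply: le_trans (enorm_mulmx _ _) _; apply: ler_pM; rewrite ?enorm_ge0 ?spnorm_ge0 //.
      by apply: A_lipschitz => //; exact: Om_in.
    apply: le_trans (lerD b1 b2) _.
    by rewrite le_eqVlt; apply/orP; left; apply/eqP; field.
  have c10 : 0 <= c1.
    apply: mulr_ge0 (C_X_ge0 HP); apply: mulr_ge0 (G_A_ge0 P); exact: M_P_ge0.
  have : c1 / 2 * y T ^+ 2 <= c1 / 2 * (T * Q T).
    by rewrite ler_wpM2l ?divr_ge0 // yQ.
  have -> : C_E P * Q T = c1 / 2 * (T * Q T) + c2 * Q T / 2 * T ^+ 2.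
    by rewrite /C_E /c1 /c2; field.
  move: (c1 / 2 * _) (c2 * Q T / 2 * _) => a b c; lra.
have cJ := primitive_family_continuous cK T0 (joint_running_cost HP cu sx) dJ TT.
have cJ' := primitive_family_continuous cK T0 (joint_running_cost HP cu' sx') dJ' TT.
have cD := primitive_family_continuous cK T0 cf dD TT.
have cJD : {within Om P, continuous (fun w => J w T - D w T)}.
  by move=> w; apply: cvgB; [exact: cJ|exact: cD].
have cc : {within Om P, continuous (fun=> C_E P * Q T : R)} by move=> w; exact: cvg_cst.
have cR : {within Om P, continuous (fun w => J w T - D w T + C_E P * Q T)}.
  by move=> w; apply: cvgD; [exact: cJD|exact: cc].
have := expectation_le cK muK cJ' cR loss.
rewrite (expectationD cK muK cJD cc) (expectationB cK muK cJ cD) (expectation_cst cK muK).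
have -> : (concavity_gap P - C_E P) * Q T = concavity_gap P * Q T - C_E P * Q T by ring.
move: gain; move: (E (fun w => D w T)) (E (fun w => J w T)) (E (fun w => J' w T)).
move: (concavity_gap P * Q T) (C_E P * Q T) => a b c e g; lra.
Qed.

End CostDecrease.

(** * Convergence of the iterates *)

Section Descent.
Context {R : realType}.

(** Past an index where [a] comes within [c e] of its infimum, a single step cannot lose [c e] or
    more. *)
Lemma vanishing_decrements (a q : nat -> R) c : 0 < c -> (forall k, 0 <= a k) ->
  (forall k, 0 <= q k) -> (forall k, a k.+1 <= a k - c * q k) ->
  forall e : R, 0 < e -> exists N, forall k, (N <= k)%N -> q k < e.
Proof.
move=> c0 a0 q0 dec e e0.
have lb : has_lbound (range a) by exists 0 => _ [k _ <-].
have hi : has_inf (range a) by split => //; exists (a 0%N); exists 0%N.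
have [_ [N _ <-] aN] := inf_adherent (mulr_gt0 c0 e0) hi.
exists N => k Nk.
have mono i : a (N + i)%N <= a N.
  elim: i => [|i IHi]; first by rewrite addn0.
  rewrite addnS; apply: le_trans (dec _) _; apply: le_trans IHi.
  by rewrite gerBl mulr_ge0 // ltW.
have := mono (k - N)%N; rewrite subnKC // => ak.
have infk : inf (range a) <= a k.+1 by apply: ge_inf => //; exists k.+1.
rewrite -(ltr_pM2l c0); have := dec k; move: (c * q k) (c * e) aN infk ak => u v; lra.
Qed.

(** If [|v t| >= e], the modulus keeps [|v| >= e / 2] on an interval of length
    [min (r / 2) (T / 2)], which costs at least the energy excluded by hypothesis. *)
Lemma small_energy_small m (T : R) (v : R -> 'cV[R]_m) (Q : R -> R) (e r : R) :
  0 < T -> 0 < e -> 0 < r -> has_derivative_on T Q (fun t => enorm (v t) ^+ 2) ->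
  (forall s t, 0 <= s <= T -> 0 <= t <= T -> `|t - s| < r -> enorm (v t - v s) <= e / 2) ->
  Q T - Q 0 < (e / 2) ^+ 2 * Num.min (r / 2) (T / 2) ->
  forall t, 0 <= t <= T -> enorm (v t) < e.
Proof.
move=> T0 e0 r0 dQ hv small t tT; rewrite ltNge; apply/negP => et.
set h := Num.min _ _ in small.
have hr : h <= r / 2 by rewrite ge_min lexx.
have hT : h <= T / 2 by rewrite ge_min lexx orbT.
have h0 : 0 < h by rewrite lt_min !divr_gt0.
(* There is room [T / 2] on at least one side of [t] within the segment. *)
have [a [b [a0 bT ba atb]]] : exists a b : R, [/\ 0 <= a, b <= T, b - a = h & a <= t <= b].
  have [tl|tg] := leP t (T / 2).
    by exists t, (t + h); split; lra.
  by exists (t - h), t; split; lra.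
have ab : a <= b by lra.
have mono s s' : 0 <= s -> s <= s' -> s' <= T -> Q s <= Q s'.
  by apply: (has_derivative_on_nondecreasing dQ) => z _; exact: sqr_ge0.
have := has_derivative_on_le (has_derivative_on_linear T ((e / 2) ^+ 2)) dQ a0 ab bT.
rewrite -mulrBr ba => H.
have {H} : (e / 2) ^+ 2 * h <= Q b - Q a.
  apply: H => s sab; have sT : 0 <= s <= T by lra.
  rewrite lerXn2r ?nnegrE ?enorm_ge0 ?divr_ge0 ?(ltW e0) //.
  have ts : `|t - s| < r.
    by apply: (@le_lt_trans _ _ h); [rewrite ler_norml; apply/andP; split; lra|lra].
  have := hv s t sT tT ts; have := enormD (v t - v s) (v s); rewrite subrK; lra.
have := mono 0 a (lexx 0) a0 (le_trans ab bT); have := mono b T (le_trans a0 ab) bT (lexx T).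
move: small; move: (_ * h) => c; lra.
Qed.

End Descent.

Section Iterates.
Context {R : realType} {d d' m n : nat} (P : problem R d d' m n).
Hypothesis HP : standing_assumptions P.
Hypothesis gap : C_E P < concavity_gap P.

Local Notation T := (hT P).
Local Notation trajectory := (R -> cpath T d -> 'cV[R]_n).
Local Notation E f := (\int[mu P]_(w in Om P) f w).

Let T0 : 0 <= T := T_ge0 HP.

(** Makes [concavity_gap] positive under the hypothesis [gap], hence the Hamiltonian strongly
    concave. *)
Lemma C_E_ge0 : 0 <= C_E P.
Proof.
have CX0 := C_X_ge0 HP.
apply: mulr_ge0; first by apply: mulr_ge0 => //; apply: mulr_ge0.
apply: addr_ge0; first by apply: mulr_ge0 (G_A_ge0 P); exact: M_P_ge0.
apply: mulr_ge0 => //; apply: mulr_ge0 => //.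
by apply: mulr_ge0 (sqr_ge0 _); exact: alpha_ge0.
Qed.

Let gap0 : 0 < concavity_gap P := le_lt_trans C_E_ge0 gap.

Lemma continuous_control_is_control u : continuous_control P u -> is_control P u.
Proof.
move=> [cu uU]; split=> [i|t]; last by rewrite /= in_itv => /uU.
apply: subspace_continuous_measurable_fun => //.
move=> t; have h := cu t.
exact: (@cvg_comp _ _ _ u (fun M => M i 0) _ _ _ h (@coord_continuous _ _ _ _ _ _)).
Qed.

Lemma maximizer_continuous_control u x p u' : continuous_control P u -> is_state P u x ->
  is_adjoint P u x p -> (forall t, 0 <= t <= T -> maximizes_hamiltonian P x p u' t) ->
  continuous_control P u'.
Proof.
move=> cu sx ap umax; split=> [|t /umax[]//].
apply/within_continuousP => t It e e0.
have [r r0 h] := maximizer_equicontinuous HP gap0 e0.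
exists r => // s Is ts; apply: le_lt_trans (norm_le_enorm _) _.
by apply: (h u x p u' cu sx ap umax).
Qed.

Lemma MSA_exists u0 : continuous_control P u0 -> exists u x p, is_MSA P u0 u x p.
Proof.
move=> cu0.
(* Iteration wants a step defined on every function, so a dummy triple is supplied when [u] is not a
   continuous control; the induction in [cu] shows that the iterates avoid this case. *)
have step_ex u : exists z : trajectory * trajectory * (R -> 'cV[R]_m),
    continuous_control P u -> [/\ is_state P u z.1.1, is_adjoint P u z.1.1 z.1.2
      & forall t, 0 <= t <= T -> maximizes_hamiltonian P z.1.1 z.1.2 z.2 t].
  have [cu|ncu] := pselect (continuous_control P u); last first.
    by exists (fun=> fun=> 0, fun=> fun=> 0, u).
  have [x sx] := state_exists HP cu; have [p ap] := adjoint_exists HP cu sx.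
  have /choice[v hv] : forall t, exists v, 0 <= t <= T -> U P v /\ forall v', U P v' ->
      hamiltonian P (x t) (p t) v' t <= hamiltonian P (x t) (p t) v t.
    move=> t; have [tT|ntT] := pselect (0 <= t <= T); last by exists 0.
    by have [v hv] := maximizer_exists HP cu sx ap tT; exists v.
  by exists (x, p, v).
have [step hstep] := choice step_ex.
pose u k := iter k (fun v => (step v).2) u0.
have cu k : continuous_control P (u k).
  elim: k => [//|k IHk]; have [sx ap umax] := hstep _ IHk.
  exact: maximizer_continuous_control sx ap umax.
exists u, (fun k => (step (u k)).1.1), (fun k => (step (u k)).1.2).
split=> // k; have [sx ap umax] := hstep _ (cu k) => //.
Qed.

Definition pairing_sensitivity : R :=
  adjoint_stability_constant P * (M_A P * M_X P + M_B P) + M_P P * (M_A P * (C_X P * T)).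

Lemma expected_pairing_stability v v' y y' q q' e t z :
  continuous_control P v -> continuous_control P v' -> is_state P v y -> is_state P v' y' ->
  is_adjoint P v y q -> is_adjoint P v' y' q' -> 0 <= e ->
  (forall s, 0 <= s <= T -> enorm (v' s - v s) <= e) -> 0 <= t <= T -> U P z ->
  `|E (pairing (y' t) (q' t) z t) - E (pairing (y t) (q t) z t)| <= pairing_sensitivity * e.
Proof.
move=> cv cv' sy sy' aq aq' e0 vv tT Uz.
apply: expected_pairing_dist => //; try exact: state_slice sy _; try exact: state_slice sy' _;
  try exact: adjoint_slice aq _; try exact: adjoint_slice aq' _.
move=> w Ow; rewrite !subrr enorm0 addr0.
rewrite spnorm0.
have hy := state_stability_sup HP cv cv' sy sy' e0 vv tT Ow.
have hq := adjoint_stability HP cv cv' sy sy' aq aq' e0 vv tT Ow.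
have -> : pairing_sensitivity * e =
    adjoint_stability_constant P * e * (M_A P * M_X P + M_B P) +
    M_P P * (M_A P * (C_X P * T * e)) by rewrite /pairing_sensitivity; ring.
have ss0 := state_speed_ge0 HP; have MA0 := MA_ge0 HP; have MP0 := M_P_ge0 HP.
rewrite mul0r addr0; apply: lerD; first by rewrite ler_wpM2r.
by rewrite ler_wpM2l // ler_wpM2l.
Qed.

Variables (u0 : R -> 'cV[R]_m) (u : nat -> R -> 'cV[R]_m) (x p : nat -> trajectory).
Hypothesis cu0 : continuous_control P u0.
Hypothesis msa : is_MSA P u0 u x p.

Let sx k : is_state P (u k) (x k). Proof. by case: msa. Qed.

Let ap k : is_adjoint P (u k) (x k) (p k). Proof. by case: msa. Qed.

Let umax k t : 0 <= t <= T -> maximizes_hamiltonian P (x k) (p k) (u k.+1) t.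
Proof. by case: msa => _ _ _ h tT; apply: h; rewrite /= in_itv. Qed.

Lemma MSA_continuous_control k : continuous_control P (u k).
Proof.
elim: k => [|k IHk]; first by case: msa => ->.
exact: maximizer_continuous_control IHk (sx k) (ap k) (@umax k).
Qed.

Let cu := MSA_continuous_control.

Lemma MSA_equicontinuous (e : R) : 0 < e -> exists2 r : R, 0 < r & forall k s t,
  0 <= s <= T -> 0 <= t <= T -> `|t - s| < r -> enorm (u k t - u k s) < e.
Proof.
move=> e0; have [r r0 h] := maximizer_equicontinuous HP gap0 e0.
have m1 : 0 < m%:R + 1 :> R by rewrite ltr_wpDl.
have [r' r'0 h'] := compact_uniform_continuous (@segment_compact _ _ _) (cu 0%N).1 (divr_gt0 e0 m1).
exists (Num.min r r'); first by rewrite lt_min r0.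
(* [u 0] is no maximizer and brings its own modulus, from uniform continuity on the segment; all
   later iterates share [r]. *)
move=> [|k] s t sT tT; rewrite lt_min => /andP[ts ts'].
  apply: le_lt_trans (enorm_le_norm _) _.
  apply: (@le_lt_trans _ _ ((m%:R + 1) * `|u 0%N t - u 0%N s|)).
    by rewrite ler_wpM2r // lerDl.
  rewrite mulrC -ltr_pdivlMr //; apply: h'; rewrite //= in_itv //.
exact: (h _ _ _ _ (cu k) (sx k) (ap k) (@umax k)).
Qed.

Lemma MSA_increments_vanish (e : R) : 0 < e -> exists N, forall k, (N <= k)%N ->
  forall t, 0 <= t <= T -> enorm (u k.+1 t - u k t) < e.
Proof.
move=> e0.
have /choice[J dJ] : forall k, exists J, cost_primitive (u k) (x k) J.
  move=> k; have cJ := joint_running_cost HP (cu k) (sx k).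
  by have [J dJ] := primitive_family_exists (Om_compact HP) T0 cJ; exists J.
have /choice[Q dQ] : forall k, exists Q, control_distance P (u k) (u k.+1) Q.
  move=> k; have c : {within `[0, T], continuous (fun t => enorm (u k.+1 t - u k t) ^+ 2)}.
    by move=> t; apply: cvg_enorm_sqr; apply: cvgB; [exact: (cu k.+1).1|exact: (cu k).1].
  by have [Q Q0 dQ] := primitive_on T0 c; exists Q.
have Q_ge0 k : 0 <= Q k T.
  have [Q0 dQk] := dQ k; rewrite -Q0.
  by apply: (has_derivative_on_nondecreasing dQk) => // t _; exact: sqr_ge0.
have J_ge0 k : 0 <= E (fun w => J k w T).
  rewrite -(expectation_cst (Om_compact HP) (measure_Om HP) 0).
  apply: (expectation_le (Om_compact HP) (measure_Om HP)) => [w||w Ow].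
  - exact: cvg_cst.
  - apply: (primitive_family_continuous (Om_compact HP) T0
      (joint_running_cost HP (cu k) (sx k)) (dJ k)).
    by rewrite lexx andbT.
  - have [J0 dJw] := dJ k w Ow; rewrite -J0.
    apply: (has_derivative_on_nondecreasing dJw) => // t _.
    by apply: addr_ge0; apply: mulr_ge0 (sqr_ge0 _); apply: ltW; [exact: alpha_gt0|exact: beta_gt0].
have kappa : 0 < concavity_gap P - C_E P by rewrite subr_gt0.
(* Two consecutive iterates of modulus [e / 4] give their difference the [e / 2] asked by
   [small_energy_small]. *)
have e4 : 0 < e / 4 by rewrite divr_gt0.
have [r r0 hr] := MSA_equicontinuous e4.
pose h := Num.min (r / 2) (T / 2).
have h0 : 0 < h by rewrite lt_min !divr_gt0 // (hT_gt0 HP).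
have dec k := cost_decrease HP gap0 (cu k) (cu k.+1) (sx k) (ap k) (sx k.+1) (@umax k)
  (dJ k) (dJ k.+1) (dQ k).
have eh : 0 < (e / 2) ^+ 2 * h by rewrite mulr_gt0 // exprn_gt0 // divr_gt0.
have [N hN] := vanishing_decrements kappa J_ge0 Q_ge0 dec eh.
exists N => k Nk; have [Q0 dQk] := dQ k.
apply: (small_energy_small (hT_gt0 HP) e0 r0 dQk); last by rewrite Q0 subr0; exact: hN.
move=> s t sT tT ts.
have -> : u k.+1 t - u k t - (u k.+1 s - u k s) = (u k.+1 t - u k.+1 s) - (u k t - u k s).
  by rewrite !opprD !opprK addrACA.
apply: le_trans (enormB _ _) _.
by have := hr k s t sT tT ts; have := hr k.+1 s t sT tT ts; lra.
Qed.

Lemma uniform_limit_control (us : R -> 'cV[R]_m) (k : nat -> nat) :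
  (forall t, 0 <= t <= T -> U P (us t)) ->
  (forall e : R, 0 < e -> exists N, forall j, (N <= j)%N ->
     forall t, 0 <= t <= T -> `|us t - u (k j) t| < e) ->
  continuous_control P us.
Proof.
move=> usU lim; split=> //; apply/within_continuousP => t It e e0.
have e3 : 0 < e / 3 by rewrite divr_gt0.
have tT : 0 <= t <= T by move: It; rewrite /= in_itv.
have [N hN] := lim _ e3; have hk := hN N (leqnn N).
have /within_continuousP/(_ t It _ e3)[r r0 h] := (cu (k N)).1.
exists r => // s Is ts; have sT : 0 <= s <= T by move: Is; rewrite /= in_itv.
have := h s Is ts; have := hk t tT; have := hk s sT; rewrite (distrC (us s)) => h1 h2 h3.
have := ler_normD (us t - u (k N) t) (u (k N) t - u (k N) s).
have := ler_normD (us t - u (k N) s) (u (k N) s - us s); rewrite !subrKA; lra.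
Qed.

Lemma limit_maximizes (us : R -> 'cV[R]_m) (xs ps : trajectory) (k : nat -> nat) :
  continuous_control P us -> is_state P us xs -> is_adjoint P us xs ps ->
  (forall i, (i <= k i)%N) ->
  (forall e : R, 0 < e -> exists N, forall j, (N <= j)%N ->
     forall t, 0 <= t <= T -> enorm (us t - u (k j) t) <= e) ->
  forall t, 0 <= t <= T -> maximizes_hamiltonian P xs ps us t.
Proof.
move=> cus sxs aps kge lim t tT; split=> [|v Uv]; first exact: cus.2.
have st := state_slice HP cus sxs tT; have pt := adjoint_slice HP cus sxs aps tT.
(* Three errors of [e / 3]: from the iterate's trajectories to the limit ones at [v], the same at
   [u'], and from [u'] to [us t] in the limit Hamiltonian. *)
apply/ler_addgt0Pr => e e0; have e3 : 0 < e / 3 by rewrite divr_gt0.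
have /within_continuousP/(_ _ (cus.2 t tT) _ e3)[r r0 hH] := hamiltonian_continuous HP st pt tT.
have S1 : 0 < `|pairing_sensitivity| + 1 by rewrite ltr_pwDr.
have r2 : 0 < r / 2 by rewrite divr_gt0.
have [N1 h1] := lim _ (divr_gt0 e3 S1); have [N2 h2] := lim _ r2.
have [N3 h3] := MSA_increments_vanish r2.
(* [N3] has to be passed by [k j], which follows from [k j >= j]; it brings the maximizer
   [u (k j).+1] close to [u (k j)]. *)
pose j := maxn N1 (maxn N2 N3).
have j1 : (N1 <= j)%N by rewrite leq_maxl.
have j2 : (N2 <= j)%N by rewrite /j maxnA leq_max leq_maxr.
have j3 : (N3 <= k j)%N by apply: leq_trans (kge j); rewrite /j !leq_max leqnn !orbT.
have stk := state_slice HP (cu (k j)) (sx (k j)) tT.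
have ptk := adjoint_slice HP (cu (k j)) (sx (k j)) (ap (k j)) tT.
have [Uk maxk] := umax (k j) tT; set u' := u (k j).+1 t in Uk maxk.
have := maxk v Uv; rewrite !(hamiltonianE HP stk ptk tT) // => Hk.
have ee : 0 <= e / 3 / (`|pairing_sensitivity| + 1) by rewrite divr_ge0 // ltW.
have stab z : U P z -> `|E (pairing (xs t) (ps t) z t) -
    E (pairing (x (k j) t) (p (k j) t) z t)| <= e / 3.
  move=> Uz.
  apply: le_trans (expected_pairing_stability (cu (k j)) cus (sx (k j)) sxs (ap (k j)) aps
    ee (h1 j j1) tT Uz) _.
  rewrite mulrCA ger_pMr // ler_pdivrMr // mul1r.
  by apply: le_trans (ler_norm _) _; rewrite lerDl.
have close : `|us t - u'| < r.
  rewrite [r]splitr -(subrKA (u (k j) t)); apply: le_lt_trans (ler_normD _ _) _.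
  apply: ler_ltD; first exact: le_trans (norm_le_enorm _) (h2 j j2 t tT).
  by rewrite distrC; apply: le_lt_trans (norm_le_enorm _) (h3 _ j3 t tT).
have := hH u' Uk close; have := stab v Uv; have := stab u' Uk.
rewrite !(hamiltonianE HP st pt tT) //; last exact: cus.2.
move: Hk; rewrite ltr_norml !ler_norml => Hk /andP[a1 a2] /andP[b1 b2] /andP[d1 d2].
move: Hk a1 a2 b1 b2 d1 d2.
move: (E (pairing (x (k j) t) (p (k j) t) v t)) (E (pairing (x (k j) t) (p (k j) t) u' t)).
move: (E (pairing (xs t) (ps t) v t)) (E (pairing (xs t) (ps t) u' t)).
move: (E (pairing (xs t) (ps t) (us t) t)).
move: (E (fun w => alpha P * enorm (C P *m x (k j) t w - F P w t) ^+ 2)).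
move: (E (fun w => alpha P * enorm (C P *m xs t w - F P w t) ^+ 2)).
move: (beta P * enorm v ^+ 2) (beta P * enorm u' ^+ 2) (beta P * enorm (us t) ^+ 2).
by move=> ? ? ? ? ? ? ? ? ? ?; lra.
Qed.

(** Only the controls are extracted by compactness. [xs] and [ps] are solved for the limit control,
    and the stability estimates carry uniform convergence over to states and adjoints, so no
    differential equation is passed to the limit. *)
Lemma MSA_subsequence_limit :
  exists (k : nat -> nat) (us : R -> 'cV[R]_m) (xs ps : trajectory),
    [/\ {homo k : i j / (i < j)%N},
        {uniform `[0, T], (fun j => u (k j)) @ \oo --> us},
        {uniform `[0, T] `*` Om P,
           (fun j z => x (k j) z.1 z.2) @ \oo --> (fun z => xs z.1 z.2)}
      & {uniform `[0, T] `*` Om P,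
           (fun j z => p (k j) z.1 z.2) @ \oo --> (fun z => ps z.1 z.2)}] /\
    [/\ is_control P us, is_state P us xs, is_adjoint P us xs ps
      & forall t, 0 <= t <= T -> maximizes_hamiltonian P xs ps us t].
Proof.
have [||k [us [kinc usU lim]]] := equicontinuous_subsequence T0 (U_compact HP) (u := u).
- by move=> k; exact: (cu k).2.
- move=> e /MSA_equicontinuous[r r0 h]; exists r => // k s t sT tT st.
  by apply: le_lt_trans (norm_le_enorm _) _; exact: h.
have cus := uniform_limit_control usU lim.
have [xs sxs] := state_exists HP cus; have [ps aps] := adjoint_exists HP cus sxs.
have elim (e : R) : 0 < e -> exists N, forall j, (N <= j)%N ->
    forall t, 0 <= t <= T -> enorm (us t - u (k j) t) <= e.
  move=> e0; have m1 : 0 < m%:R + 1 :> R by rewrite ltr_wpDl.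
  have [N h] := lim _ (divr_gt0 e0 m1); exists N => j /h{}h t /h; rewrite ltr_pdivlMr // => /ltW.
  apply: le_trans; apply: le_trans (enorm_le_norm _) _.
  by rewrite mulrC ler_wpM2l // lerDl.
have kge i : (i <= k i)%N by elim: i => // i IHi; exact: leq_ltn_trans IHi (kinc _ _ (ltnSn i)).
have unif (y : nat -> trajectory) (ys : trajectory) K :
    (forall j e t w, 0 <= e -> (forall s, 0 <= s <= T -> enorm (us s - u (k j) s) <= e) ->
       0 <= t <= T -> Om P w -> enorm (ys t w - y j t w) <= K * e) ->
    {uniform `[0, T] `*` Om P, (fun j z => y j z.1 z.2) @ \oo --> (fun z => ys z.1 z.2)}.
  move=> hy; apply: uniform_cvg_dist => e e0; have K1 : 0 < `|K| + 1 by rewrite ltr_pwDr.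
  have c0 : 0 < e / (`|K| + 1) by rewrite divr_gt0.
  have [N h] := elim _ c0; exists N => j Nj [t w] [It Ow] /=.
  have tT : 0 <= t <= T by move: It; rewrite /= in_itv.
  apply: le_lt_trans (norm_le_enorm _) _.
  apply: le_lt_trans (hy j _ t w (ltW c0) (h j Nj) tT Ow) _.
  rewrite mulrCA gtr_pMr // ltr_pdivrMr // mul1r.
  by apply: le_lt_trans (ler_norm _) _; rewrite ltrDl.
exists k, us, xs, ps; split; split.
- exact: kinc.
- apply: uniform_cvg_dist => e /lim[N h]; exists N => j /h{}h t It.
  by apply: h; move: It; rewrite /= in_itv.
- apply: (unif (fun j => x (k j)) xs (C_X P * T)) => j e t w e0 h tT Ow.
  exact: (state_stability_sup HP (cu (k j)) cus (sx (k j)) sxs e0 h tT Ow).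
- apply: (unif (fun j => p (k j)) ps (adjoint_stability_constant P)) => j e t w e0 h tT Ow.
  exact: (adjoint_stability HP (cu (k j)) cus (sx (k j)) sxs (ap (k j)) aps e0 h tT Ow).
- exact: continuous_control_is_control.
- by [].
- by [].
- exact: limit_maximizes.
Qed.

End Iterates.

(** Existence of a run is stated apart, so that the second part, about every run whatever maximizers
    are chosen, is not vacuous. The maximum condition is obtained at every time of the segment. *)
Theorem theorem4p1 (R : realType) (d d' m n : nat) (P : problem R d d' m n)
    (HP : standing_assumptions P) (Hbeta : beta0 P < beta P)
    (u0 : R -> 'cV[R]_m)
    (u0_continuous : {within `[0, hT P], continuous u0})
    (u0_U : forall t : R, 0 <= t <= hT P -> U P (u0 t)) :
  (exists u x p, is_MSA P u0 u x p) /\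
  (forall u x p, is_MSA P u0 u x p ->
     (forall k, {within `[0, hT P], continuous (u k)} /\ is_control P (u k)) /\
     (exists (k : nat -> nat) (us : R -> 'cV[R]_m)
             (xs ps : R -> cpath (hT P) d -> 'cV[R]_n),
        [/\ {homo k : i j / (i < j)%N},
            {uniform `[0, hT P], (fun j => u (k j)) @ \oo --> us},
            {uniform `[0, hT P] `*` Om P,
               (fun j z => x (k j) z.1 z.2) @ \oo --> (fun z => xs z.1 z.2)}
          & {uniform `[0, hT P] `*` Om P,
               (fun j z => p (k j) z.1 z.2) @ \oo --> (fun z => ps z.1 z.2)}] /\
        [/\ is_control P us,
            is_state P us xs,
            is_adjoint P us xs ps
          & {ae lebesgue_measure, forall t : R, 0 <= t <= hT P ->
               maximizes_hamiltonian P xs ps us t}])).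
Proof.
(* [beta0 - C_E] is exactly what [concavity_gap] subtracts from [beta]. *)
have gap : C_E P < concavity_gap P.
  have -> : concavity_gap P = beta P - (beta0 P - C_E P).
    by rewrite /concavity_gap /beta0; field.
  by move: Hbeta; move: (beta0 P) (beta P) (C_E P) => a b c; lra.
have cu0 : continuous_control P u0 by [].
split=> [|u x p msa]; first exact: MSA_exists.
split=> [k|].
  have cu := MSA_continuous_control HP gap cu0 msa k.
  by split; [exact: cu.1|exact: continuous_control_is_control].
have [k [us [xs [ps [lims [cus sxs aps maxs]]]]]] := MSA_subsequence_limit HP gap cu0 msa.
exists k, us, xs, ps; split=> //; split=> //.
exact: aeW.
Qed.
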